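(* Let $\psi\in(0,\pi)$, $f\in L^2(\mathbb S^2)$ and $g=\mathcal A_\psi f\in L^2(\mathrm{SO}(3))$. Let $\hat g_n^{j,k}=\frac{2n+1}{8\pi^2}\int_{\mathrm{SO}(3)}g(Q)\,\overline{D_n^{j,k}(Q)}\,dQ$ for $n\in\mathbb N_0$, $j,k\in\{-n,\dots,n\}$. Then \[ f=\sum_{n=0}^\infty\sum_{k=-n}^n\frac{\sum_{j=-n}^n\widetilde P_n^j(0)\,s_j(\psi)\,\hat g_n^{j,k}}{\sum_{j=-n}^n\widetilde P_n^j(0)^2\,s_j(\psi)^2}\,Y_n^k, \] with convergence in $L^2(\mathbb S^2)$.
   Context: $\mathbb S^2$ is the unit sphere in $\mathbb R^3$ with spherical coordinates $\xi(\varphi,\vartheta)=(\cos\varphi\sin\vartheta,\sin\varphi\sin\vartheta,\cos\vartheta)^\top$. Associated Legendre functions $P_n^k(t)=\frac{(-1)^k}{2^n n!}(1-t^2)^{k/2}\frac{d^{n+k}}{dt^{n+k}}(t^2-1)^n$ ($k=0,\dots,n$), normalized $\widetilde P_n^k=\sqrt{\frac{2n+1}{4\pi}\frac{(n-k)!}{(n+k)!}}P_n^k$, $\widetilde P_n^{-k}=(-1)^k\widetilde P_n^k$. Spherical harmonics $Y_n^k(\xi(\varphi,\vartheta))=\widetilde P_n^k(\cos\vartheta)e^{ik\varphi}$. Rotations: $Q(\alpha,\beta,\gamma)=R_3(\alpha)R_2(\beta)R_3(\gamma)$ (zyz Euler angles; $R_3$, $R_2$ the rotations about the third and second coordinate axes)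 with measure $\int_{\mathrm{SO}(3)}g\,dQ=\int_0^{2\pi}\int_0^\pi\int_0^{2\pi}g(Q(\alpha,\beta,\gamma))\sin\beta\,d\alpha\,d\beta\,d\gamma$. Wigner D-functions $D_n^{k,j}(Q(\alpha,\beta,\gamma))=e^{-ik\alpha}d_n^{k,j}(\cos\beta)e^{-ij\gamma}$ with $d_n^{k,j}(t)=\frac{(-1)^{n-j}}{2^n}\sqrt{\frac{(n+k)!(1-t)^{j-k}}{(n-j)!(n+j)!(n-k)!(1+t)^{j+k}}}\left(\frac{d}{dt}\right)^{n-k}\left[(1+t)^{n+j}(1-t)^{n-j}\right]$. With $e_\varphi=(\cos\varphi,\sin\varphi,0)^\top$, the fixed-length arc transform is $\mathcal A_\psi f(Q)=\int_{-\psi}^{\psi}f(Q^{-1}e_\varphi)\,d\varphi$ for $f\in C(\mathbb S^2)$, extended to a bounded operator $L^2(\mathbb S^2)\to L^2(\mathrm{SO}(3))$. Let $s_0(\psi)=2\psi$ and $s_j(\psi)=\frac{2\sin(j\psi)}{j}$ for $j\ne0$. *)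

(* Defs.v *)
From HB Require Import structures.
From mathcomp Require Import all_boot all_order all_algebra.
From mathcomp Require Import all_classical all_reals all_analysis.
From mathcomp Require Import complex.

Set Implicit Arguments.
Unset Strict Implicit.
Unset Printing Implicit Defensive.

Import Order.TTheory GRing.Theory Num.Theory.
Import numFieldNormedType.Exports.

Local Open Scope classical_set_scope.
Local Open Scope ring_scope.

Section Defs.
Variable R : realType.

Definition rc (x : R) : R[i] := Complex x 0.
Definition cexpi (x : R) : R[i] := Complex (cos x) (sin x).
Definition sqmod (z : R[i]) : R := complex.Re z ^+ 2 + complex.Im z ^+ 2.

Definition vec3 (a b c : R) : 'cV[R]_3 :=
  \col_(i < 3) (if i == 0 :> nat then a else if i == 1 :> nat then b else c).
Definition mat3 (a b c d e f g h k : R) : 'M[R]_3 :=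
  \matrix_(i < 3, j < 3)
    (if i == 0 :> nat then (if j == 0 :> nat then a else if j == 1 :> nat then b else c)
     else if i == 1 :> nat then (if j == 0 :> nat then d else if j == 1 :> nat then e else f)
     else (if j == 0 :> nat then g else if j == 1 :> nat then h else k)).

Definition S2 : set 'cV[R]_3 := [set x | \sum_(i < 3) x i 0 ^+ 2 = 1].
Definition xi (phi theta : R) : 'cV[R]_3 :=
  vec3 (cos phi * sin theta) (sin phi * sin theta) (cos theta).
Definition e_ (phi : R) : 'cV[R]_3 := vec3 (cos phi) (sin phi) 0.

Definition R3 (a : R) : 'M[R]_3 :=
  mat3 (cos a) (- sin a) 0  (sin a) (cos a) 0  0 0 1.
Definition R2 (b : R) : 'M[R]_3 :=
  mat3 (cos b) 0 (sin b)  0 1 0  (- sin b) 0 (cos b).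
Definition Qe (a b c : R) : 'M[R]_3 := R3 a *m R2 b *m R3 c.

(* associated Legendre functions P_n^k, k = 0..n;
   (1-t^2)^{k/2} is written sqrt(1-t^2)^k (t in [-1,1]) *)
Definition assocP (n k : nat) (t : R) : R :=
  (-1) ^+ k / (2 ^+ n * (n`!)%:R) * Num.sqrt (1 - t ^+ 2) ^+ k
  * (((('X ^+ 2 - 1) ^+ n) : {poly R})^`(n + k)).[t].

Definition nP (n k : nat) (t : R) : R :=
  Num.sqrt ((2 * n%:R + 1) / (4 * pi) * ((n - k)`!)%:R / ((n + k)`!)%:R)
  * assocP n k t.

Definition nPz (n : nat) (k : int) (t : R) : R :=
  if (0 <= k)%R then nP n `|k|%N t else (-1) ^+ `|k|%N * nP n `|k|%N t.

(* spherical harmonics in coordinates: Y_n^k(xi(phi,theta)) *)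
Definition Ysh (n : nat) (k : int) (phi theta : R) : R[i] :=
  rc (nPz n k (cos theta)) * cexpi (k%:~R * phi).

Definition s_ (j : int) (psi : R) : R :=
  if j == 0 then 2 * psi else 2 * sin (j%:~R * psi) / j%:~R.

Definition wd (n : nat) (k j : int) (t : R) : R :=
  (-1) ^+ absz (n%:Z - j) / 2 ^+ n
  * Num.sqrt (((absz (n%:Z + k))`!)%:R * (1 - t) ^ (j - k)
      / (((absz (n%:Z - j))`!)%:R * ((absz (n%:Z + j))`!)%:R * ((absz (n%:Z - k))`!)%:R
         * (1 + t) ^ (j + k)))
  * ((((1 + 'X) ^+ absz (n%:Z + j) * (1 - 'X) ^+ absz (n%:Z - j)) : {poly R})
       ^`(absz (n%:Z - k))).[t].

(* Wigner D-functions in Euler angles: D_n^{k,j}(Q(a,b,c)) *)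
Definition WD (n : nat) (k j : int) (a b c : R) : R[i] :=
  cexpi (- (k%:~R * a)) * rc (wd n k j (cos b)) * cexpi (- (j%:~R * c)).

Definition mu2 := (@lebesgue_measure R \x @lebesgue_measure R)%E.
Definition mu3 := (mu2 \x @lebesgue_measure R)%E.

Definition box2 : set (R * R) :=
  [set p | 0 <= p.1 < 2 * pi /\ 0 <= p.2 <= pi].
Definition box3 : set ((R * R) * R) :=
  [set x | 0 <= x.1.1 < 2 * pi /\ 0 <= x.1.2 <= pi /\ 0 <= x.2 < 2 * pi].

Definition cint d (T : measurableType d) (mu : {measure set T -> \bar R})
  (D : set T) (h : T -> R[i]) : R[i] :=
  Complex (Rintegral mu D (fun x => complex.Re (h x))) (Rintegral mu D (fun x => complex.Im (h x))).

Definition cmeas d (T : measurableType d) (D : set T) (h : T -> R[i]) :=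
  measurable_fun D (fun x => complex.Re (h x)) /\ measurable_fun D (fun x => complex.Im (h x)).

Definition ccontS2 (F : 'cV[R]_3 -> R[i]) :=
  {within S2, continuous (fun x => complex.Re (F x))} /\
  {within S2, continuous (fun x => complex.Im (F x))}.

(* squared L^2 norms: on S^2 (surface measure sin theta dphi dtheta)
   and on SO(3) (measure sin beta dalpha dbeta dgamma) *)
Definition L2S2 (F : 'cV[R]_3 -> R[i]) : \bar R :=
  (\int[mu2]_(p in box2) (sqmod (F (xi p.1 p.2)) * sin p.2)%:E)%E.
Definition L2SO3 (G : 'M[R]_3 -> R[i]) : \bar R :=
  (\int[mu3]_(x in box3) (sqmod (G (Qe x.1.1 x.1.2 x.2)) * sin x.1.2)%:E)%E.

Definition Arc (psi : R) (F : 'cV[R]_3 -> R[i]) (Q : 'M[R]_3) : R[i] :=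
  cint (@lebesgue_measure R) `[- psi, psi]%classic
    (fun phi => F (invmx Q *m e_ phi)).

(* u_m --> 0 in \bar R (u_m are squared L^2 distances) *)
Definition to0 (u : nat -> \bar R) :=
  forall e : R, 0 < e -> exists N : nat, forall m, (N <= m)%N -> (u m < e%:E)%E.

Definition zidx (n : nat) (j : 'I_(2 * n + 1)) : int := j%:Z - n%:Z.

Definition ghat (G : 'M[R]_3 -> R[i]) (n : nat) (j k : int) : R[i] :=
  rc ((2 * n%:R + 1) / (8 * pi ^+ 2)) *
  cint mu3 box3 (fun x => G (Qe x.1.1 x.1.2 x.2)
                         * conjc (WD n j k x.1.1 x.1.2 x.2) * rc (sin x.1.2)).

Definition coef (psi : R) (G : 'M[R]_3 -> R[i]) (n : nat) (k : int) : R[i] :=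
  (\sum_(j < 2 * n + 1) rc (nPz n (zidx j) 0 * s_ (zidx j) psi) * ghat G n (zidx j) k)
  / rc (\sum_(j < 2 * n + 1) (nPz n (zidx j) 0) ^+ 2 * (s_ (zidx j) psi) ^+ 2).

Definition psum (psi : R) (G : 'M[R]_3 -> R[i]) (N : nat) (phi theta : R) : R[i] :=
  \sum_(n < N.+1) \sum_(k < 2 * n + 1)
     coef psi G n (zidx k) * Ysh n (zidx k) phi theta.

End Defs.

(* Main.v *)
(** On the sphere put [u = x + i y], [v = x - i y], so that [u v = 1 - z^2]. Up to
    normalization the harmonics of degree [n] are the coefficients of
    [(v X^2 + 2 z X - u)^n]. A rotation acts on this quadratic polynomial by a
    Moebius substitution in [X], whence the transformation law
    [Y_n^k(Q^-1 x) = sum_j D_n^{j,k}(Q) Y_n^j(x)]. Integrating it along the arc gives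
    [A_psi Y_n^k = sum_j P_n^j(0) s_j(psi) D_n^{j,k}], and the orthogonality relations
    of the D-functions turn this into
    [ghat_n^{j,k} = P_n^j(0) s_j(psi) <f, Y_n^k>], first for finite sums of harmonics
    and then, by Bessel's inequality on both sides, for [f] in L^2. The denominators
    are positive, so the coefficient in the theorem is [<f, Y_n^k>]. Convergence is
    the best approximation property of orthogonal projections, since finite sums of
    harmonics are dense: they form an algebra containing the coordinates, and
    Bernstein polynomials approximate continuous functions on the sphere. *)

Require Import Defs.
From HB Require Import structures.
From mathcomp Require Import all_boot all_order all_algebra.
From mathcomp Require Import all_classical all_reals all_analysis.
From mathcomp Require Import complex ring lra zify measurable_realfun.

Set Implicit Arguments.
Unset Strict Implicit.
Unset Printing Implicit Defensive.

Import Order.TTheory GRing.Theory Num.Theory.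
Import numFieldNormedType.Exports.

Local Open Scope classical_set_scope.
Local Open Scope ring_scope.

(** * Coefficients of powers of a quadratic polynomial *)

Section PolyNumField.
Variable K : numFieldType.
Implicit Types (p q r : {poly K}) (x : K).

(** The Wigner formula [wd] can be singular at [beta = 0] and [beta = pi], through the powers of
    [1 - t] and [1 + t] under its square root, and it does not display any action of rotations. The
    d-functions are therefore introduced anew as matrix entries [dm] of half-angle Moebius maps
    acting on polynomials of degree at most [2n], where the transformation law is immediate and
    continuity in [beta] is visible. The bridge [wd_dm] to the Rodrigues-type formula holds on the
    open interval only; this suffices because the weight [sin beta] vanishes at both ends.
    Orthogonality is proved on the Rodrigues side, with a formal integral of polynomials. The
    harmonics are d-functions with one order equal to zero, so one computation serves both the
    sphere and the rotation group. Only an approximating sequence of continuous functions ties [g]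
    to [f]. These functions are replaced by sums of harmonics uniformly on the sphere, because a
    uniform bound passes through the arc integral pointwise and so controls both L^2 distances with
    the same sum. *)

Lemma poly_all_roots p : (forall x, p.[x] = 0) -> p = 0.
Proof.
move=> p0; apply/eqP/negPn/negP => pn0.
(* In characteristic zero these are [size p] distinct roots, one more than the degree allows. *)
pose s := [seq (i%:R : K) | i <- iota 0 (size p)].
have : (size s < size p)%N.
  apply: max_poly_roots => //; first by apply/allP => x _; rewrite rootE p0.
  by rewrite map_inj_uniq ?iota_uniq// => i j /eqP; rewrite eqr_nat => /eqP.
by rewrite size_map size_iota ltnn.
Qed.

(** Polynomial identities may thus be checked by field computations that divide by [r.[x]]: the
    product [r * (p - q)] vanishes everywhere. *)
Lemma poly_eq_off_roots r p q : r != 0 ->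
  (forall x, r.[x] != 0 -> p.[x] = q.[x]) -> p = q.
Proof.
move=> r0 pq; apply/eqP; rewrite -subr_eq0.
suff /eqP : r * (p - q) = 0 by rewrite mulf_eq0 (negbTE r0).
apply: poly_all_roots => x; rewrite hornerM hornerD hornerN.
have [->|/pq->] := eqVneq r.[x] 0; first by rewrite mul0r.
by rewrite subrr mulr0.
Qed.

(** The substitution [s / x] reverses the coefficients. It serves with [s = 1] to exchange low and
    high coefficients of [quad], and with [s = -1] for the reflection symmetry of [dm]. *)
Lemma coef_reverse N p q (s : K) : s ^+ 2 = 1 -> (size p <= N.+1)%N ->
  (size q <= N.+1)%N -> (forall x, x != 0 -> p.[x] = x ^+ N * q.[s / x]) ->
  forall i, (i <= N)%N -> p`_i = s ^+ (N - i) * q`_(N - i).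
Proof.
move=> s2 sp sq pq i iN.
suff -> : p = \poly_(i < N.+1) (s ^+ (N - i) * q`_(N - i)).
  by rewrite coef_poly ltnS iN.
apply: (@poly_eq_off_roots 'X); first by rewrite polyX_eq0.
move=> x; rewrite hornerX => x0; rewrite pq// horner_poly.
rewrite (horner_coef_wide _ sq) mulr_sumr (reindex_inj rev_ord_inj)/=.
apply: eq_bigr => j _; rewrite subSS.
have jN : (j <= N)%N by rewrite -ltnS.
have -> : x ^+ N = x ^+ (N - j) * x ^+ j by rewrite -exprD subnK.
by rewrite expr_div_n; field; rewrite expf_neq0.
Qed.

Lemma horner_homogenize N p x y : (size p <= N.+1)%N -> y != 0 ->
  \sum_(i < N.+1) p`_i * x ^+ i * y ^+ (N - i) = y ^+ N * p.[x / y].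
Proof.
move=> sp y0; rewrite (horner_coef_wide _ sp) mulr_sumr; apply: eq_bigr => i _.
have iN : (i <= N)%N by rewrite -ltnS.
have -> : y ^+ N = y ^+ (N - i) * y ^+ i by rewrite -exprD subnK.
by rewrite expr_div_n; field; rewrite expf_neq0.
Qed.

Lemma coef_comp_affine p (v z : K) m :
  (p \Po (v *: 'X + z%:P))`_m = v ^+ m * (p^`N(m)).[z].
Proof.
rewrite /comp_poly addrC nderiv_taylor; last exact: mulrC.
rewrite size_map_inj_poly//; last exact: polyC_inj.
under eq_bigr => i _.
  rewrite nderivn_map.
  have -> : (p^`N(i)^:P).[z%:P] = (p^`N(i)).[z]%:P by rewrite horner_map.
  rewrite exprZn -mul_polyC mulrA -polyCM.
  over.
rewrite coef_sum.
under eq_bigr => i _ do rewrite coefCM coefXn.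
have [mp|pm] := ltnP m (size p).
  rewrite (bigD1 (Ordinal mp))//= eqxx big1 ?addr0 ?mulr1 1?mulrC// => i ip.
  by case: eqP => [e|]; rewrite ?mulr0//; case/eqP: ip; apply/val_inj.
rewrite big1 => [|i _].
  suff -> : p^`N(m) = 0 by rewrite horner0 mulr0.
  apply/polyP => j; rewrite coef_nderivn coef0 nth_default ?mul0rn//.
  by rewrite (leq_trans pm)// leq_addr.
case: eqP => [e|]; rewrite ?mulr0//.
by move: (ltn_ord i); rewrite -e ltnNge pm.
Qed.

Definition quad (u v z : K) : {poly K} := v *: 'X^2 + (2 * z) *: 'X - u%:P.

Lemma size_quad u v z : (size (quad u v z) <= 3)%N.
Proof.
apply: leq_trans (size_polyD _ _) _; rewrite geq_max size_polyN.
rewrite (leq_trans (size_polyC_leq1 _))// andbT.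
apply: leq_trans (size_polyD _ _) _; rewrite geq_max.
by rewrite !(leq_trans (size_scale_leq _ _))// ?size_polyXn ?size_polyX.
Qed.

Lemma size_quadX u v z n : (size (quad u v z ^+ n) <= (2 * n).+1)%N.
Proof.
apply: leq_trans (size_poly_exp_leq _ _) _; rewrite ltnS leq_mul2r.
by apply/orP; right; have := size_quad u v z; case: (size _).
Qed.

Lemma horner_quad u v z x : (quad u v z).[x] = v * x ^+ 2 + 2 * z * x - u.
Proof. by rewrite /quad !hornerE. Qed.

(** The polynomial differentiated in Rodrigues' formula for Legendre functions. *)
Definition legq n : {poly K} := ('X^2 - 1) ^+ n.

(** On the sphere [v * quad u v z = (v X + z)^2 - 1], so [v^n quad^n] is [legq n] composed with an
    affine map, and its coefficients are Taylor coefficients at [z]. *)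
Lemma coef_quad_scaled n u v z m : u * v = 1 - z ^+ 2 ->
  v ^+ n * (quad u v z ^+ n)`_m = v ^+ m * ((legq n)^`N(m)).[z].
Proof.
move=> uv; rewrite -coef_comp_affine -coefZ -exprZn; congr (_ : {poly K})`_m.
rewrite /legq rmorphXn /=; congr (_ ^+ n).
rewrite rmorphB/= rmorph1 rmorphXn/= comp_polyX /quad -!mul_polyC.
have := congr1 polyC uv; rewrite polyCM polyCB rmorphXn /= polyC1 => uv'.
rewrite !polyCM; ring: uv'.
Qed.

Lemma coef_quad_high n k u v z : u * v = 1 - z ^+ 2 ->
  (quad u v z ^+ n)`_(n + k) = v ^+ k * ((legq n)^`N(n + k)).[z].
Proof.
move=> uv; have [v0|v0] := eqVneq v 0; last first.
  apply: (mulfI (expf_neq0 n v0)); rewrite coef_quad_scaled//.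
  by rewrite exprD mulrA.
(* For [v = 0], which on the sphere means a pole, [v^n] cannot be cancelled, but [quad] degenerates
   to the affine polynomial [2 z X - u]: only the coefficient of index [n] survives, and it is
   [(2 z)^n]. *)
have z2 : z ^+ 2 = 1.
  by apply/eqP; rewrite eq_sym -subr_eq0 -uv v0 mulr0.
have -> : quad u v z ^+ n = 'X^n \Po ((2 * z) *: 'X + (- u)%:P).
  rewrite rmorphXn/= comp_polyX /quad v0 scale0r add0r polyCN.
  by [].
rewrite coef_comp_affine nderivnXn hornerMn hornerXn.
case: k => [|k]; last first.
  by rewrite bin_small ?v0 ?expr0n ?mul0r ?mulr0//; lia.
rewrite addn0 expr0 mul1r binn subnn expr0 mulr1n mulr1.
have := coef_comp_affine (legq n) 1 z n; rewrite expr1n mul1r => <-.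
have -> : legq n \Po (1 *: 'X + z%:P) = 'X^n * ((2 * z)%:P + 'X) ^+ n.
  rewrite /legq rmorphXn /= -exprMn; congr (_ ^+ n).
  rewrite rmorphB/= rmorph1 rmorphXn/= comp_polyX scale1r.
  have := congr1 polyC z2; rewrite rmorphXn/= polyC1 => z2'.
  by rewrite polyCM; ring: z2'.
by rewrite coefXnM ltnn subnn -horner_coef0 horner_exp !hornerE.
Qed.

Lemma coef_quad_low n k u v z : u * v = 1 - z ^+ 2 -> (k <= n)%N ->
  (quad u v z ^+ n)`_(n - k) = (- u) ^+ k * ((legq n)^`N(n + k)).[z].
Proof.
move=> uv kn; have vu : (- v) * (- u) = 1 - z ^+ 2 by rewrite mulrNN mulrC.
rewrite -(coef_quad_high _ _ vu).
rewrite (@coef_reverse (2 * n) _ (quad (- v) (- u) z ^+ n) 1) ?size_quadX//.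
- by rewrite expr1n mul1r; congr (_`_ _); rewrite mul2n -addnn; lia.
- by rewrite expr1n.
- move=> x x0; rewrite !horner_exp !horner_quad exprM -exprMn; congr (_ ^+ n).
  by field.
- lia.
Qed.

(** Both sides are [B^(2n)] times [quad ^+ n] evaluated at [A / B], which is how a fractional
    substitution acts on polynomials of degree at most [2n]. *)
Lemma comp_quad_homogenize n u v z (A B : {poly K}) : B != 0 ->
  \sum_(i < (2 * n).+1) (quad u v z ^+ n)`_i *: (A ^+ i * B ^+ (2 * n - i))
  = (v *: A ^+ 2 + (2 * z) *: (A * B) - u *: B ^+ 2) ^+ n.
Proof.
move=> B0; apply: (poly_eq_off_roots B0) => x Bx.
have -> : ((v *: A ^+ 2 + (2 * z) *: (A * B) - u *: B ^+ 2) ^+ n).[x]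
    = (v * A.[x] ^+ 2 + 2 * z * (A.[x] * B.[x]) - u * B.[x] ^+ 2) ^+ n.
  by rewrite horner_exp !(hornerD, hornerN, hornerZ, hornerM, horner_exp).
rewrite horner_sum; under eq_bigr => i _.
  rewrite hornerZ hornerM !horner_exp mulrA; over.
rewrite horner_homogenize ?size_quadX// horner_exp exprM -exprMn horner_quad.
by congr (_ ^+ n); field.
Qed.

Lemma vanishing_derivn (c : K) (Q : {poly K}) (p e : nat) : (e <= p)%N ->
  exists Q' : {poly K}, ((('X - c%:P) ^+ p * Q)^`(e)) = ('X - c%:P) ^+ (p - e) * Q'.
Proof.
elim: e => [|e IH] ep; first by exists Q; rewrite subn0.
have [Q' E] := IH (ltnW ep).
exists (Q' *+ (p - e) + ('X - c%:P) * Q'^`()).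
rewrite derivnS E derivM deriv_exp derivXsubC.
have -> : (p - e = (p - e.+1).+1)%N by lia.
by rewrite /= mul1r exprSr [RHS]mulrDr mulrnAr mulrA mulrnAl.
Qed.

Lemma root_derivn (c : K) (Q : {poly K}) (p e : nat) : (e < p)%N ->
  ((('X - c%:P) ^+ p * Q)^`(e)).[c] = 0.
Proof.
move=> ep; have [Q' ->] := vanishing_derivn c Q (ltnW ep).
by rewrite hornerM horner_exp hornerXsubC subrr expr0n subn_eq0 leqNgt ep mul0r.
Qed.

End PolyNumField.

(** * Orthogonality of Jacobi polynomials *)

Section FormalIntegral.
Variable K : numFieldType.
Implicit Types p q : {poly K}.

Definition primitive p : {poly K} :=
  \poly_(i < (size p).+1) (p`_i.-1 / i%:R).

(** The integral over [-1, 1], taken formally so that orthogonality becomes algebra;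
    [Rintegral_poly_cos] compares it with the Lebesgue integral. *)
Definition intp p : K := (primitive p).[1] - (primitive p).[- 1].

Lemma primitiveK p : (primitive p)^`() = p.
Proof.
apply/polyP => i; rewrite coef_deriv coef_poly ltnS.
have [ip|pi] := ltnP i (size p); first by rewrite -[LHS]mulr_natr divfK ?pnatr_eq0.
by rewrite mul0rn nth_default.
Qed.

Lemma intp_deriv p : intp p^`() = p.[1] - p.[- 1].
Proof.
suff [c E] : exists c, p = primitive p^`() + c%:P.
  by rewrite /intp [in RHS]E !hornerE opprD addrACA subrr addr0.
exists (p - primitive p^`())`_0.
apply/eqP; rewrite addrC -subr_eq; apply/eqP/polyP => i; rewrite coefC.
case: i => [|i] //=.
have : (p - primitive p^`())^`()`_i = 0 by rewrite derivB primitiveK subrr coef0.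
rewrite coef_deriv -mulr_natr => /eqP; rewrite mulf_eq0 pnatr_eq0 orbF => /eqP //.
Qed.

Lemma intpD p q : intp (p + q) = intp p + intp q.
Proof.
rewrite -{1}[p]primitiveK -{1}[q]primitiveK -derivD intp_deriv !hornerD /intp.
by rewrite opprD addrACA.
Qed.

Lemma intpZ c p : intp (c *: p) = c * intp p.
Proof.
by rewrite -{1}[p]primitiveK -derivZ intp_deriv !hornerZ /intp mulrBr.
Qed.

Lemma intp0 : intp 0 = 0.
Proof. by rewrite -(scale0r (0 : {poly K})) intpZ mul0r. Qed.

Lemma intp_by_parts p q :
  intp (p^`() * q) = p.[1] * q.[1] - p.[- 1] * q.[- 1] - intp (p * q^`()).
Proof.
by apply/eqP; rewrite eq_sym subr_eq -intpD -derivM intp_deriv !hornerM.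
Qed.

Lemma derivn_comp p a b : p^`(a)^`(b) = p^`(b + a).
Proof. by rewrite /derivn iterD. Qed.

Lemma intp_by_parts_iter p q r :
  (forall e, (e < r)%N ->
    (p^`(r - e.+1)).[1] * (q^`(e)).[1] = 0 /\
    (p^`(r - e.+1)).[- 1] * (q^`(e)).[- 1] = 0) ->
  intp (p^`(r) * q) = (- 1) ^+ r * intp (p * q^`(r)).
Proof.
move=> H; suff G : forall e, (e <= r)%N ->
    intp (p^`(r) * q) = (- 1) ^+ e * intp (p^`(r - e) * q^`(e)).
  by rewrite (G r)// subnn.
elim=> [|e IH] er; first by rewrite subn0 mul1r.
rewrite IH ?(ltnW er)//.
have -> : (r - e = (r - e.+1).+1)%N by lia.
rewrite derivnS intp_by_parts; have [-> ->] := H e er.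
by rewrite subrr sub0r exprS derivnS mulN1r mulrN mulNr.
Qed.

(** Euler's beta integral rescaled to [-1, 1]. Integrating by parts trades a factor [1 - X] for a
    factor [1 + X]; the boundary terms vanish because one of the two factors is zero at each
    endpoint. *)
Lemma intp_beta (l h : nat) :
  intp ((1 + 'X) ^+ l * (1 - 'X) ^+ h)
  = 2 ^+ (l + h).+1 * (l`!)%:R * (h`!)%:R / ((l + h).+1`!)%:R.
Proof.
elim: h l => [|h IH] l.
  have -> : (1 + 'X) ^+ l * (1 - 'X) ^+ 0
      = (l.+1%:R^-1 *: (1 + 'X) ^+ l.+1)^`() :> {poly K}.
    rewrite mulr1 derivZ deriv_exp derivD derivC derivX add0r mul1r -[_ ^+ _ *+ _]scaler_nat.
    by rewrite scalerA mulVf ?scale1r ?pnatr_eq0.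
  rewrite intp_deriv !(hornerZ, horner_exp, hornerD, hornerC, hornerX) subrr expr0n/= mulr0 subr0.
  rewrite addn0 factS natrM fact0.
  by field; rewrite nat1r !pnatr_eq0 -lt0n fact_gt0.
have -> : (1 + 'X) ^+ l * (1 - 'X) ^+ h.+1
    = (l.+1%:R^-1 *: (1 + 'X) ^+ l.+1)^`() * (1 - 'X) ^+ h.+1 :> {poly K}.
  rewrite derivZ deriv_exp derivD derivC derivX add0r mul1r -[_ ^+ _ *+ _]scaler_nat.
  by rewrite scalerA mulVf ?scale1r ?pnatr_eq0.
rewrite intp_by_parts !(hornerZ, horner_exp, hornerD, hornerN, hornerC, hornerX) !subrr !expr0n/=.
rewrite !(mulr0, mul0r) subrr sub0r.
have -> : (l.+1%:R^-1 *: (1 + 'X) ^+ l.+1) * ((1 - 'X) ^+ h.+1)^`()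
    = (- (h.+1%:R / l.+1%:R)) *: ((1 + 'X) ^+ l.+1 * (1 - 'X) ^+ h) :> {poly K}.
  rewrite deriv_exp derivB derivC derivX sub0r mulN1r mulNrn -[_ ^+ _ *+ _]scaler_nat mulrN.
  by rewrite -scalerAl -scalerAr scalerA scaleNr mulrC.
rewrite intpZ IH addSnnS (factS l) (factS h) !natrM.
field; apply/and3P; split; rewrite ?nat1r -?natrD ?nat1r pnatr_eq0//.
by rewrite -lt0n; exact: fact_gt0.
Qed.

(* Two ways of reading the coefficient of [v^h w^m] in
   [(a + b w + v (a w - b))^N]. *)
Lemma coef_transpose (a b : K) N h m : (h <= N)%N -> (m <= N)%N ->
  ((a%:P + b *: 'X) ^+ (N - h) * (a *: 'X - b%:P) ^+ h)`_m *+ 'C(N, h)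
  = ((a%:P - b *: 'X) ^+ (N - m) * (a *: 'X + b%:P) ^+ m)`_h *+ 'C(N, m).
Proof.
move=> hN mN.
have H (P Q : {poly K}) k : (k <= N)%N ->
    ((P%:P + 'X * Q%:P) ^+ N)`_k = P ^+ (N - k) * Q ^+ k *+ 'C(N, k).
  move=> kN; rewrite exprDn coef_sum (bigD1 (Ordinal (kN : (k < N.+1)%N)))//=.
  rewrite big1 ?addr0 => [|i ik].
    rewrite coefMn exprMn -!rmorphXn/= mulrCA -rmorphM/= mulrC.
    by rewrite coefCM coefXn eqxx mulr1.
  rewrite coefMn exprMn -!rmorphXn/= mulrCA -rmorphM/= mulrC coefCM coefXn.
  by rewrite eq_sym -val_eqE/= in ik; rewrite (negbTE ik) mulr0 mul0rn.
pose F : {poly {poly K}} :=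
  ((a%:P + b *: 'X)%:P + 'X * (a *: 'X - b%:P)%:P) ^+ N.
have E : swapXY F = ((a%:P - b *: 'X)%:P + 'X * (a *: 'X + b%:P)%:P) ^+ N.
  rewrite /F rmorphXn/=; congr (_ ^+ N).
  rewrite rmorphD rmorphM/= swapXY_X !swapXY_polyC !rmorphD !rmorphN /=.
  rewrite !linearZ /= map_polyC map_polyX /= -!mul_polyC !polyCM !map_polyC /=.
  by move: ('X%:P) ('X) (a%:P%:P) (b%:P%:P) => X Y A B; ring.
by rewrite -!coefMn -!H// -/F -E coef_swapXY.
Qed.

(** Its derivatives are Jacobi polynomials times powers of [1 + X] and [1 - X], by Rodrigues'
    formula. *)
Definition jac (l h : nat) : {poly K} := (1 + 'X) ^+ l * (1 - 'X) ^+ h.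

Lemma size_jac l h : (size (jac l h) <= (l + h).+1)%N.
Proof.
have s1 : size (1 + 'X : {poly K}) = 2%N by rewrite addrC size_XaddC.
have s2 : size (1 - 'X : {poly K}) = 2%N.
  by rewrite -size_polyN opprB size_XsubC.
have A := size_poly_exp_leq (1 + 'X : {poly K}) l.
have B := size_poly_exp_leq (1 - 'X : {poly K}) h.
rewrite s1 in A; rewrite s2 in B.
apply: leq_trans (size_polyMleq _ _) _; rewrite -subn1 leq_subLR.
by apply: leq_trans (leq_add A B) _; lia.
Qed.

Lemma jac_derivn_m1 l h e : (e < l)%N -> ((jac l h)^`(e)).[- 1] = 0.
Proof.
move=> el; rewrite /jac addrC -[1]opprK -polyC1 -polyCN.
by rewrite root_derivn.
Qed.

Lemma jac_derivn_1 l h e : (e < h)%N -> ((jac l h)^`(e)).[1] = 0.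
Proof.
move=> eh; rewrite /jac mulrC -[1 - 'X]opprB -mulN1r exprMn -mulrA mulrCA.
by rewrite -polyC1 root_derivn.
Qed.

Lemma jac_derivn_top l h :
  (jac l h)^`(l + h) = ((- 1) ^+ h * ((l + h)`!)%:R)%:P.
Proof.
have s1 : size (1 + 'X : {poly K}) = 2%N by rewrite addrC size_XaddC.
have s2 : size (1 - 'X : {poly K}) = 2%N.
  by rewrite -size_polyN opprB size_XsubC.
have sz (p : {poly K}) (k : nat) : size p = 2%N -> size (p ^+ k) = k.+1.
  move=> sp; have := size_exp p k; rewrite sp mul1n => E; rewrite -[in RHS]E.
  by rewrite prednK// lt0n size_poly_eq0 expf_neq0// -size_poly_eq0 sp.
have l1 : lead_coef (1 + 'X : {poly K}) = 1 by rewrite addrC lead_coefXaddC.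
have l2 : lead_coef (1 - 'X : {poly K}) = -1.
  by rewrite -opprB lead_coefN lead_coefXsubC.
have jE : (jac l h)`_(l + h) = (- 1) ^+ h.
  have := lead_coefM ((1 + 'X : {poly K}) ^+ l) ((1 - 'X) ^+ h).
  rewrite !lead_coef_exp l1 l2 expr1n mul1r => <-.
  rewrite lead_coefE size_mul -?size_poly_eq0 ?sz//.
  by rewrite addSn addnS.
apply/polyP => i; rewrite coef_derivn coefC.
case: i => [|i]; first by rewrite addn0 jE ffactnn mulr_natr.
by rewrite nth_default ?mul0rn// (leq_trans (size_jac _ _))//; lia.
Qed.

(** All derivatives are moved to the second factor, which then carries [n + m] of them but has
    degree at most [2m]. For [m < n] it vanishes; for [m = n] it becomes a constant and a beta
    integral remains. *)
Lemma intp_jac_orth n m i i' l h l' h' :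
  (l + h = 2 * n)%N -> (l' + h' = 2 * m)%N -> (n + i' = m + i)%N ->
  (n + h' = m + l)%N -> (i <= 2 * n)%N -> (i' <= 2 * m)%N -> (m <= n)%N ->
  intp ((jac l h)^`(2 * n - i) * (jac l' h')^`(i'))
  = if n == m then (- 1) ^+ (i + h') * 2 ^+ (2 * n).+1 * (l`!)%:R * (h`!)%:R / (2 * n).+1%:R else 0.
Proof.
move=> lh lh' ii hl i_n i'm mn.
rewrite intp_by_parts_iter; last first.
  (* In each boundary term the two derivative orders add up to [n + m - 1], while the orders of
     vanishing of the two factors add up to [n + m] at either endpoint. Hence one factor is zero
     there. *)
  move=> e er; split.
    have [A|A] := ltnP (2 * n - i - e.+1) h.
      by rewrite jac_derivn_1// mul0r.
    by rewrite derivn_comp [X in _ * X]jac_derivn_1 ?mulr0//; lia.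
  have [A|A] := ltnP (2 * n - i - e.+1) l.
    by rewrite jac_derivn_m1// mul0r.
  by rewrite derivn_comp [X in _ * X]jac_derivn_m1 ?mulr0//; lia.
rewrite derivn_comp.
have -> : (2 * n - i + i' = n + m)%N by lia.
case: eqP => [nm|nm]; last first.
  rewrite derivn_poly0 ?mulr0 ?intp0 ?mulr0// (leq_trans (size_jac _ _))//; lia.
subst m; rewrite addnn -mul2n -lh' jac_derivn_top lh' [_ * _%:P]mulrC mul_polyC.
have <- : l = h' by lia.
rewrite intpZ intp_beta lh factS natrM.
have -> : (- 1) ^+ (2 * n - i) = (- 1) ^+ i :> K.
  by rewrite -signr_odd -[RHS]signr_odd oddB// oddM.
rewrite exprD; field.
by rewrite -natrM nat1r !pnatr_eq0 -!lt0n fact_gt0.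
Qed.

End FormalIntegral.

(** * Spherical harmonics and rotations *)

Section ComplexBasics.
Variable R : realType.
Local Notation C := R[i].

HB.instance Definition _ := GRing.RMorphism.copy (@rc R) (real_complex R).

Lemma rc_inj : injective (@rc R).
Proof. by move=> x y []. Qed.

Lemma rc_eq0 (x : R) : (rc x == 0) = (x == 0).
Proof. by rewrite -(inj_eq rc_inj) rmorph0. Qed.

Lemma cexpi0 : cexpi 0 = 1 :> C.
Proof. by rewrite /cexpi cos0 sin0. Qed.

Lemma cexpiD (x y : R) : cexpi (x + y) = cexpi x * cexpi y.
Proof. by rewrite /cexpi cosD sinD; congr Complex; ring. Qed.

Lemma cexpi_neq0 (x : R) : cexpi x != 0.
Proof.
apply/eqP => e0; have := cexpiD x (- x).
by rewrite e0 mul0r subrr cexpi0 => /eqP; rewrite oner_eq0.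
Qed.

Lemma cexpiN (x : R) : cexpi (- x) = (cexpi x)^-1.
Proof.
apply: (mulfI (cexpi_neq0 x)).
by rewrite -cexpiD subrr cexpi0 mulfV// cexpi_neq0.
Qed.

Lemma conjc_cexpi (x : R) : conjc (cexpi x) = cexpi (- x).
Proof. by rewrite /cexpi cosN sinN. Qed.

Lemma conjc_rc (x : R) : conjc (rc x) = rc x.
Proof. by rewrite /rc /= oppr0. Qed.

Lemma cexpiX (x : R) k : cexpi x ^+ k = cexpi (k%:R * x).
Proof.
elim: k => [|k IH]; first by rewrite mul0r cexpi0.
by rewrite exprS IH -cexpiD -natr1; congr cexpi; ring.
Qed.

Lemma cexpi_intX (x : R) (k : int) : cexpi x ^ k = cexpi (k%:~R * x).
Proof.
case: k => k; first by rewrite -exprnP cexpiX.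
by rewrite NegzE -exprnN cexpiX -cexpiN; congr cexpi; rewrite rmorphN/=; ring.
Qed.

Definition uz (x : 'cV[R]_3) : C := Complex (x 0 0) (x 1 0).
Definition vz (x : 'cV[R]_3) : C := Complex (x 0 0) (- x 1 0).
Definition zz (x : 'cV[R]_3) : C := rc (x 2 0).

Lemma S2P (x : 'cV[R]_3) : S2 x <-> x 0 0 ^+ 2 + x 1 0 ^+ 2 + x 2 0 ^+ 2 = 1.
Proof.
rewrite /S2 /= big_ord_recl big_ord_recl big_ord1 addrA.
have -> : lift ord0 (lift ord0 ord0) = 2 :> 'I_3 by apply/val_inj.
by have -> : lift ord0 ord0 = 1 :> 'I_3 by apply/val_inj.
Qed.

Lemma uzvz (x : 'cV[R]_3) : S2 x -> uz x * vz x = 1 - zz x ^+ 2.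
Proof.
move=> /S2P E; rewrite /uz /vz /zz -rmorphXn -(rmorph1 (@rc R)) -rmorphB.
by congr Complex; rewrite -?E /=; ring.
Qed.

Lemma vec3E0 (a b c : R) : vec3 a b c 0 0 = a :> R.
Proof. by rewrite mxE. Qed.
Lemma vec3E1 (a b c : R) : vec3 a b c 1 0 = b :> R.
Proof. by rewrite mxE. Qed.
Lemma vec3E2 (a b c : R) : vec3 a b c 2 0 = c :> R.
Proof. by rewrite mxE. Qed.
Definition vec3E := (vec3E0, vec3E1, vec3E2).

Lemma cV3_eq (x y : 'cV[R]_3) :
  x 0 0 = y 0 0 -> x 1 0 = y 1 0 -> x 2 0 = y 2 0 -> x = y.
Proof.
move=> e0 e1 e2; apply/colP => -[[|[|[|//]]] p].
- by rewrite (_ : Ordinal p = 0); [|apply/val_inj].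
- by rewrite (_ : Ordinal p = 1); [|apply/val_inj].
- by rewrite (_ : Ordinal p = 2); [|apply/val_inj].
Qed.

Lemma mat3_vec (a b c d e f g h k : R) (x : 'cV[R]_3) :
  mat3 a b c d e f g h k *m x
  = vec3 (a * x 0 0 + b * x 1 0 + c * x 2 0)
         (d * x 0 0 + e * x 1 0 + f * x 2 0)
         (g * x 0 0 + h * x 1 0 + k * x 2 0).
Proof.
have e1 : lift ord0 ord0 = 1 :> 'I_3 by apply/val_inj.
have e2 : lift ord0 (lift ord0 ord0) = 2 :> 'I_3 by apply/val_inj.
by apply: cV3_eq; rewrite !vec3E mxE !big_ord_recl big_ord0 addr0 addrA;
  rewrite ?e2 ?e1 !mxE.
Qed.

Lemma R3_vec a (x : 'cV[R]_3) : R3 a *m x =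
  vec3 (cos a * x 0 0 - sin a * x 1 0) (sin a * x 0 0 + cos a * x 1 0) (x 2 0).
Proof. by rewrite /R3 mat3_vec; congr vec3; ring. Qed.

Lemma R2_vec a (x : 'cV[R]_3) : R2 a *m x =
  vec3 (cos a * x 0 0 + sin a * x 2 0) (x 1 0) (- sin a * x 0 0 + cos a * x 2 0).
Proof. by rewrite /R2 mat3_vec; congr vec3; ring. Qed.

Lemma mx3_eq (A B : 'M[R]_3) : (forall x : 'cV_3, A *m x = B *m x) -> A = B.
Proof.
move=> AB; apply/matrixP => i j.
have := AB (delta_mx j 0); rewrite -!colE => /colP/(_ i).
by rewrite !mxE.
Qed.

Lemma R3K (a : R) : R3 (- a) *m R3 a = 1%:M :> 'M[R]_3.
Proof.
apply: mx3_eq => x; rewrite -mulmxA !R3_vec mul1mx cosN sinN.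
have E := cos2sin2 a.
apply: cV3_eq; rewrite !vec3E //; ring: E.
Qed.

Lemma R2K (a : R) : R2 (- a) *m R2 a = 1%:M :> 'M[R]_3.
Proof.
apply: mx3_eq => x; rewrite -mulmxA !R2_vec mul1mx cosN sinN.
have E := cos2sin2 a.
apply: cV3_eq; rewrite !vec3E //; ring: E.
Qed.

Lemma invmx_Qe (a b c : R) : invmx (Qe a b c) = R3 (- c) *m R2 (- b) *m R3 (- a) :> 'M[R]_3.
Proof.
have H : R3 (- c) *m R2 (- b) *m R3 (- a) *m Qe a b c = 1%:M.
  rewrite /Qe !mulmxA -(mulmxA _ (R3 (- a))) R3K mulmx1.
  by rewrite -(mulmxA _ (R2 (- b))) R2K mulmx1 R3K.
have [_ U] := mulmx1_unit H.
by rewrite -[RHS]mulmx1 -(mulmxV U) mulmxA H mul1mx.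
Qed.

Lemma xi_S2 (phi theta : R) : S2 (xi phi theta).
Proof.
apply/S2P; rewrite /xi !vec3E.
have E := cos2sin2 phi; have E' := cos2sin2 theta; ring: E E'.
Qed.

Lemma S2_R3 a (x : 'cV[R]_3) : S2 x -> S2 (R3 a *m x).
Proof.
move=> /S2P e.
have E : x 2 0 ^+ 2 = 1 - x 0 0 ^+ 2 - x 1 0 ^+ 2 by rewrite -e; ring.
apply/S2P; rewrite R3_vec !vec3E.
have E' := cos2sin2 a; ring: E E'.
Qed.

Lemma S2_R2 a (x : 'cV[R]_3) : S2 x -> S2 (R2 a *m x).
Proof.
move=> /S2P e.
have E : x 2 0 ^+ 2 = 1 - x 0 0 ^+ 2 - x 1 0 ^+ 2 by rewrite -e; ring.
apply/S2P; rewrite R2_vec !vec3E.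
have E' := cos2sin2 a; ring: E E'.
Qed.

Lemma e_xi (phi : R) : e_ phi = xi phi (pi / 2).
Proof. by rewrite /e_ /xi sin_pihalf cos_pihalf !mulr1. Qed.

Lemma S2_arc (a b c : R) (phi : R) : S2 (invmx (Qe a b c) *m e_ phi).
Proof.
rewrite invmx_Qe -!mulmxA; apply/S2_R3/S2_R2/S2_R3; rewrite e_xi; exact: xi_S2.
Qed.

End ComplexBasics.

(** * Spherical harmonics as coefficients of powers of a quadratic *)

Section Harmonics.
Variable R : realType.
Local Notation C := R[i].

(** The ratio between a coefficient of [quad ^+ n] and the normalized harmonic. With [i = n + k] the
    two factorials are [(n + k)!] and [(n - k)!], so the value is even in [k]. *)
Definition cnr (n i : nat) : R :=
  2 ^+ n * n`!%:R * Num.sqrt (4 * pi / (2 * n%:R + 1))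
  / Num.sqrt (i`!%:R * (2 * n - i)`!%:R).

Lemma fact_gt0r n : 0 < n`!%:R :> R.
Proof. by rewrite ltr0n fact_gt0. Qed.

Lemma cnr_gt0 n i : 0 < cnr n i.
Proof.
rewrite /cnr divr_gt0 ?mulr_gt0 ?exprn_gt0 ?fact_gt0r// sqrtr_gt0.
  by rewrite divr_gt0 ?mulr_gt0 ?pi_gt0// ltr_wpDl// mulr_ge0.
Qed.

Lemma cnr_neq0 n i : cnr n i != 0. Proof. by rewrite gt_eqF ?cnr_gt0. Qed.

(* [Y_n^k] as a polynomial function of the coordinates. Here and below the order
   [k] in [-n..n] is encoded by the natural number [i = n + k] in [0..2n]. *)
Definition Yx n i (x : 'cV[R]_3) : C :=
  (quad (uz x) (vz x) (zz x) ^+ n)`_(2 * n - i) / rc (cnr n i).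

Lemma legq_rc n m (z : R) :
  ((legq C n)^`N(m)).[rc z] = rc ((legq R n)^`(m)).[z] / rc m`!%:R.
Proof.
have -> : legq C n = map_poly (real_complex R) (legq R n).
  by rewrite /legq rmorphXn/= rmorphB/= rmorph1 map_polyXn.
rewrite nderivn_map horner_map/= nderivn_def hornerMn -mulr_natr rmorphM/=.
by rewrite mulfK// rc_eq0 gt_eqF ?fact_gt0r.
Qed.

(* With [k = |i - n|] both half-ranges of [i] reduce to [assocP n k]. *)
Lemma cnr_assoc n k i (s D : R) : (k <= n)%N -> i = (n + k)%N \/ i = (n - k)%N ->
  Num.sqrt ((2 * n%:R + 1) / (4 * pi) * (n - k)`!%:R / (n + k)`!%:R)
    * ((- 1) ^+ k / (2 ^+ n * n`!%:R) * s ^+ k * D)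
  = (- s) ^+ k * (D / (n + k)`!%:R) / cnr n i.
Proof.
move=> kn ik; have -> : cnr n i = cnr n (n + k).
  case: ik => -> //; rewrite /cnr.
  have -> : (2 * n - (n - k) = n + k)%N by lia.
  have -> : (2 * n - (n + k) = n - k)%N by lia.
  by rewrite [(n - k)`!%:R * _]mulrC.
rewrite /cnr (_ : 2 * n - (n + k) = n - k)%N; last by lia.
have p0 : 0 < pi :> R := pi_gt0 R.
have n0 : 0 < 2 * n%:R + 1 :> R by rewrite ltr_wpDl// mulr_ge0.
have f1 := fact_gt0r (n + k); have f2 := fact_gt0r (n - k).
set F1 := (n + k)`!%:R in f1 *; set F2 := (n - k)`!%:R in f2 *.
have e1 : F1 = Num.sqrt F1 ^+ 2 by rewrite sqr_sqrtr// ltW.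
have cp : 0 <= (2 * n%:R + 1) / (4 * pi) :> R.
  by rewrite divr_ge0 ?(ltW n0)// mulr_ge0// ltW.
have cp' : 0 <= 4 * pi / (2 * n%:R + 1) :> R.
  by rewrite divr_ge0 ?(ltW n0)// mulr_ge0// ltW.
rewrite (sqrtrM _ (mulr_ge0 cp (ltW f2))) (sqrtrM _ cp).
rewrite (sqrtrV (ltW f1)).
rewrite (sqrtrM _ (ltW f1)).
have -> : (2 * n%:R + 1) / (4 * pi) = (4 * pi / (2 * n%:R + 1))^-1 :> R.
  by rewrite invf_div.
rewrite sqrtrV//.
have g1 : Num.sqrt F1 != 0 by rewrite gt_eqF// sqrtr_gt0.
have g2 : Num.sqrt F2 != 0 by rewrite gt_eqF// sqrtr_gt0.
have g3 : Num.sqrt (4 * pi / (2 * n%:R + 1)) != 0 :> R.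
  by rewrite gt_eqF// sqrtr_gt0 divr_gt0 ?mulr_gt0.
have g4 : n`!%:R != 0 :> R by rewrite gt_eqF// fact_gt0r.
rewrite [X in D / X]e1 [(- s) ^+ k]exprNn.
move: (Num.sqrt F1) (Num.sqrt F2) (Num.sqrt (_ / _)) (n`!%:R) g1 g2 g3 g4.
move=> a b c d a0 b0 c0 d0.
have e0 : 2 ^+ n != 0 :> R by rewrite expf_neq0.
move: (2 ^+ n) (s ^+ k) ((- 1) ^+ k) e0 => e f g e0.
by field; rewrite a0 b0 c0 d0 e0.
Qed.

(** Orders [k >= 0] come from the low coefficients, whose factor [(- u)^k] supplies the sign
    [(-1)^k] of [assocP]. Negative orders come from the high ones, where the powers of [v] carry no
    sign, in accordance with the second sign in [nPz]. The range of [theta] makes [sqrt (1 - cos^2)]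
    equal to [sin]. *)
Lemma Ysh_Yx n i (phi theta : R) : (i <= 2 * n)%N -> 0 <= theta <= pi ->
  Ysh n (i%:Z - n%:Z) phi theta = Yx n i (xi phi theta).
Proof.
move=> i2n t0pi; have S := uzvz (xi_S2 phi theta).
have st : Num.sqrt (1 - cos theta ^+ 2) = sin theta.
  by rewrite -sin2cos2 sqrtr_sqr ger0_norm// sin_ge0_pi.
have uE : uz (xi phi theta) = rc (sin theta) * cexpi phi.
  by rewrite /uz /xi !vec3E /rc /cexpi; congr Complex; ring.
have vE : vz (xi phi theta) = rc (sin theta) * cexpi (- phi).
  by rewrite /vz /xi !vec3E /rc /cexpi cosN sinN; congr Complex; ring.
have zE : zz (xi phi theta) = rc (cos theta) by rewrite /zz /xi !vec3E.
rewrite /Yx /Ysh /nPz; have [ni|ni] := leqP n i.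
  have -> : (i%:Z - n%:Z = (i - n)%N%:Z) by lia.
  have -> : (2 * n - i = n - (i - n))%N by lia.
  rewrite coef_quad_low//; last by lia.
  have kn : (i - n <= n)%N by lia.
  rewrite /nP /assocP st (@cnr_assoc n (i - n) i) //; last by left; lia.
  rewrite zE legq_rc uE -mulNr exprMn cexpiX -/(legq R n) -pmulrn.
  by move: (cnr n i) => cn; rewrite !rmorphM !fmorphV !rmorphXn rmorphN /=; ring.
have -> : (i%:Z - n%:Z = - (n - i)%N%:Z) by lia.
rewrite abszN absz_nat ifF; last by lia.
have -> : (2 * n - i = n + (n - i))%N by lia.
rewrite coef_quad_high// zE legq_rc vE exprMn cexpiX /nP /assocP st.
rewrite (@cnr_assoc n (n - i) i); [|lia|right; lia].
rewrite -/(legq R n).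
have -> : (- (n - i)%N%:Z)%:~R * phi = (n - i)%:R * - phi :> R.
  by rewrite rmorphN /= -pmulrn; ring.
have sgn2 : (- 1) ^+ (n - i) * (- 1) ^+ (n - i) = 1 :> C.
  by rewrite -exprMn mulrNN mulr1 expr1n.
move: (cnr n i) => cn; rewrite !rmorphM !fmorphV !rmorphXn !rmorphN rmorph1 /=.
rewrite [(- rc (sin theta)) ^+ _]exprNn.
move: ((- 1) ^+ (n - i)) sgn2 => e; rewrite -expr2 => e2.
by ring: e2.
Qed.

End Harmonics.

(** * The action of rotations on harmonics *)

Section Wigner.
Variable R : realType.
Local Notation C := R[i].

(** [dA / dB] is the Moebius map that a rotation about the second axis induces through stereographic
    projection; the half angle reflects the double cover of the rotation group by SU(2). *)
Definition dA (beta : R) : {poly R} :=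
  cos (beta / 2) *: 'X + (sin (beta / 2))%:P.
Definition dB (beta : R) : {poly R} :=
  (cos (beta / 2))%:P - sin (beta / 2) *: 'X.

(* [d_n^{k,j}(cos beta)] for [i = n + k] and [l = n + j]. The half-angle form has no
   singularity at [beta = 0] and [beta = pi]. *)
Definition dm n i l (beta : R) : R :=
  cnr R n i / cnr R n l * (dA beta ^+ (2 * n - i) * dB beta ^+ i)`_(2 * n - l).

(** The right-hand side is [B^2] times [quad] at [A / B], that is, the Moebius substitution with
    denominators cleared; the half-angle formulas verify it. *)
Lemma quad_R2 beta (x : 'cV[R]_3) :
  let A := map_poly (real_complex R) (dA beta) in
  let B := map_poly (real_complex R) (dB beta) in
  let y := R2 (- beta) *m x in
  quad (uz y) (vz y) (zz y)
  = vz x *: A ^+ 2 + (2 * zz x) *: (A * B) - uz x *: B ^+ 2.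
Proof.
move=> A B y.
have [c2 s2] : cos beta = cos (beta / 2) ^+ 2 - sin (beta / 2) ^+ 2 /\
    sin beta = 2 * cos (beta / 2) * sin (beta / 2).
  have E : beta = beta / 2 + beta / 2 by field.
  by rewrite {1 4}E cosD sinD; split; ring.
have AE : A = rc (cos (beta / 2)) *: 'X + (rc (sin (beta / 2)))%:P.
  by rewrite /A /dA rmorphD/= map_polyZ/= map_polyX map_polyC.
have BE : B = (rc (cos (beta / 2)))%:P - rc (sin (beta / 2)) *: 'X.
  by rewrite /B /dB rmorphB/= map_polyZ/= map_polyX map_polyC.
pose I : C := Complex 0 1.
have uI (w : 'cV[R]_3) : uz w = rc (w 0 0) + I * rc (w 1 0).
  by rewrite /uz /I /rc; congr Complex; ring.
have vI (w : 'cV[R]_3) : vz w = rc (w 0 0) - I * rc (w 1 0).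
  by rewrite /vz /I /rc; congr Complex; ring.
rewrite /quad !uI !vI /zz AE BE /y R2_vec !vec3E cosN sinN s2 c2.
rewrite !(rmorphD, rmorphB, rmorphN, rmorphM, rmorphXn, rmorph1) /=.
have := congr1 (fun t => (rc t)%:P) (cos2sin2 (beta / 2)).
rewrite !(rmorphD, rmorphB, rmorphN, rmorphM, rmorphXn, rmorph1) /=.
rewrite -!mul_polyC.
rewrite !(polyCD, polyCB, polyCN, polyCM) /=.
move: ((rc (cos (beta / 2)))%:P) ((rc (sin (beta / 2)))%:P) => ca sa.
move: ((rc (x 0 0))%:P) ((rc (x 1 0))%:P) ((rc (x 2 0))%:P) (I%:P) => X Y Z J.
move=> E.
ring: E.
Qed.

Lemma dB_neq0 (beta : R) : map_poly (real_complex R) (dB beta) != 0.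
Proof.
rewrite map_poly_eq0; apply/eqP => e.
have e0 := congr1 (fun p : {poly R} => p`_0) e.
have e1 := congr1 (fun p : {poly R} => p`_1) e.
move: e0 e1; rewrite /dB !coefB !coefC !coefZ !coefX /= ?coef0 mulr0 subr0 mulr1.
rewrite sub0r => c0 /eqP; rewrite oppr_eq0 => /eqP s0.
by have /eqP := cos2Dsin2 (beta / 2); rewrite c0 s0 expr0n/= addr0 eq_sym oner_eq0.
Qed.

Lemma Yx_R2 n l (beta : R) (x : 'cV[R]_3) : (l <= 2 * n)%N ->
  Yx n l (R2 (- beta) *m x)
  = \sum_(i < (2 * n).+1) rc (dm n i l beta) * Yx n i x.
Proof.
move=> ln; rewrite {1}/Yx quad_R2 -(comp_quad_homogenize _ _ _ _ _ (dB_neq0 beta)).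
rewrite coef_sum mulr_suml (reindex_inj rev_ord_inj)/=; apply: eq_bigr => i _.
have i2n : (i <= 2 * n)%N by rewrite -ltnS.
rewrite subSS subKn// coefZ -!rmorphXn -rmorphM/= coef_map /Yx /dm /=.
move: (cnr_neq0 R n i) (cnr_neq0 R n l); rewrite -!(rc_eq0 (cnr _ _ _)).
move: (cnr R n i) (cnr R n l) => a b a0 b0.
rewrite !rmorphM fmorphV /=.
move: (rc a) (rc b) a0 b0 => {}a {}b a0 b0.
rewrite -[(_ `_ (2 * n - l))%:C%C]/(rc _).
move: (rc (_`_ _)) ((quad _ _ _ ^+ n : {poly C})`_ _) => p q.
by field; rewrite a0 b0.
Qed.

(** The rotation multiplies [u] by [e^(ia)] and [v] by [e^(-ia)], which amounts to replacing [X] by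
    [e^(-ia) X] in [quad] and multiplying by [e^(ia)]. The coefficient of index [2n - l] of the
    [n]-th power thus gains [e^(ia(n - (2n - l)))]. *)
Lemma Yx_R3 n l (a : R) (x : 'cV[R]_3) : (l <= 2 * n)%N ->
  Yx n l (R3 a *m x) = cexpi ((l%:Z - n%:Z)%:~R * a) * Yx n l x.
Proof.
move=> ln; rewrite /Yx mulrA; congr (_ / _).
set y := R3 a *m x.
have uE : uz y = cexpi a * uz x.
  by rewrite /uz /y R3_vec !vec3E /cexpi; congr Complex; ring.
have vE : vz y = cexpi (- a) * vz x.
  by rewrite /vz /y R3_vec !vec3E /cexpi cosN sinN; congr Complex; ring.
have zE : zz y = zz x by rewrite /zz /y R3_vec !vec3E.
have -> : quad (uz y) (vz y) (zz y)
    = cexpi a *: (quad (uz x) (vz x) (zz x) \Po (cexpi (- a) *: 'X + 0%:P)).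
  have E : cexpi a * cexpi (- a) = 1 by rewrite -cexpiD subrr cexpi0.
  rewrite /quad rmorphB rmorphD /= !linearZ /= rmorphXn /= comp_polyX.
  rewrite comp_polyC uE vE zE polyC0 addr0 -!mul_polyC !polyCM.
  have := congr1 polyC E; rewrite polyCM polyC1.
  move: ((cexpi a)%:P) ((cexpi (- a))%:P) => s t st.
  by ring: st.
have cX (p q : {poly C}) : (p \Po q) ^+ n = (p ^+ n) \Po q by rewrite rmorphXn.
rewrite exprZn coefZ cX.
rewrite coef_comp_affine horner_coef0 coef_nderivn addn0 binn mulr1n mulrA.
congr (_ * _); rewrite !cexpiX -cexpiD; congr cexpi.
by rewrite rmorphB /= -!pmulrn natrB// natrM; ring.
Qed.

End Wigner.

(** * Wigner d-functions *)

Section WignerOrth.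
Variable R : realType.
Local Notation C := R[i].

(** The non-polynomial factor of [wd], possibly singular at [t = 1] and [t = -1]: in terms of orders
    the exponents are [j - k] and [j + k]. *)
Definition wgt n i l (t : R) : R :=
  Num.sqrt ((1 - t) ^ (l%:Z - i%:Z) / (1 + t) ^ (l%:Z + i%:Z - (2 * n)%:Z)).

Lemma wdE n i l (t : R) : (i <= 2 * n)%N -> (l <= 2 * n)%N -> -1 < t < 1 ->
  wd n (i%:Z - n%:Z) (l%:Z - n%:Z) t
  = (- 1) ^+ (2 * n - l) / 2 ^+ n
    * Num.sqrt (i`!%:R / ((2 * n - l)`!%:R * l`!%:R * (2 * n - i)`!%:R))
    * wgt n i l t * ((jac R l (2 * n - l))^`(2 * n - i)).[t].
Proof.
move=> i2n l2n /andP[t1 t2].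
have p1 : 0 < 1 - t by rewrite subr_gt0.
have p2 : 0 < 1 + t by rewrite -ltrBlDl sub0r.
rewrite /wd /wgt /jac.
have -> : absz (n%:Z - (l%:Z - n%:Z))%R = (2 * n - l)%N by lia.
have -> : absz (n%:Z + (i%:Z - n%:Z))%R = i by lia.
have -> : absz (n%:Z + (l%:Z - n%:Z))%R = l by lia.
have -> : absz (n%:Z - (i%:Z - n%:Z))%R = (2 * n - i)%N by lia.
have -> : l%:Z - n%:Z - (i%:Z - n%:Z) = l%:Z - i%:Z by lia.
have -> : l%:Z - n%:Z + (i%:Z - n%:Z) = l%:Z + i%:Z - (2 * n)%:Z by lia.
congr (_ * _); rewrite -[RHS]mulrA; congr (_ * _).
rewrite -sqrtrM; last by rewrite divr_ge0// !mulr_ge0.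
congr Num.sqrt; rewrite invfM; move: (_ ^ _) (_ ^ _) => a b; ring.
Qed.

(** The symmetry that negates both orders. It comes from the substitution [-1 / X], which exchanges
    [dA] and [dB] up to a factor [X] and a sign. *)
Lemma dm_rev n i l (beta : R) : (i <= 2 * n)%N -> (l <= 2 * n)%N ->
  dm n (2 * n - i) (2 * n - l) beta = (- 1) ^+ (l + i) * dm n i l beta.
Proof.
move=> i2n l2n; rewrite /dm !subKn//.
have cs k : (k <= 2 * n)%N -> cnr R n (2 * n - k) = cnr R n k.
  by move=> k2n; rewrite /cnr subKn// [_ * k`!%:R]mulrC.
rewrite !cs// mulrCA; congr (_ * _).
set p := dA beta ^+ _ * dB beta ^+ _; set q := dA beta ^+ _ * dB beta ^+ _.
have szA : (size (dA beta) <= 2)%N.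
  rewrite (leq_trans (size_polyD _ _))// geq_max.
  rewrite (leq_trans (size_scale_leq _ _)) ?size_polyX//=.
  by rewrite (leq_trans (size_polyC_leq1 _)).
have szB : (size (dB beta) <= 2)%N.
  rewrite (leq_trans (size_polyD _ _))// size_polyN geq_max.
  rewrite (leq_trans (size_polyC_leq1 _))//=.
  by rewrite (leq_trans (size_scale_leq _ _)) ?size_polyX.
have sz a b : (a + b = 2 * n)%N -> (size (dA beta ^+ a * dB beta ^+ b)%R <= (2 * n).+1)%N.
  move=> ab; apply: leq_trans (size_polyMleq _ _) _; rewrite -subn1 leq_subLR.
  have hA := size_poly_exp_leq (dA beta) a.
  have hB := size_poly_exp_leq (dB beta) b.
  apply: leq_trans (leq_add hA hB) _.
  have : ((size (dA beta)).-1 * a <= a)%N by rewrite -[leqRHS]mul1n leq_mul2r; lia.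
  have : ((size (dB beta)).-1 * b <= b)%N by rewrite -[leqRHS]mul1n leq_mul2r; lia.
  lia.
rewrite (@coef_reverse _ (2 * n) p ((- 1) ^+ (2 * n - i) *: q) (- 1)).
- rewrite coefZ mulrA; congr (_ * _).
  rewrite -exprD -(signr_odd _ (l + i)) -(signr_odd _ (2 * n - l + _)).
  by have -> : odd (2 * n - l + (2 * n - i)) = odd (l + i) by lia.
- by rewrite sqrrN expr1n.
- by rewrite sz// subnKC.
- by rewrite (leq_trans (size_scale_leq _ _))// sz// subnK.
- move=> x x0; rewrite hornerZ /p /q !hornerM !horner_exp.
  have -> : x ^+ (2 * n) = x ^+ (2 * n - i) * x ^+ i by rewrite -exprD subnK.
  have -> : (dA beta).[x] = x * (dB beta).[-1 / x].
    by rewrite /dA /dB !(hornerD, hornerN, hornerZ, hornerC, hornerX); field.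
  have -> : (dB beta).[x] = - 1 * (x * (dA beta).[-1 / x]).
    by rewrite /dA /dB !(hornerD, hornerN, hornerZ, hornerC, hornerX); field.
  by rewrite !exprMn; ring.
- exact: l2n.
Qed.


(** The two equations say that both index pairs encode the same orders. Negating the orders of one
    factor inverts its weight, so a product of two d-functions of equal orders, one of them
    reflected by [dm_rev], is a polynomial in [cos beta]. *)
Lemma wgtV n n' i i' l l' (t : R) : -1 < t < 1 ->
  (n + i' = n' + i)%N -> (n + l' = n' + l)%N -> (i' <= 2 * n')%N -> (l' <= 2 * n')%N ->
  wgt n i l t * wgt n' (2 * n' - i') (2 * n' - l') t = 1.
Proof.
move=> /andP[t1 t2] ii ll i2n l2n.
have p1 : 0 < 1 - t by rewrite subr_gt0.
have p2 : 0 < 1 + t by rewrite -ltrBlDl sub0r.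
rewrite /wgt -sqrtrM; last by rewrite divr_ge0// exprz_ge0// ltW.
have -> : (2 * n' - l')%N%:Z - (2 * n' - i')%N%:Z = - (l%:Z - i%:Z) by lia.
have -> : (2 * n' - l')%N%:Z + (2 * n' - i')%N%:Z - (2 * n')%:Z
  = - (l%:Z + i%:Z - (2 * n)%:Z) by lia.
rewrite -!invr_expz.
have a0 : (1 - t) ^ (l%:Z - i%:Z) != 0 by rewrite expfz_neq0// gt_eqF.
have b0 : (1 + t) ^ (l%:Z + i%:Z - (2 * n)%:Z) != 0 by rewrite expfz_neq0// gt_eqF.
move: (_ ^ _) (_ ^ _) a0 b0 => a b a0 b0.
by rewrite -[RHS]sqrtr1; congr Num.sqrt; field; rewrite a0 b0.
Qed.

Lemma half_angle (beta : R) : 0 < beta < pi ->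
  0 < cos (beta / 2) /\ 0 < sin (beta / 2).
Proof.
move=> /andP[b0 bpi]; split.
  by rewrite cos_gt0_pihalf//; apply/andP; split; lra.
by rewrite sin_gt0_pi//; apply/andP; split; lra.
Qed.

Lemma cos_in (beta : R) : 0 < beta < pi -> -1 < cos beta < 1.
Proof.
move=> b; have [c0 s0] := half_angle b.
have -> : cos beta = cos (beta / 2) ^+ 2 - sin (beta / 2) ^+ 2.
  have E : beta = beta / 2 + beta / 2 by field.
  by rewrite {1}E cosD; ring.
have := cos2Dsin2 (beta / 2) => E.
by apply/andP; split; nra.
Qed.

(** In [wd] the exponents come from [l] and the order of differentiation from [i], in [dm] the other
    way round; [coef_transpose] converts one into the other. *)
Lemma wd_dm n i l (beta : R) : (i <= 2 * n)%N -> (l <= 2 * n)%N -> 0 < beta < pi ->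
  wd n (i%:Z - n%:Z) (l%:Z - n%:Z) (cos beta) = dm n i l beta.
Proof.
move=> i2n l2n b; rewrite wdE ?cos_in//.
have [] := half_angle b; rewrite /dm /dA /dB.
have : cos beta = 2 * cos (beta / 2) ^+ 2 - 1 /\ cos (beta / 2) ^+ 2 = 1 - sin (beta / 2) ^+ 2.
  have E : beta = beta / 2 + beta / 2 by field.
  split; last by rewrite cos2sin2.
  by rewrite {1}E cosD -!expr2 sin2cos2; ring.
move: (cos beta) (cos (beta / 2)) (sin (beta / 2)) => t a c [tE ac] a0 c0.
set h := (2 * n - l)%N; set m := (2 * n - i)%N.
have hN : (h <= 2 * n)%N by lia.
have mN : (m <= 2 * n)%N by lia.
have := coef_transpose a c hN mN.
have -> : (2 * n - h = l)%N by lia.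
have -> : (2 * n - m = i)%N by lia.
rewrite [(a%:P - c *: 'X) ^+ i * _]mulrC.
set dI := (_ `_ m); set dJ := (_ `_ h) => tr.
(* With [t = cos beta], the shift of [t] by [2 a c X = sin beta X] turns [1 + t] into
   [2 a (a + c X)] and [1 - t] into [- 2 c (a X - c)]. The derivative is thus a Taylor coefficient
   of a product of powers of these half-angle factors. *)
have T : ((jac R l h)^`(m)).[t] = m`!%:R * ((2 * a) ^+ l * (2 * c) ^+ h * (- 1) ^+ h * dI / (2 * a * c) ^+ m).
  rewrite nderivn_def hornerMn -mulr_natl; congr (_ * _).
  have ac0 : (2 * a * c) ^+ m != 0 by rewrite expf_neq0// !mulf_neq0// gt_eqF.
  apply: (mulfI ac0); rewrite -coef_comp_affine /dI.
  rewrite [RHS]mulrC divfK// -coefZ.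
  congr (_ : {poly R})`_m; rewrite /jac rmorphM !rmorphXn rmorphD rmorphB /=.
  rewrite rmorph1 comp_polyX.
  have e1 : 1 + ((2 * a * c) *: 'X + t%:P) = (2 * a) *: (a%:P + c *: 'X).
    rewrite tE -!mul_polyC !polyCB !polyCM polyC1.
    by move: (a%:P) (c%:P) => A B; ring.
  have e2 : 1 - ((2 * a * c) *: 'X + t%:P) = (2 * c * - 1) *: (a *: 'X - c%:P).
    rewrite tE ac -!mul_polyC !(polyCB, polyCM, polyCN, polyC1).
    by move: (a%:P) (c%:P) => A B; ring.
  rewrite e1 e2 !exprZn -scalerAl -scalerAr scalerA; congr (_ *: _).
  by rewrite mulrA.
have W : wgt n i l t = 2 ^+ n * c ^+ l * a ^+ (2 * n) / (2 ^+ i * c ^+ i * a ^+ l * a ^+ i).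
  rewrite /wgt.
  have -> : 1 - t = 2 * c ^+ 2 by rewrite tE ac; ring.
  have -> : 1 + t = 2 * a ^+ 2 by rewrite tE; ring.
  have a2 : 2 * a ^+ 2 != 0 by rewrite mulf_neq0// expf_neq0// gt_eqF.
  have c2 : 2 * c ^+ 2 != 0 by rewrite mulf_neq0// expf_neq0// gt_eqF.
  rewrite !expfzDr// -!exprnP -!invr_expz -!exprnP.
  have -> : (2 * c ^+ 2) ^+ l / (2 * c ^+ 2) ^+ i /
      ((2 * a ^+ 2) ^+ l * (2 * a ^+ 2) ^+ i / (2 * a ^+ 2) ^+ (2 * n))
      = (2 ^+ n * c ^+ l * a ^+ (2 * n) / (2 ^+ i * c ^+ i * a ^+ l * a ^+ i)) ^+ 2.
    have z2 : (2 : R) ^+ l != 0 by rewrite expf_neq0.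
    have z2' : (2 : R) ^+ i != 0 by rewrite expf_neq0.
    have z2'' : (2 : R) ^+ n != 0 by rewrite expf_neq0.
    have y1 : a ^+ l != 0 by rewrite expf_neq0// gt_eqF.
    have y2 : a ^+ i != 0 by rewrite expf_neq0// gt_eqF.
    have y3 : c ^+ i != 0 by rewrite expf_neq0// gt_eqF.
    have y4 : a ^+ (2 * n) != 0 by rewrite expf_neq0// gt_eqF.
    rewrite !exprMn.
    have -> : (2 : R) ^+ (2 * n) = 2 ^+ n * 2 ^+ n by rewrite mul2n -addnn exprD.
    move: (2 ^+ l) (2 ^+ i) (2 ^+ n) (a ^+ l) (a ^+ i) (a ^+ (2 * n)) (c ^+ l) (c ^+ i) z2 z2' z2'' y1 y2 y3 y4.
    move=> p q r s u v w z p0 q0 r0 s0 u0 v0 w0; field.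
    by rewrite p0 q0 r0 s0 u0 v0 w0.
  by rewrite sqrtr_sqr ger0_norm// divr_ge0// !mulr_ge0// exprn_ge0// ltW.
have dJE : dJ = dI * (m`!%:R * i`!%:R) / (h`!%:R * l`!%:R).
  have Fh := bin_fact hN; have Fm := bin_fact mN.
  have eh : (2 * n - h = l)%N by lia.
  have em : (2 * n - m = i)%N by lia.
  rewrite eh in Fh; rewrite em in Fm.
  have f0 : ((2 * n)`!%:R : R) != 0 by rewrite gt_eqF ?fact_gt0r.
  have {}tr : dI * ('C(2 * n, h))%:R = dJ * ('C(2 * n, m))%:R.
    by rewrite !mulr_natr.
  have := congr1 (fun k => k%:R : R) Fh; have := congr1 (fun k => k%:R : R) Fm.
  rewrite !natrM.
  have := fact_gt0r R h; have := fact_gt0r R l; have := fact_gt0r R m; have := fact_gt0r R i.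
  move: tr f0; move: ('C(2 * n, h)%:R) ('C(2 * n, m)%:R) (h`!%:R) (l`!%:R) (m`!%:R) (i`!%:R) ((2 * n)`!%:R).
  move=> ch cm fh fl fm fi f tr f0 fi0 fm0 fl0 fh0 em' eh'.
  apply: (mulfI f0); rewrite -{1}em' -eh'.
  have -> : cm * (fm * fi) * dJ = (dJ * cm) * (fm * fi) by ring.
  by rewrite -tr; field; rewrite !gt_eqF.
rewrite T W dJE /cnr.
have -> : (2 * n - l = h)%N by []. have -> : (2 * n - i = m)%N by [].
have ih : 0 <= i`!%:R / (h`!%:R * l`!%:R * m`!%:R) :> R by rewrite divr_ge0// !mulr_ge0.
have q0 k : Num.sqrt (k`!%:R : R) != 0 by rewrite gt_eqF// sqrtr_gt0 fact_gt0r.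
have qE k : k`!%:R = Num.sqrt (k`!%:R : R) ^+ 2 by rewrite sqr_sqrtr.
have sM (x y : nat) : Num.sqrt (x`!%:R * y`!%:R) = Num.sqrt (x`!%:R : R) * Num.sqrt (y`!%:R).
  by rewrite sqrtrM.
have -> : Num.sqrt (i`!%:R / (h`!%:R * l`!%:R * m`!%:R))
    = Num.sqrt i`!%:R / (Num.sqrt h`!%:R * Num.sqrt l`!%:R * Num.sqrt m`!%:R) :> R.
  by rewrite sqrtrM// sqrtrV ?mulr_ge0// sqrtrM ?mulr_ge0// sM.
rewrite !sM.
have g3 : Num.sqrt (4 * pi / (2 * n%:R + 1)) != 0 :> R.
  by rewrite gt_eqF// sqrtr_gt0 divr_gt0 ?mulr_gt0 ?pi_gt0// ltr_wpDl// mulr_ge0.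
have g4 : n`!%:R != 0 :> R by rewrite gt_eqF// fact_gt0r.
have e1 : a ^+ (2 * n) = a ^+ i * a ^+ m by rewrite -exprD; congr (_ ^+ _); lia.
have e2 : c ^+ i * c ^+ m = c ^+ l * c ^+ h.
  by rewrite -!exprD; congr (_ ^+ _); lia.
have e3 : (2 : R) ^+ i * 2 ^+ m = 2 ^+ l * 2 ^+ h.
  by rewrite -!exprD; congr (_ ^+ _); lia.
have e4 : (- 1 : R) ^+ h * (- 1) ^+ h = 1 by rewrite -exprMn mulrNN mulr1 expr1n.
have X0 (x : R) k : 0 < x -> x ^+ k != 0 by move=> x0; rewrite expf_neq0 ?gt_eqF.
rewrite e1 !exprMn.
move: (q0 i) (q0 h) (q0 l) (q0 m) (qE i) (qE h) (qE l) (qE m).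
move: (Num.sqrt i`!%:R) (Num.sqrt h`!%:R) (Num.sqrt l`!%:R) (Num.sqrt m`!%:R).
move=> qi qh ql qm qi0 qh0 ql0 qm0 -> -> -> ->.
move: g3 g4 => /=.
move: (Num.sqrt _) (n`!%:R) => g k g0 k0.
have := X0 a i a0; have := X0 a m a0; have := X0 a l a0.
have := X0 c i c0; have := X0 c m c0; have := X0 c l c0; have := X0 c h c0.
have := X0 2 n (ltr0Sn _ 1); have := X0 2 i (ltr0Sn _ 1); have := X0 2 m (ltr0Sn _ 1).
move: e2 e3 e4.
move: (a ^+ i) (a ^+ m) (a ^+ l) (c ^+ i) (c ^+ m) (c ^+ l) (c ^+ h) => ai am al ci cm cl ch.
move: (2 ^+ n) (2 ^+ i) (2 ^+ m) (2 ^+ l) (2 ^+ h) ((- 1) ^+ h) => tn ti tm tl th sg.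
move=> e2 e3 e4 tm0 ti0 tn0 ch0 cl0 cm0 ci0 al0 am0 ai0.
transitivity ((cl * ch) * (tl * th) * (sg * sg) * (qi * qm * dI) / (qh * ql * (ci * cm) * (ti * tm))).
  by field; rewrite ?(qi0, qh0, ql0, qm0, al0, am0, ai0, tn0, ti0, tm0, ci0, cm0).
rewrite -e2 -e3 e4.
by field; rewrite ?(qi0, qh0, ql0, qm0, ti0, tm0, ci0, cm0, tn0, g0, k0).
Qed.

End WignerOrth.

(** * Orthogonality of d-functions and values on the equator *)

Section Orthogonality.
Variable R : realType.
Local Notation C := R[i].

Lemma dm_orth_le n n' i i' l l' : (n' <= n)%N ->
  (n + i' = n' + i)%N -> (n + l' = n' + l)%N ->
  (i <= 2 * n)%N -> (l <= 2 * n)%N -> (i' <= 2 * n')%N -> (l' <= 2 * n')%N ->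
  exists P : {poly R},
    (forall beta, 0 < beta < pi ->
      dm n i l beta * dm n' i' l' beta = P.[cos beta]) /\
    intp P = if n == n' then 2 / (2 * n%:R + 1) else 0.
Proof.
move=> n'n ii ll i2n l2n i2n' l2n'.
(* [c1] is the constant of [wdE] for [(i, l)], and [c2] the one for the reflected pair
   [(2n' - i', 2n' - l')]. *)
pose c1 : R := (- 1) ^+ (2 * n - l) / 2 ^+ n
    * Num.sqrt (i`!%:R / ((2 * n - l)`!%:R * l`!%:R * (2 * n - i)`!%:R)).
pose c2 : R := (- 1) ^+ l' / 2 ^+ n'
    * Num.sqrt ((2 * n' - i')`!%:R / (l'`!%:R * (2 * n' - l')`!%:R * i'`!%:R)).
exists (((- 1) ^+ (l' + i') * c1 * c2) *:
  ((jac R l (2 * n - l))^`(2 * n - i) * (jac R (2 * n' - l') l')^`(i'))); split.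
  move=> beta b; rewrite hornerZ hornerM.
  have : dm n' i' l' beta = (- 1) ^+ (l' + i') * dm n' (2 * n' - i') (2 * n' - l') beta.
    by rewrite dm_rev// mulrA -exprMn mulrNN mulr1 expr1n mul1r.
  have iv : (2 * n' - i' <= 2 * n')%N by lia.
  have lv : (2 * n' - l' <= 2 * n')%N by lia.
  have w1 := @wgtV R n n' i i' l l' _ (cos_in b) ii ll i2n' l2n'.
  rewrite -[dm n' (2 * n' - i') _ beta]wd_dm// -[dm n i l beta]wd_dm// => ->.
  rewrite !wdE ?cos_in// !subKn// -/c1 -/c2.
  move: w1; move: (wgt n i l _) (wgt n' _ _ _) => u v uv.
  rewrite -[RHS]mulr1 -uv; ring.
rewrite intpZ (@intp_jac_orth _ n n' i i' l (2 * n - l) (2 * n' - l') l') ?subnKC ?subnK//.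
case: eqP => [nn|_]; last by rewrite mulr0.
subst n'.
have ei : i' = i by lia. have el : l' = l by lia.
subst i' l'; rewrite /c1 /c2.
have f k : 0 < k`!%:R :> R by exact: fact_gt0r.
have E : Num.sqrt (i`!%:R / ((2 * n - l)`!%:R * l`!%:R * (2 * n - i)`!%:R))
  * Num.sqrt ((2 * n - i)`!%:R / (l`!%:R * (2 * n - l)`!%:R * i`!%:R))
  = ((2 * n - l)`!%:R * l`!%:R)^-1 :> R.
  rewrite -sqrtrM; last by rewrite divr_ge0// !mulr_ge0.
  have := f i; have := f l; have := f (2 * n - i)%N; have := f (2 * n - l)%N.
  move: (i`!%:R) (l`!%:R) ((2 * n - i)`!%:R) ((2 * n - l)`!%:R) => a b c d d0 c0 b0 a0.
  rewrite -[RHS]ger0_norm ?invr_ge0 ?mulr_ge0 ?ltW// -sqrtr_sqr; congr Num.sqrt.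
  by field; rewrite !gt_eqF.
have s1 : (- 1) ^+ (l + i) * (- 1) ^+ (l + i) = 1 :> R.
  by rewrite -exprMn mulrNN mulr1 expr1n.
have s2 : (- 1) ^+ (2 * n - l) * (- 1) ^+ l = 1 :> R.
  by rewrite -exprD subnK// exprM sqrrN !expr1n.
have t2 : (2 : R) ^+ (2 * n).+1 = 2 * (2 ^+ n * 2 ^+ n).
  by rewrite exprS mul2n -addnn exprD.
rewrite [(i + l)%N]addnC t2.
have -> : ((2 * n).+1)%:R = 2 * n%:R + 1 :> R by rewrite -natr1 natrM.
have n0 : 2 * n%:R + 1 != 0 :> R by rewrite gt_eqF// ltr_wpDl// mulr_ge0.
have z : (2 : R) ^+ n != 0 by rewrite expf_neq0.
have := f l; have := f (2 * n - l)%N.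
move: E; move: (Num.sqrt _) (Num.sqrt _) => q p.
move: (l`!%:R) ((2 * n - l)`!%:R) => a b E b0 a0.
move: s1 s2 z; move: ((- 1 : R) ^+ (l + i)) ((- 1 : R) ^+ (2 * n - l)) ((- 1 : R) ^+ l) ((2 : R) ^+ n) => s t u v s1 s2 v0.
transitivity ((s * s) * (t * u) * (p * q) * 2 * a * b / (2 * n%:R + 1)).
  by field; rewrite v0 n0.
by rewrite s1 s2 E; field; rewrite n0 !gt_eqF.
Qed.

Lemma dm_orth n n' i i' l l' :
  (n + i' = n' + i)%N -> (n + l' = n' + l)%N ->
  (i <= 2 * n)%N -> (l <= 2 * n)%N -> (i' <= 2 * n')%N -> (l' <= 2 * n')%N ->
  exists P : {poly R},
    (forall beta, 0 < beta < pi ->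
      dm n i l beta * dm n' i' l' beta = P.[cos beta]) /\
    intp P = if n == n' then 2 / (2 * n%:R + 1) else 0.
Proof.
move=> ii ll i2n l2n i2n' l2n'.
have [nn|nn] := leqP n' n; first exact: dm_orth_le.
have [P [PE PI]] := @dm_orth_le n' n i' i l' l (ltnW nn) (esym ii) (esym ll) i2n' l2n' i2n l2n.
exists P; split; first by move=> beta b; rewrite mulrC PE.
by rewrite PI eq_sym; case: eqP nn => // ->; rewrite ltnn.
Qed.

Definition pole : 'cV[R]_3 := vec3 0 0 1.

Lemma Yx_pole n i : (i <= 2 * n)%N -> Yx n i pole
  = if i == n then rc (Num.sqrt ((2 * n%:R + 1) / (4 * pi))) else 0.
Proof.
move=> i2n; rewrite /Yx /quad.
have -> : uz pole = 0 by rewrite /uz /pole !vec3E.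
have -> : vz pole = 0 by rewrite /vz /pole !vec3E oppr0.
have -> : zz pole = 1 by rewrite /zz /pole !vec3E.
rewrite scale0r add0r polyC0 subr0 mulr1 exprZn coefZ coefXn.
have -> : (2 * n - i == n)%N = (i == n) by lia.
case: eqP => [->|_]; last by rewrite mulr0 mul0r.
rewrite mulr1 /cnr; have -> : (2 * n - n = n)%N by lia.
have f : 0 < n`!%:R :> R by exact: fact_gt0r.
rewrite -expr2 sqrtr_sqr gtr0_norm//.
have -> : (2 * n%:R + 1) / (4 * pi) = (4 * pi / (2 * n%:R + 1))^-1 :> R.
  by rewrite invf_div.
have g : 0 <= 4 * pi / (2 * n%:R + 1) :> R.
  by rewrite divr_ge0 ?mulr_ge0 ?pi_ge0// addr_ge0// mulr_ge0.
rewrite sqrtrV// -(rmorph_nat (@rc R)) -rmorphXn -fmorphV -rmorphM; congr rc.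
have z : (2 : R) ^+ n != 0 by rewrite expf_neq0.
have g0 : Num.sqrt (4 * pi / (2 * n%:R + 1)) != 0 :> R.
  by rewrite gt_eqF// sqrtr_gt0 divr_gt0 ?mulr_gt0 ?pi_gt0// ltr_wpDl// mulr_ge0.
move: (Num.sqrt _) (2 ^+ n) (n`!%:R) g0 z f => p q r p0 q0 r0.
by field; rewrite p0 q0 gt_eqF.
Qed.

(** The point [xi pi beta] is the north pole rotated about the second axis. At the pole only the
    harmonic of order zero is nonzero, so the expansion of [Yx_R2] has a single term. The longitude
    [pi] accounts for the sign. *)
Lemma nPz_dm n l (beta : R) : (l <= 2 * n)%N -> 0 <= beta <= pi ->
  nPz n (l%:Z - n%:Z) (cos beta)
  = (- 1) ^+ (l + n) * (dm n n l beta * Num.sqrt ((2 * n%:R + 1) / (4 * pi))).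
Proof.
move=> l2n b.
have n2n : (n <= 2 * n)%N by lia.
have := Ysh_Yx pi l2n b.
have -> : xi pi beta = R2 (- beta) *m pole.
  apply: cV3_eq; rewrite R2_vec /xi /pole !vec3E ?cospi ?sinpi ?cosN ?sinN; ring.
rewrite Yx_R2// (bigD1 (Ordinal (n2n : (n < (2 * n).+1)%N)))//=.
rewrite big1 ?addr0 => [|i ni]; last first.
  rewrite Yx_pole -1?ltnS//; move: ni; rewrite -val_eqE/= => /negbTE->.
  by rewrite mulr0.
rewrite Yx_pole// eqxx /Ysh -rmorphM /= => E.
have cE : cexpi ((l%:Z - n%:Z)%:~R * pi) = rc ((- 1) ^+ (l + n)) :> C.
  have cp : cexpi pi = - 1 :> C.
    by rewrite /cexpi cospi sinpi; congr Complex; rewrite ?oppr0.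
  rewrite -cexpi_intX cp rmorphXn rmorphN rmorph1.
  have sg (k : nat) : (- 1 : C) ^ (k%:Z) = (- 1) ^+ k by [].
  rewrite expfzDr ?oppr_eq0 ?oner_eq0// -invr_expz !sg exprD.
  by rewrite -exprVn invrN1.
move: E; rewrite cE -rmorphM => /rc_inj E.
rewrite -E mulrCA -exprMn mulrNN mulr1 expr1n mulr1.
by [].
Qed.

Lemma legq_coef_neq0 n j : (j <= n)%N -> (legq R n)`_(2 * j) != 0.
Proof.
move=> jn.
rewrite /legq exprDn coef_sum (bigD1 (Ordinal (leq_subr j n : (n - j < n.+1)%N)))//=.
rewrite big1 ?addr0 => [|i ij].
  rewrite subKn// coefMn -exprM -polyC1 -polyCN -rmorphXn /= coefMC coefXn eqxx.
  by rewrite mul1r -mulr_natr mulf_neq0 ?signr_eq0// pnatr_eq0 -lt0n bin_gt0 leq_subr.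
rewrite coefMn -exprM -polyC1 -polyCN -rmorphXn /= coefMC coefXn.
rewrite (_ : _ == _ = false) ?mul0r ?mul0rn//.
move: ij; rewrite -val_eqE /= => ij; have := ltn_ord i; lia.
Qed.

(** Up to nonzero factors the value at 0 is the coefficient of [X^(n + k)] in [(X^2 - 1)^n], a
    signed binomial coefficient when [n + k] is even. *)
Lemma nPz_eq0_neq0 n j k : (j <= n)%N -> (n + k = 2 * j)%N -> nPz n k%:Z 0 != 0 :> R.
Proof.
move=> jn nk; rewrite /nPz /= /nP /assocP nk !mulf_neq0//.
- have cp : 0 < (2 * n%:R + 1) / (4 * pi) :> R.
    by rewrite divr_gt0 ?mulr_gt0 ?pi_gt0// ltr_wpDl// mulr_ge0.
  by rewrite gt_eqF// sqrtr_gt0 divr_gt0// (mulr_gt0 cp).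
- by rewrite signr_eq0.
- by rewrite expr0n subr0 sqrtr1 expr1n oner_neq0.
- rewrite horner_coef0 coef_derivn addn0 ffactnn -mulr_natr mulf_neq0 ?legq_coef_neq0// pnatr_eq0 -lt0n fact_gt0.
Qed.

(* The denominator cannot vanish: for even [n] the term [j = 0] is positive;
   for odd [n], if [sin (n psi) = 0] then [sin ((n - 2) psi) = +- sin (2 psi)],
   and both vanish only if [psi = pi / 2], where [sin (n psi) = +-1]. *)
Lemma denominator_gt0 n (psi : R) : 0 < psi < pi ->
  0 < \sum_(j < 2 * n + 1) (nPz n (zidx j) 0) ^+ 2 * (s_ (zidx j) psi) ^+ 2.
Proof.
move=> psi0.
have sin0 : 0 < sin psi by exact: sin_gt0_pi.
suff [k [kn N0 s0]] : exists k : nat, [/\ (k <= n)%N, nPz n k%:Z (0 : R) != 0 & s_ k%:Z psi != 0].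
  have kl : (n + k < 2 * n + 1)%N by lia.
  rewrite (bigD1 (Ordinal kl))//=; apply: ltr_pwDl; last first.
    by apply: sumr_ge0 => i _; rewrite mulr_ge0 ?sqr_ge0.
  have -> : zidx (Ordinal kl) = k%:Z by rewrite /zidx /=; lia.
  by rewrite mulr_gt0 ?exprn_even_gt0.
have sE (k : nat) : (0 < k)%N -> sin (k%:R * psi) != 0 -> s_ k%:Z psi != 0.
  move=> k0 sk; rewrite /s_ ifF; last by lia.
  by rewrite -pmulrn !mulf_neq0 ?invr_neq0 ?pnatr_eq0// -lt0n.
have [ne|no] := boolP (~~ odd n).
  exists 0%N; split=> //; first by apply: (@nPz_eq0_neq0 n n./2); lia.
  by rewrite /s_ eqxx mulf_neq0// gt_eqF//; case/andP: psi0.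
rewrite negbK in no.
have [s0|s0] := eqVneq (sin (n%:R * psi)) 0; last first.
  exists n; split=> //; first by apply: (@nPz_eq0_neq0 n n); lia.
  by apply: sE => //; case: (n) no.
have c0 : cos (n%:R * psi) != 0.
  apply/eqP => c0; have := cos2Dsin2 (n%:R * psi).
  by rewrite c0 s0 expr0n addr0 => /eqP; rewrite eq_sym oner_eq0.
have n1 : n != 1%N by apply/eqP => n1; move: s0; rewrite n1 mul1r => /eqP; rewrite gt_eqF.
have n2 : (2 < n)%N by move: no n1; case: (n) => [|[|[]]].
exists (n - 2)%N; split; [lia|by apply: (@nPz_eq0_neq0 n n.-1); lia|].
apply: sE; first lia.
have -> : (n - 2)%:R * psi = n%:R * psi - (psi + psi).
  by rewrite natrB 1?ltnW//; ring.
rewrite sinB s0 mul0r sub0r oppr_eq0 mulf_neq0// sinD.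
have -> : sin psi * cos psi + cos psi * sin psi = 2 * sin psi * cos psi by ring.
rewrite !mulf_neq0 ?(gt_eqF sin0)//; apply/eqP => cpsi.
have S1 : sin psi ^+ 2 = 1 by have := cos2Dsin2 psi; rewrite cpsi expr0n add0r.
have : forall m, sin ((2 * m + 1)%:R * psi) ^+ 2 = 1.
  elim=> [|m IH]; first by rewrite mul1r.
  have -> : (2 * m.+1 + 1)%:R * psi = (2 * m + 1)%:R * psi + (psi + psi).
    by rewrite (_ : 2 * m.+1 + 1 = (2 * m + 1) + 2)%N ?natrD; [ring|lia].
  rewrite sinD sinD cosD cpsi !mul0r !mulr0 addr0 mulr0 addr0 sub0r -expr2 S1.
  by rewrite mulrN1 sqrrN.
move=> /(_ n./2); rewrite (_ : 2 * n./2 + 1 = n)%N; last by lia.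
by rewrite s0 expr0n => /eqP; rewrite eq_sym oner_eq0.
Qed.

End Orthogonality.

(** * Density of spherical harmonics *)

Section HarmonicSpan.
Variable R : realType.
Local Notation C := R[i].
Local Notation V := ('cV[R]_3).

Definition inspan (T : V -> C) := exists s : seq (C * (nat * nat)),
  (forall p, p \in s -> (p.2.2 <= 2 * p.2.1)%N) /\
  forall x, S2 x -> T x = \sum_(p <- s) p.1 * Yx p.2.1 p.2.2 x.

Lemma inspan_ext (T U : V -> C) : (forall x, S2 x -> T x = U x) -> inspan T -> inspan U.
Proof.
by move=> TU [s [sP sE]]; exists s; split => // x Sx; rewrite -TU// sE.
Qed.

Lemma inspan0 : inspan (fun=> 0).
Proof. by exists [::]; split=> // x _; rewrite big_nil. Qed.

Lemma inspanD (T U : V -> C) : inspan T -> inspan U -> inspan (fun x => T x + U x).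
Proof.
move=> [s [sP sE]] [t [tP tE]]; exists (s ++ t); split.
  by move=> p; rewrite mem_cat => /orP[/sP|/tP].
by move=> x Sx; rewrite big_cat/= sE// tE.
Qed.

Lemma inspanZ c (T : V -> C) : inspan T -> inspan (fun x => c * T x).
Proof.
move=> [s [sP sE]]; exists [seq (c * p.1, p.2) | p <- s]; split.
  by move=> p /mapP[q /sP qP ->].
move=> x Sx; rewrite big_map sE// mulr_sumr; apply: eq_bigr => p _.
by rewrite mulrA.
Qed.

Lemma inspanY n i : (i <= 2 * n)%N -> inspan (Yx n i).
Proof.
move=> i2n; exists [:: (1, (n, i))]; split.
  by move=> p; rewrite inE => /eqP->.
by move=> x _; rewrite big_seq1 mul1r.
Qed.

Lemma inspan_sum (I : Type) (r : seq I) (P : pred I) (F : I -> V -> C) :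
  (forall i, P i -> inspan (F i)) -> inspan (fun x => \sum_(i <- r | P i) F i x).
Proof.
move=> FP; elim: r => [|i r IH].
  by apply: inspan_ext inspan0 => x _; rewrite big_nil.
have [Pi|Pi] := boolP (P i).
  by apply: inspan_ext (inspanD (FP i Pi) IH) => x _; rewrite big_cons Pi.
by apply: inspan_ext IH => x _; rewrite big_cons (negbTE Pi).
Qed.

(* [(legq C n)^`N(n + k)] has exact degree [n - k], so these polynomials are a
   basis of the polynomials in [z]. *)
Lemma inspan_poly (w : V -> C) (k : nat) :
  (forall n, (k <= n)%N -> inspan (fun x => w x * ((legq C n)^`N(n + k)).[zz x])) ->
  forall p : {poly C}, inspan (fun x => w x * p.[zz x]).
Proof.
move=> H p; have [d] := ubnP (size p); elim: d p => // d IH p.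
rewrite ltnS => pd.
case: d pd IH => [|d] pd IH.
  apply: inspan_ext inspan0 => x _.
  by move: pd; rewrite leqn0 size_poly_eq0 => /eqP->; rewrite horner0 mulr0.
pose q := (legq C (k + d))^`N(k + d + k).
have szl : size (legq C (k + d)) = (2 * (k + d)).+1.
  have E : legq C (k + d) = ('X^2 - 1%:P) ^+ (k + d) by rewrite polyC1.
  have := size_exp ('X^2 - 1%:P : {poly C}) (k + d).
  rewrite size_XnsubC//= -E => e; rewrite -e prednK// lt0n size_poly_eq0 E.
  by rewrite expf_neq0// -size_poly_eq0 size_XnsubC.
have szq : (size q <= d.+1)%N.
  by rewrite /q /nderivn (leq_trans (size_poly _ _))// szl; lia.
have qd : q`_d != 0.
  rewrite /q coef_nderivn -mulr_natr mulf_neq0//; last first.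
    by rewrite pnatr_eq0 -lt0n bin_gt0 leq_addr.
  have -> : (k + d + k + d = (size (legq C (k + d))).-1)%N by rewrite szl; lia.
  by rewrite -lead_coefE lead_coef_eq0 -size_poly_eq0 szl.
have szr : (size (p - (p`_d / q`_d) *: q)%R <= d)%N.
  apply/leq_sizeP => j; rewrite leq_eqVlt => /orP[/eqP<-|dj].
    by rewrite coefB coefZ divfK// subrr.
  rewrite coefB coefZ nth_default ?(leq_trans pd)// sub0r.
  by rewrite [q`_j]nth_default ?mulr0 ?oppr0// (leq_trans szq).
apply: inspan_ext (inspanD (IH _ szr) (inspanZ (p`_d / q`_d) (H (k + d)%N (leq_addr _ _)))).
move=> x _ /=; rewrite -/q hornerD hornerN hornerZ; ring.
Qed.

Lemma inspan_uz k p : inspan (fun x => uz x ^+ k * p.[zz x]).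
Proof.
apply: (@inspan_poly (fun x => uz x ^+ k) k) => n kn.
have nk : (n + k <= 2 * n)%N by lia.
apply: inspan_ext (inspanZ ((- 1) ^+ k * rc (cnr R n (n + k))) (inspanY nk)) => x Sx.
rewrite /Yx (_ : 2 * n - (n + k) = n - k)%N; last by lia.
rewrite coef_quad_low ?uzvz//.
have c0 : rc (cnr R n (n + k)) != 0 by rewrite rc_eq0 cnr_neq0.
rewrite -[- uz x]mulN1r exprMn.
have s : (- 1) ^+ k * (- 1) ^+ k = 1 :> C by rewrite -exprMn mulrNN mulr1 expr1n.
move: (rc _) ((- 1) ^+ k) c0 s => c e c0 s.
transitivity ((e * e) * (uz x ^+ k * ((legq C n)^`N(n + k)).[zz x])); first by field.
by rewrite s mul1r.
Qed.

Lemma inspan_vz k p : inspan (fun x => vz x ^+ k * p.[zz x]).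
Proof.
apply: (@inspan_poly (fun x => vz x ^+ k) k) => n kn.
have nk : (n - k <= 2 * n)%N by lia.
apply: inspan_ext (inspanZ (rc (cnr R n (n - k))) (inspanY nk)) => x Sx.
rewrite /Yx (_ : 2 * n - (n - k) = n + k)%N; last by lia.
rewrite coef_quad_high ?uzvz//.
by rewrite mulrC divfK// rc_eq0 cnr_neq0.
Qed.

(* Every [Y_n^k] is [u^k p(z)] or [v^|k| p(z)], and [u v = 1 - z^2] on the sphere. *)
Lemma inspan_mul (m : V -> C) :
  (forall k p, inspan (fun x => m x * (uz x ^+ k * p.[zz x]))) ->
  (forall k p, inspan (fun x => m x * (vz x ^+ k * p.[zz x]))) ->
  forall T, inspan T -> inspan (fun x => m x * T x).
Proof.
move=> Hu Hv T [s [sP sE]].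
apply: inspan_ext (inspan_sum s (F := fun p x => m x * (p.1 * Yx p.2.1 p.2.2 x)) (P := fun p => p \in s) _).
  by move=> x Sx; rewrite -big_seq -mulr_sumr sE.
move=> [c [n i]] /sP/= i2n.
have [ni|ni] := leqP n i.
  have := inspanZ (c * (- 1) ^+ (i - n) / rc (cnr R n i)) (Hu (i - n)%N ((legq C n)^`N(n + (i - n)))).
  apply: inspan_ext => x Sx; rewrite /Yx.
  have -> : (2 * n - i = n - (i - n))%N by lia.
  rewrite coef_quad_low ?uzvz//; last by lia.
  by rewrite -[- uz x]mulN1r exprMn; ring.
have := inspanZ (c / rc (cnr R n i)) (Hv (n - i)%N ((legq C n)^`N(n + (n - i)))).
apply: inspan_ext => x Sx; rewrite /Yx.
have -> : (2 * n - i = n + (n - i))%N by lia.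
by rewrite coef_quad_high ?uzvz//; ring.
Qed.

Lemma inspan_mul_zz T : inspan T -> inspan (fun x => zz x * T x).
Proof.
apply: inspan_mul => k p.
  by apply: inspan_ext (inspan_uz k (p * 'X)) => x _; rewrite hornerMX; ring.
by apply: inspan_ext (inspan_vz k (p * 'X)) => x _; rewrite hornerMX; ring.
Qed.

Lemma inspan_mul_uz T : inspan T -> inspan (fun x => uz x * T x).
Proof.
apply: inspan_mul => k p.
  by apply: inspan_ext (inspan_uz k.+1 p) => x _; rewrite exprS mulrA.
case: k => [|k].
  by apply: inspan_ext (inspan_uz 1 p) => x _; rewrite mul1r.
apply: inspan_ext (inspan_vz k ((1 - 'X^2) * p)) => x Sx.
rewrite hornerM hornerD hornerN hornerXn hornerC -uzvz// exprS; ring.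
Qed.

Lemma inspan_mul_vz T : inspan T -> inspan (fun x => vz x * T x).
Proof.
apply: inspan_mul => k p; last first.
  by apply: inspan_ext (inspan_vz k.+1 p) => x _; rewrite exprS mulrA.
case: k => [|k].
  by apply: inspan_ext (inspan_vz 1 p) => x _; rewrite mul1r.
apply: inspan_ext (inspan_uz k ((1 - 'X^2) * p)) => x Sx.
rewrite hornerM hornerD hornerN hornerXn hornerC -uzvz// exprS; ring.
Qed.

Lemma inspan_mul_coord (j : 'I_3) T : inspan T -> inspan (fun x => rc (x j 0) * T x).
Proof.
move=> sT; have [->|[->|->]] : j = 0 \/ j = 1 \/ j = 2.
  case: j => -[|[|[|//]]] p.
  - by left; apply/val_inj.
  - by right; left; apply/val_inj.
  - by right; right; apply/val_inj.
- apply: inspan_ext (inspanZ (2^-1) (inspanD (inspan_mul_uz sT) (inspan_mul_vz sT))).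
  move=> x _; have -> : rc (x 0 0) = (uz x + vz x) / 2.
    have -> : uz x + vz x = rc (x 0 0) * 2.
      by rewrite /uz /vz /rc; congr Complex; ring.
    by rewrite mulfK.
  by field.
- apply: inspan_ext (inspanZ ((2 * Complex 0 1)^-1)
     (inspanD (inspan_mul_uz sT) (inspanZ (- 1) (inspan_mul_vz sT)))).
  move=> x _; have I0 : Complex 0 1 != 0 :> C.
    by apply/eqP => -[/eqP]; rewrite oner_eq0.
  have -> : rc (x 1 0) = (uz x - vz x) / (2 * Complex 0 1).
    have -> : uz x - vz x = rc (x 1 0) * (2 * Complex 0 1).
      by rewrite /uz /vz /rc; congr Complex; ring.
    by rewrite mulfK// mulf_neq0.
  by field.
- exact: inspan_mul_zz.
Qed.

Lemma inspan_const c : inspan (fun=> c).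
Proof.
by apply: inspan_ext (inspan_uz 0 c%:P) => x _; rewrite hornerC mul1r.
Qed.

End HarmonicSpan.

(** * Bernstein operators and radial extension *)

Section Bernstein.
Variable R : realType.
Implicit Types (f g : nat -> R).

(* [bern N x f] is the expectation of [f] under the binomial law with
   parameters [N] and [(1 + x) / 2]. *)
Fixpoint bern (N : nat) (x : R) f : R :=
  if N is N'.+1 then
    (1 + x) / 2 * bern N' x (fun i => f i.+1) + (1 - x) / 2 * bern N' x f
  else f 0%N.

Lemma bern_linear N x a f g :
  bern N x (fun i => a * f i + g i) = a * bern N x f + bern N x g.
Proof. by elim: N f g => //= N IH f g; rewrite !IH; ring. Qed.

Lemma bern_const N x c : bern N x (fun=> c) = c.
Proof. by elim: N => //= N ->; field. Qed.

Lemma bern_ext N x f g : f =1 g -> bern N x f = bern N x g.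
Proof.
elim: N f g => //= N IH f g fg.
by rewrite (IH _ _ fg) (IH (fun i => f i.+1) (fun i => g i.+1)).
Qed.

Lemma bern_le N x f g : -1 <= x <= 1 -> (forall i, f i <= g i) ->
  bern N x f <= bern N x g.
Proof.
move=> /andP[x1 x2]; elim: N f g => //= N IH f g fg.
by apply: lerD; apply: ler_wpM2l; rewrite ?divr_ge0//;
  [lra|apply: IH => i|lra|apply: IH].
Qed.

(** Variance plus squared bias for the success probability [p = (1 + x) / 2], as
    [p (1 - p) = (1 - x^2) / 4]. The centre [c] is arbitrary because a success shifts it by one in
    the induction. *)
Lemma bern_var N x c : bern N x (fun i => (i%:R - c) ^+ 2)
  = N%:R * (1 - x ^+ 2) / 4 + (N%:R * (1 + x) / 2 - c) ^+ 2.
Proof.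
elim: N c => [|N IH] c /=; first by ring.
rewrite IH (bern_ext _ _ (g := fun i => (i%:R - (c - 1)) ^+ 2)).
  by rewrite IH -natr1; field.
by move=> i; rewrite -natr1; ring.
Qed.

(** Rescales the number of successes so that its mean becomes [x]. *)
Definition node N (i : nat) : R := 2 * i%:R / N%:R - 1.

Lemma bern_node N (x : R) : (0 < N)%N ->
  bern N x (fun i => (node N i - x) ^+ 2) = (1 - x ^+ 2) / N%:R.
Proof.
move=> N0; have n0 : N%:R != 0 :> R by rewrite pnatr_eq0 -lt0n.
rewrite (bern_ext _ _ (g := fun i =>
    4 / N%:R ^+ 2 * (i%:R - N%:R * (1 + x) / 2) ^+ 2 + 0)).
  by rewrite bern_linear bern_var bern_const; field.
by move=> i; rewrite /node; field.
Qed.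

Definition bern3 N (x : 'cV[R]_3) (G : nat -> nat -> nat -> R) : R :=
  bern N (x 0 0) (fun i => bern N (x 1 0) (fun j => bern N (x 2 0) (G i j))).

Definition dsq (x y : 'cV[R]_3) : R :=
  (x 0 0 - y 0 0) ^+ 2 + (x 1 0 - y 1 0) ^+ 2 + (x 2 0 - y 2 0) ^+ 2.

Definition grid N i j k : 'cV[R]_3 := vec3 (node N i) (node N j) (node N k).

Lemma S2_coord (x : 'cV[R]_3) : S2 x ->
  [/\ -1 <= x 0 0 <= 1, -1 <= x 1 0 <= 1 & -1 <= x 2 0 <= 1].
Proof.
move=> /S2P; move: (x 0 0) (x 1 0) (x 2 0) => a b c e.
by split; apply/andP; split; nra.
Qed.

(** The operator is positive, linear and preserves constants, so the quadratic bound on [F y - F x]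
    can be averaged. On the sphere the three variances [(1 - x_j^2) / N] add up to [2 / N]. *)
Lemma bern3_approx N (F : 'cV[R]_3 -> R) (x : 'cV[R]_3) (e c : R) :
  S2 x -> (0 < N)%N -> 0 <= c -> (forall y, `|F y - F x| <= e + c * dsq y x) ->
  `|bern3 N x (fun i j k => F (grid N i j k)) - F x| <= e + c * (2 / N%:R).
Proof.
move=> Sx N0 c0 H.
have [h0 h1 h2] := S2_coord Sx.
pose D (i j k : nat) : R := dsq (grid N i j k) x.
have mono G1 G2 : (forall i j k, G1 i j k <= G2 i j k) -> bern3 N x G1 <= bern3 N x G2.
  by move=> G12; apply: bern_le => // i; apply: bern_le => // j; exact: bern_le.
have lin a b (G : nat -> nat -> nat -> R) :
    bern3 N x (fun i j k => a * G i j k + b) = a * bern3 N x G + b.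
  rewrite /bern3; under bern_ext => i.
    under bern_ext => j do rewrite bern_linear bern_const.
    rewrite bern_linear bern_const; over.
  by rewrite bern_linear bern_const.
have DE : bern3 N x D = 2 / N%:R.
  have e0 i j : bern N (x 2 0) (D i j)
      = 1 * (node N j - x 1 0) ^+ 2 + ((node N i - x 0 0) ^+ 2 + (1 - x 2 0 ^+ 2) / N%:R).
    rewrite (bern_ext _ _ (g := fun k => 1 * (node N k - x 2 0) ^+ 2
       + ((node N i - x 0 0) ^+ 2 + (node N j - x 1 0) ^+ 2))); last first.
      by move=> k; rewrite /D /dsq /grid !vec3E; ring.
    by rewrite bern_linear bern_const bern_node//; ring.
  have e1 i : bern N (x 1 0) (fun j => bern N (x 2 0) (D i j))
      = 1 * (node N i - x 0 0) ^+ 2 + ((1 - x 1 0 ^+ 2) / N%:R + (1 - x 2 0 ^+ 2) / N%:R).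
    rewrite (bern_ext _ _ (e0 i)) bern_linear bern_const bern_node//; ring.
  rewrite /bern3 (bern_ext _ _ e1) bern_linear bern_const bern_node//.
  move/S2P: Sx => Sx.
  have -> : x 2 0 ^+ 2 = 1 - x 0 0 ^+ 2 - x 1 0 ^+ 2 by rewrite -Sx; ring.
  by field; rewrite pnatr_eq0 -lt0n.
pose G i j k := F (grid N i j k).
have up : bern3 N x G <= bern3 N x (fun i j k => c * D i j k + (e + F x)).
  apply: mono => i j k; have := H (grid N i j k); rewrite ler_norml => /andP[_ h].
  by rewrite /G /D; lra.
have dn : bern3 N x (fun i j k => - c * D i j k + (F x - e)) <= bern3 N x G.
  apply: mono => i j k; have := H (grid N i j k); rewrite ler_norml => /andP[h _].
  by rewrite /G /D; lra.
rewrite !lin DE in up dn.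
by rewrite -/G ler_norml; apply/andP; split; lra.
Qed.

Lemma inspan_bern N (j : 'I_3) (F : nat -> 'cV[R]_3 -> R) :
  (forall i, inspan (fun x => rc (F i x))) ->
  inspan (fun x => rc (bern N (x j 0) (fun i => F i x))).
Proof.
elim: N F => [|N IH] F HF /=; first exact: HF.
have h1 := IH (fun i => F i.+1) (fun i => HF i.+1).
have h2 := IH F HF.
have m1 := inspan_mul_coord j h1; have m2 := inspan_mul_coord j h2.
apply: inspan_ext (inspanZ (2^-1) (inspanD (inspanD h1 m1) (inspanD h2 (inspanZ (- 1) m2)))).
move=> x _; rewrite rmorphD !rmorphM !rmorphD rmorphN rmorph1 !fmorphV rmorphD rmorph1.
by field.
Qed.

Lemma inspan_bern3 N (G : nat -> nat -> nat -> R) :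
  inspan (fun x => rc (bern3 N x G)).
Proof.
apply: inspan_bern => i; apply: inspan_bern => j; apply: inspan_bern => k.
exact: inspan_const.
Qed.

(* Constant along rays, so that values at the grid points, which are off the sphere,
   make sense; the value at the origin is arbitrary. *)
Definition radial (F : 'cV[R]_3 -> R) (y : 'cV[R]_3) : R :=
  let r := Num.sqrt (y 0 0 ^+ 2 + y 1 0 ^+ 2 + y 2 0 ^+ 2) in
  if r == 0 then F (pole R) else F (vec3 (y 0 0 / r) (y 1 0 / r) (y 2 0 / r)).

Lemma pole_S2 : S2 (pole R).
Proof. by apply/S2P; rewrite /pole !vec3E; ring. Qed.

Lemma radial_S2 F x : S2 x -> radial F x = F x.
Proof.
move=> /S2P e; rewrite /radial e sqrtr1 oner_eq0 !divr1; congr F.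
by apply: cV3_eq; rewrite !vec3E.
Qed.

(** Projecting [y] to the sphere at most doubles its distance to the point [x] of the sphere, hence
    the factor 4 on squared distances. At the origin the squared distance is 1, and no two points of
    the sphere have squared distance above 4. *)
Lemma radial_modulus F (e c : R) : 0 <= c ->
  (forall x y, S2 x -> S2 y -> `|F y - F x| <= e + c * dsq y x) ->
  forall x y, S2 x -> `|radial F y - radial F x| <= e + 4 * c * dsq y x.
Proof.
move=> c0 H x y Sx; rewrite (radial_S2 _ Sx) /radial.
set r := Num.sqrt _; have r0 : 0 <= r by exact: sqrtr_ge0.
have r2 : r ^+ 2 = y 0 0 ^+ 2 + y 1 0 ^+ 2 + y 2 0 ^+ 2.
  by rewrite sqr_sqrtr// !addr_ge0 ?sqr_ge0.
case: eqP => [rz|/eqP rn].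
  apply: le_trans (H _ _ Sx pole_S2) _; rewrite lerD2l mulrAC [leRHS]mulrC.
  have : dsq y x = 1.
    have y0 : y 0 0 = 0 by move: r2; rewrite rz => ?; nra.
    have y1 : y 1 0 = 0 by move: r2; rewrite rz => ?; nra.
    have y2 : y 2 0 = 0 by move: r2; rewrite rz => ?; nra.
    by move/S2P: Sx; rewrite /dsq y0 y1 y2 => <-; ring.
  move=> ->; rewrite mulr1; apply: ler_wpM2l => //.
  have [_ _ /andP[z1 z2]] := S2_coord Sx.
  by move/S2P: Sx; rewrite /dsq /pole !vec3E => Sx; nra.
have rp : 0 < r by rewrite lt_neqAle eq_sym rn.
set y' := vec3 _ _ _.
have Sy' : S2 y'.
  apply/S2P; rewrite /y' !vec3E !expr_div_n -!mulrDl -r2 divff//.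
  by rewrite expf_neq0.
apply: le_trans (H _ _ Sx Sy') _; rewrite lerD2l mulrAC [leRHS]mulrC.
apply: ler_wpM2l => //.
have -> : y = vec3 (r * y' 0 0) (r * y' 1 0) (r * y' 2 0).
  by apply: cV3_eq; rewrite /y' !vec3E mulrC divfK.
clearbody y'; rewrite /dsq !vec3E; move/S2P: Sx; move/S2P: Sy'.
move: (y' 0 0) (y' 1 0) (y' 2 0) (x 0 0) (x 1 0) (x 2 0) => a b d u v w Sy Sx.
pose s := a * u + b * v + d * w.
have s1 : s <= 1.
  rewrite /s; have := sqr_ge0 (a - u); have := sqr_ge0 (b - v); have := sqr_ge0 (d - w).
  by nra.
have s2 : -1 <= s.
  rewrite /s; have := sqr_ge0 (a + u); have := sqr_ge0 (b + v); have := sqr_ge0 (d + w).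
  by nra.
have -> : (a - u) ^+ 2 + (b - v) ^+ 2 + (d - w) ^+ 2
    = (a ^+ 2 + b ^+ 2 + d ^+ 2) + (u ^+ 2 + v ^+ 2 + w ^+ 2) - 2 * s.
  by rewrite /s; ring.
have -> : (r * a - u) ^+ 2 + (r * b - v) ^+ 2 + (r * d - w) ^+ 2
    = r ^+ 2 * (a ^+ 2 + b ^+ 2 + d ^+ 2) + (u ^+ 2 + v ^+ 2 + w ^+ 2) - 2 * r * s.
  by rewrite /s; ring.
rewrite Sx Sy.
(* The claim is [2 - 2 s <= 4 (r^2 + 1 - 2 r s)]. For [s >= 0] the bracket is
   [(r - s)^2 + (1 - s)(1 + s)]; for [s < 0] it is at least 1, while the left side is at most 4. *)
have [sp|sn] := leP 0 s; have := sqr_ge0 (r - s); nra.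
Qed.

End Bernstein.

(** * Compactness of the sphere and uniform approximation *)

Section SphereCompactness.
Variable R : realType.
Implicit Types F : 'cV[R]_3 -> R.

Lemma unit_circle_angle (a b : R) : a ^+ 2 + b ^+ 2 = 1 ->
  exists2 phi, 0 <= phi <= 2 * pi & cos phi = a /\ sin phi = b.
Proof.
move=> ab.
have a1 : -1 <= a <= 1 by apply/andP; split; nra.
have [p0 p1] : 0 <= acos a /\ acos a <= pi.
  by split; [exact: acos_ge0|exact: acos_lepi].
have ca : cos (acos a) = a by rewrite acosK// in_itv.
have sa : sin (acos a) = `|b|.
  by rewrite sin_acos// -sqrtr_sqr; congr Num.sqrt; rewrite -ab; ring.
have pp := pi_ge0 R.
have [b0|b0] := leP 0 b.
  by exists (acos a); [apply/andP; split; lra|rewrite ca sa ger0_norm].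
exists (2 * pi - acos a); first by apply/andP; split; lra.
have -> : 2 * pi - acos a = - acos a + pi *+ 2 by rewrite mulr2n; ring.
by rewrite cosD2pi sinD2pi cosN sinN ca sa ltr0_norm// opprK.
Qed.

Lemma S2_param (x : 'cV[R]_3) : S2 x ->
  exists p : R * R, [/\ 0 <= p.1 <= 2 * pi, 0 <= p.2 <= pi & xi p.1 p.2 = x].
Proof.
move=> Sx; have [_ _ z1] := S2_coord Sx; move/S2P: Sx => Sx.
pose s := Num.sqrt (1 - x 2 0 ^+ 2).
have s2 : s ^+ 2 = x 0 0 ^+ 2 + x 1 0 ^+ 2.
  rewrite sqr_sqrtr -Sx; first by ring.
  by rewrite (_ : _ - _ = x 0 0 ^+ 2 + x 1 0 ^+ 2) ?addr_ge0 ?sqr_ge0//; ring.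
have [phi phib [cp sp]] : exists2 phi, 0 <= phi <= 2 * pi &
    s * cos phi = x 0 0 /\ s * sin phi = x 1 0.
  have [s0|s0] := eqVneq s 0.
    exists 0; first by rewrite lexx mulr_ge0// pi_ge0.
    by rewrite s0 !mul0r; rewrite s0 in s2; split; nra.
  have [|phi phib [cp sp]] := @unit_circle_angle (x 0 0 / s) (x 1 0 / s).
    by rewrite !expr_div_n -mulrDl -s2 divff// expf_neq0.
  by exists phi => //; rewrite cp sp !(mulrC s) !divfK.
exists (phi, acos (x 2 0)); split => //=.
  by rewrite acos_ge0// acos_lepi.
by apply: cV3_eq; rewrite /xi !vec3E ?sin_acos ?acosK ?in_itv// -/s mulrC.
Qed.

Lemma within_S2_local F : {within @S2 R, continuous F} ->
  forall x (e : R), S2 x -> 0 < e -> exists2 d : R, 0 < d &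
  forall y, S2 y -> (forall j, `|x j 0 - y j 0| < d) -> `|F x - F y| < e.
Proof.
move=> /subspace_continuousP cF x e Sx e0.
have /cvgrPdist_lt/(_ e e0) := cF x Sx.
rewrite near_withinE => /nbhs_ballP[d /= d0 H].
exists d => // y Sy xy; apply: (H y _ Sy); split => // i j.
by rewrite (ord1 j); exact: xy.
Qed.

(** Passage from local to global constants: what holds near each point for all large [c] holds on
    the whole sphere for one [c]. The compact set is the rectangle of angles, mapped continuously
    onto the sphere. *)
Lemma near_S2 (P : R -> 'cV[R]_3 -> Prop) :
  (forall x, S2 x -> exists2 d : R, 0 < d & exists c0 : R, forall y c, S2 y ->
     (forall j, `|x j 0 - y j 0| < d) -> c0 <= c -> P c y) ->
  exists2 c, 0 <= c & forall x, S2 x -> P c x.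
Proof.
move=> H.
have K : compact (`[0, 2 * pi] `*` `[0, pi] : set (R * R)).
  by apply: compact_setX; exact: segment_compact.
have /compact_near_coveringP := K.
move=> /(_ R (pinfty_nbhs R) (fun c p => P c (xi p.1 p.2))) HK.
have : \forall c \near pinfty_nbhs R,
    `[0, 2 * pi] `*` `[0, pi] `<=` (fun p : R * R => P c (xi p.1 p.2)).
  apply: HK => p Kp; have [d d0 [c0 Hd]] := H _ (xi_S2 p.1 p.2).
  have cf (f : R * R -> R) : {for p, continuous f} ->
      \forall q \near p & c \near pinfty_nbhs R, `|f p - f q| < d.
    move=> /cvgrPdist_lt/(_ d d0) Hf.
    exists ([set q | `|f p - f q| < d], setT); first by split => //=; exact: filterT.
    by move=> [q c] [].
  have c0' : \forall q \near p & c \near pinfty_nbhs R, c0 <= c.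
    exists (setT, [set c | c0 <= c]); last by move=> [q c] [].
    by split; [exact: filterT|by apply: nbhs_pinfty_ge; exact: num_real].
  have cfst (h : R -> R) : continuous h -> {for p, continuous (fun q : R * R => h q.1)}.
    by move=> ch; apply: (@continuous_comp _ _ _ fst h p); [exact: cvg_fst|exact: ch].
  have csnd (h : R -> R) : continuous h -> {for p, continuous (fun q : R * R => h q.2)}.
    by move=> ch; apply: (@continuous_comp _ _ _ snd h p); [exact: cvg_snd|exact: ch].
  have cc : continuous (@cos R) by exact: continuous_cos.
  have cs : continuous (@sin R) by exact: continuous_sin.
  have c1 : {for p, continuous (fun q : R * R => cos q.1 * sin q.2)}.
    exact: continuousM (cfst _ cc) (csnd _ cs).
  have c2 : {for p, continuous (fun q : R * R => sin q.1 * sin q.2)}.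
    exact: continuousM (cfst _ cs) (csnd _ cs).
  have c3 := csnd _ cc.
  have {}c1 := cf _ c1; have {}c2 := cf _ c2; have {}c3 := cf _ c3.
  apply: filterS (filterI (filterI c1 c2) (filterI c3 c0')).
  move=> -[q c] [[/= h1 h2] [h3 h4]]; apply: Hd => //; first exact: xi_S2.
  move=> j; rewrite /xi; case: j => -[|[|[|//]]] jp; by rewrite !mxE.
move=> [M [_ HM]]; exists (Num.max 0 (M + 1)); first by rewrite le_max lexx.
move=> x Sx; have [p [p1 p2 <-]] := S2_param Sx.
apply: HM; first by rewrite lt_max ltrDl ltr01 orbT.
by split; rewrite /= in_itv.
Qed.

Lemma within_S2_bounded F : {within @S2 R, continuous F} ->
  exists2 M, 0 <= M & forall x, S2 x -> `|F x| <= M.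
Proof.
move=> cF; apply: near_S2 => x Sx.
have [d d0 Hd] := within_S2_local cF Sx ltr01.
exists d => //; exists (`|F x| + 1) => y c Sy xy; apply: le_trans.
have := Hd y Sy xy; rewrite distrC => h.
by rewrite -[F y](subrK (F x)) (le_trans (ler_normD _ _))// addrC lerD2l ltW.
Qed.

(** Uniform continuity in the quadratic form that [bern3_approx] averages: nearby points are covered
    by [e], distant ones by [c * dsq]. *)
Lemma within_S2_modulus F : {within @S2 R, continuous F} ->
  forall e : R, 0 < e -> exists2 c, 0 <= c &
  forall x y, S2 x -> S2 y -> `|F y - F x| <= e + c * dsq y x.
Proof.
move=> cF e e0; have [M M0 HM] := within_S2_bounded cF.
suff [c c0 Hc] : exists2 c, 0 <= c & forall x, S2 x -> 0 <= c /\
    forall y, S2 y -> `|F y - F x| <= e + c * dsq y x.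
  by exists c => // x y Sx; exact: (Hc x Sx).2.
apply: near_S2 => x Sx; have e2 : 0 < e / 2 by rewrite divr_gt0.
have [d d0 Hd] := within_S2_local cF Sx e2.
have d2 : 0 < d / 2 by rewrite divr_gt0.
(* Two points that differ by at least [d / 2] in a coordinate have [dsq] at least [(d / 2)^2], so
   this constant makes [c * dsq] at least [2 M], a bound for any difference of values. *)
exists (d / 2) => //; exists (2 * M / (d / 2) ^+ 2) => y c Sy xy cM.
have c0 : 0 <= c by rewrite (le_trans _ cM)// divr_ge0 ?mulr_ge0 ?exprn_ge0// ltW.
split=> // z Sz.
have dn : 0 <= dsq z y by rewrite /dsq !addr_ge0 ?sqr_ge0.
have [yz|] := pselect (forall j, `|y j 0 - z j 0| < d / 2).
  have h1 : `|F x - F y| < e / 2.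
    by apply: Hd => // j; apply: lt_trans (xy j) _; lra.
  have h2 : `|F x - F z| < e / 2.
    apply: Hd => // j; rewrite -[x j 0](subrK (y j 0)) -addrA.
    by rewrite (le_lt_trans (ler_normD _ _))// [ltRHS](splitr d) ltrD.
  have -> : F z - F y = (F x - F y) - (F x - F z) by ring.
  rewrite (le_trans (ler_normB _ _))// [e]splitr -[leLHS]addr0 lerD ?mulr_ge0//.
  by rewrite lerD// ltW.
move=> /existsNP[j /negP]; rewrite -leNgt => dj.
have dd : (d / 2) ^+ 2 <= dsq z y.
  apply: (@le_trans _ _ ((z j 0 - y j 0) ^+ 2)).
    by rewrite -[leRHS]real_normK ?num_real// distrC lerXn2r// ?nnegrE ltW.
  rewrite /dsq; case: j {dj} => -[|[|[|//]]] p.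
  - by rewrite (_ : Ordinal p = 0); [rewrite -addrA lerDl addr_ge0 ?sqr_ge0|apply/val_inj].
  - rewrite (_ : Ordinal p = 1); [|exact/val_inj].
    by rewrite addrAC lerDr addr_ge0 ?sqr_ge0.
  - by rewrite (_ : Ordinal p = 2); [rewrite lerDr addr_ge0 ?sqr_ge0|apply/val_inj].
apply: (@le_trans _ _ (2 * M)).
  by rewrite (le_trans (ler_normB _ _))// mulr_natl mulr2n lerD// HM.
apply: (@le_trans _ _ (c * dsq z y)); last by rewrite lerDr ltW.
apply: (@le_trans _ _ (2 * M / (d / 2) ^+ 2 * (d / 2) ^+ 2)).
  by rewrite divfK// gt_eqF// exprn_gt0.
by apply: ler_pM => //; rewrite ?divr_ge0 ?mulr_ge0 ?exprn_ge0// ltW.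
Qed.

Lemma uniform_span_approx_real F (e : R) : {within @S2 R, continuous F} -> 0 < e ->
  exists2 T : 'cV[R]_3 -> R, inspan (fun x => rc (T x)) &
  forall x, S2 x -> `|T x - F x| <= e.
Proof.
move=> cF e0; have e2 : 0 < e / 2 by rewrite divr_gt0.
have [c c0 Hc] := within_S2_modulus cF e2.
have H := radial_modulus c0 Hc.
(* Large enough for the error term [4 c * (2 / N)] to be at most [e / 2]. *)
pose N := (Num.truncn (4 * c * 2 / (e / 2))).+1.
exists (fun x => bern3 N x (fun i j k => radial F (grid R N i j k))).
  exact: inspan_bern3.
move=> x Sx; rewrite -[F x](radial_S2 F Sx).
apply: le_trans (@bern3_approx R N (radial F) x (e / 2) (4 * c) Sx isT _ _) _.
- by rewrite mulr_ge0.
- by move=> y; exact: H.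
rewrite [leRHS]splitr lerD2l mulrA ler_pdivrMr ?ltr0n//.
have := truncnS_gt (4 * c * 2 / (e / 2)).
by rewrite ltr_pdivrMr// => /ltW; rewrite [_ * (e / 2)]mulrC.
Qed.

Lemma uniform_span_approx (f : 'cV[R]_3 -> R[i]) (e : R) : ccontS2 f -> 0 < e ->
  exists2 T, inspan T & forall x, S2 x -> sqmod (T x - f x) <= e.
Proof.
move=> [c1 c2] e0.
(* Then [d^2 <= d <= e / 2], so the real and imaginary parts each contribute at most [e / 2]. *)
pose d := Num.min 1 (e / 2).
have d0 : 0 < d by rewrite lt_min ltr01 divr_gt0.
have [T1 s1 H1] := uniform_span_approx_real c1 d0.
have [T2 s2 H2] := uniform_span_approx_real c2 d0.
exists (fun x => rc (T1 x) + Complex 0 1 * rc (T2 x)).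
  exact: inspanD s1 (inspanZ _ s2).
move=> x Sx.
have -> : sqmod (rc (T1 x) + Complex 0 1 * rc (T2 x) - f x)
    = (T1 x - complex.Re (f x)) ^+ 2 + (T2 x - complex.Im (f x)) ^+ 2.
  by rewrite /sqmod; case: (f x) => a b /=; ring.
have sq (t : R) : `|t| <= d -> t ^+ 2 <= e / 2.
  move=> td; rewrite -real_normK ?num_real//.
  have : d <= 1 by rewrite ge_min lexx.
  have : d <= e / 2 by rewrite ge_min lexx orbT.
  have := normr_ge0 t; nra.
by rewrite [e]splitr lerD// sq ?H1 ?H2.
Qed.

End SphereCompactness.

(** * Weighted complex L^2 spaces *)

Section ComplexIntegral.
Context d (T : measurableType d) (R : realType).
Variables (mu : {measure set T -> \bar R}) (D : set T).
Hypothesis mD : measurable D.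
Local Notation C := R[i].
Implicit Types u v : T -> C.

Definition cintegrable u :=
  mu.-integrable D (fun x => (complex.Re (u x))%:E) /\
  mu.-integrable D (fun x => (complex.Im (u x))%:E).

Lemma cint_ext u v : (forall x, D x -> u x = v x) -> cint mu D u = cint mu D v.
Proof.
by move=> uv; congr Complex; apply: eq_Rintegral => x; rewrite inE => Dx; rewrite uv.
Qed.

Lemma cintegrable_ext u v : (forall x, D x -> u x = v x) -> cintegrable u -> cintegrable v.
Proof.
move=> uv [u1 u2]; split.
  by apply: eq_integrable u1 => // x; rewrite inE => Dx; rewrite uv.
by apply: eq_integrable u2 => // x; rewrite inE => Dx; rewrite uv.
Qed.

Lemma cintegrableD u v : cintegrable u -> cintegrable v ->
  cintegrable (fun x => u x + v x).
Proof.
move=> [u1 u2] [v1 v2]; split.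
  apply: eq_integrable (integrableD mD u1 v1) => // x _.
  by rewrite /= -EFinD; case: (u x) (v x) => a b [].
apply: eq_integrable (integrableD mD u2 v2) => // x _.
by rewrite /= -EFinD; case: (u x) (v x) => a b [].
Qed.

Lemma cintD u v : cintegrable u -> cintegrable v ->
  cint mu D (fun x => u x + v x) = cint mu D u + cint mu D v.
Proof.
move=> [u1 u2] [v1 v2]; rewrite /cint.
have -> : (fun x => complex.Re (u x + v x)) = (fun x => complex.Re (u x) + complex.Re (v x)).
  by apply/funext => x; case: (u x) (v x) => a b [].
have -> : (fun x => complex.Im (u x + v x)) = (fun x => complex.Im (u x) + complex.Im (v x)).
  by apply/funext => x; case: (u x) (v x) => a b [].
by rewrite !RintegralD.
Qed.

Lemma cintegrableZ c u : cintegrable u -> cintegrable (fun x => c * u x).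
Proof.
case: c => a b [u1 u2]; split.
  apply: eq_integrable (integrableB mD (integrableZl mD a u1) (integrableZl mD b u2)) => // x _.
  by rewrite /= -!EFinM -EFinB; case: (u x) => p q.
apply: eq_integrable (integrableD mD (integrableZl mD a u2) (integrableZl mD b u1)) => // x _.
by rewrite /= -!EFinM -EFinD; case: (u x) => p q.
Qed.

Lemma cintZ c u : cintegrable u -> cint mu D (fun x => c * u x) = c * cint mu D u.
Proof.
case: c => a b [u1 u2]; rewrite /cint.
have -> : (fun x => complex.Re (Complex a b * u x))
    = (fun x => a * complex.Re (u x) - b * complex.Im (u x)).
  by apply/funext => x; case: (u x).
have -> : (fun x => complex.Im (Complex a b * u x))
    = (fun x => a * complex.Im (u x) + b * complex.Re (u x)).
  by apply/funext => x; case: (u x).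
have Z (c : R) (h : T -> R) : mu.-integrable D (EFin \o h) ->
    mu.-integrable D (EFin \o (fun x => c * h x)).
  by move=> ih; apply: eq_integrable (integrableZl mD c ih).
by rewrite RintegralB ?RintegralD ?RintegralZl//; apply: Z.
Qed.

Lemma cintegrable0 : cintegrable (fun=> 0).
Proof. by split; exact: integrable0. Qed.

Lemma cint0 : cint mu D (fun=> 0) = 0.
Proof.
have E : Rintegral mu D (fun=> 0) = 0 by rewrite /Rintegral integral0.
by rewrite /cint /= E.
Qed.

Lemma cintegrable_sum (I : eqType) (s : seq I) (F : I -> T -> C) :
  (forall i, i \in s -> cintegrable (F i)) ->
  cintegrable (fun x => \sum_(i <- s) F i x).
Proof.
elim: s => [|i s IH] H.
  by apply: cintegrable_ext cintegrable0 => x _; rewrite big_nil.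
apply: (@cintegrable_ext (fun x => F i x + \sum_(j <- s) F j x)).
  by move=> x _; rewrite big_cons.
apply: cintegrableD; first by apply: H; rewrite mem_head.
by apply: IH => j js; apply: H; rewrite inE js orbT.
Qed.

Lemma cint_sum (I : eqType) (s : seq I) (F : I -> T -> C) :
  (forall i, i \in s -> cintegrable (F i)) ->
  cint mu D (fun x => \sum_(i <- s) F i x) = \sum_(i <- s) cint mu D (F i).
Proof.
elim: s => [|i s IH] H.
  by rewrite big_nil -[RHS]cint0; apply: cint_ext => x _; rewrite big_nil.
rewrite big_cons -IH; last by move=> j js; apply: H; rewrite inE js orbT.
rewrite -cintD.
- by apply: cint_ext => x _; rewrite big_cons.
- by apply: H; rewrite mem_head.
- by apply: cintegrable_sum => j js; apply: H; rewrite inE js orbT.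
Qed.

Lemma cint_conj u : cintegrable u -> cint mu D (fun x => conjc (u x)) = conjc (cint mu D u).
Proof.
move=> [_ u2]; rewrite /cint /=; congr Complex.
  by apply: eq_Rintegral => x _; case: (u x).
rewrite -[RHS]mulN1r -RintegralZl//.
by apply: eq_Rintegral => x _; case: (u x) => a b /=; rewrite mulN1r.
Qed.

Lemma cmeasD u v : cmeas D u -> cmeas D v -> cmeas D (fun x => u x + v x).
Proof.
move=> [u1 u2] [v1 v2]; split.
  apply: eq_measurable_fun (measurable_funD u1 v1) => x _ /=.
  by case: (u x) (v x) => a b [].
apply: eq_measurable_fun (measurable_funD u2 v2) => x _ /=.
by case: (u x) (v x) => a b [].
Qed.

Lemma cmeasM u v : cmeas D u -> cmeas D v -> cmeas D (fun x => u x * v x).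
Proof.
move=> [u1 u2] [v1 v2]; split.
  apply: eq_measurable_fun (measurable_funB (measurable_funM u1 v1) (measurable_funM u2 v2)) => x _ /=.
  by case: (u x) (v x) => a b [].
apply: eq_measurable_fun (measurable_funD (measurable_funM u1 v2) (measurable_funM u2 v1)) => x _ /=.
by case: (u x) (v x) => a b [] p q /=; ring.
Qed.

Lemma cmeas_cst (c : C) : cmeas D (fun=> c).
Proof. by split; exact: measurable_cst. Qed.

Lemma cmeas_rc (h : T -> R) : measurable_fun D h -> cmeas D (fun x => rc (h x)).
Proof. by move=> mh; split => //=; exact: measurable_cst. Qed.

Lemma cmeas_conj u : cmeas D u -> cmeas D (fun x => conjc (u x)).
Proof.
move=> [u1 u2]; split.
  by apply: eq_measurable_fun u1 => x _; case: (u x).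
apply: eq_measurable_fun (measurable_funN u2) => x _ /=; by case: (u x).
Qed.

Lemma cmeas_ext u v : (forall x, D x -> u x = v x) -> cmeas D u -> cmeas D v.
Proof.
move=> uv [u1 u2]; split.
  by apply: eq_measurable_fun u1 => x; rewrite inE => Dx; rewrite uv.
by apply: eq_measurable_fun u2 => x; rewrite inE => Dx; rewrite uv.
Qed.

Lemma measurable_sqmod u : cmeas D u -> measurable_fun D (fun x => sqmod (u x)).
Proof.
move=> [u1 u2]; apply: measurable_funD; exact: measurable_funX.
Qed.

Lemma cmeasB u v : cmeas D u -> cmeas D v -> cmeas D (fun x => u x - v x).
Proof.
move=> mu' mv; apply: (@cmeas_ext (fun x => u x + - 1 * v x)).
  by move=> x _; rewrite mulN1r.
by apply: cmeasD => //; apply: cmeasM => //; exact: cmeas_cst.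
Qed.

End ComplexIntegral.

(** * Weighted inner products and Bessel's identity *)

Section WeightedL2.
Context d (T : measurableType d) (R : realType).
Variables (mu : {measure set T -> \bar R}) (D : set T) (w : T -> R).
Hypothesis mD : measurable D.
Hypothesis muD : (mu D < +oo)%E.
Hypothesis mw : measurable_fun D w.
Hypothesis w01 : forall x, D x -> 0 <= w x <= 1.
Local Notation C := R[i].
Implicit Types u v : T -> C.

(** Keeping the Jacobian as a weight [w] over a coordinate box treats the sphere and the rotation
    group alike. *)
Definition sqn u : \bar R := (\int[mu]_(x in D) (sqmod (u x) * w x)%:E)%E.
Definition ip u v : C := cint mu D (fun x => u x * conjc (v x) * rc (w x)).
Definition inL2 u := cmeas D u /\ (sqn u < +oo)%E.

Lemma sqmod_ge0 (z : C) : 0 <= sqmod z.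
Proof. by rewrite addr_ge0// sqr_ge0. Qed.

Lemma w_ge0 x : D x -> 0 <= w x. Proof. by case/w01/andP. Qed.

Lemma sqn_ge0 u : (0 <= sqn u)%E.
Proof.
by apply: integral_ge0 => x Dx; rewrite lee_fin mulr_ge0 ?sqmod_ge0 ?w_ge0.
Qed.

Lemma measurable_sqn u : cmeas D u -> measurable_fun D (fun x => sqmod (u x) * w x).
Proof. by move=> mu'; apply: measurable_funM => //; exact: measurable_sqmod. Qed.

Lemma inL2_integrable u : inL2 u ->
  mu.-integrable D (fun x => (sqmod (u x) * w x)%:E).
Proof.
move=> [mu' fu]; apply/integrableP; split.
  by apply/measurable_EFinP; exact: measurable_sqn.
rewrite (eq_integral (fun x => (sqmod (u x) * w x)%:E))// => x; rewrite inE => Dx.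
by rewrite /= ger0_norm// mulr_ge0 ?sqmod_ge0 ?w_ge0.
Qed.

Lemma sqn_le u v (k : R) : cmeas D u -> cmeas D v -> 0 <= k ->
  (forall x, D x -> sqmod (u x) <= k * sqmod (v x)) ->
  (sqn u <= k%:E * sqn v)%E.
Proof.
move=> mu' mv k0 H; rewrite /sqn -ge0_integralZl//.
- apply: ge0_le_integral => //.
  + by move=> x Dx; rewrite lee_fin mulr_ge0 ?sqmod_ge0 ?w_ge0.
  + by apply/measurable_EFinP; exact: measurable_sqn.
  + apply/measurable_EFinP; apply: measurable_funM => //; exact: measurable_sqn.
  + move=> x Dx; rewrite -EFinM lee_fin mulrA; apply: ler_wpM2r; first exact: w_ge0.
    exact: H.
- by apply/measurable_EFinP; exact: measurable_sqn.
- by move=> x Dx; rewrite lee_fin mulr_ge0 ?sqmod_ge0 ?w_ge0.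
Qed.

Lemma sqmodD (a b : C) : sqmod (a + b) <= 2 * (sqmod a + sqmod b).
Proof.
rewrite /sqmod; case: a b => a b [p q] /=.
by have := sqr_ge0 (a - p); have := sqr_ge0 (b - q); nra.
Qed.

Lemma sqmodM (a b : C) : sqmod (a * b) = sqmod a * sqmod b.
Proof. by rewrite /sqmod; case: a b => a b [p q] /=; ring. Qed.

Lemma sqnD u v : cmeas D u -> cmeas D v ->
  (sqn (fun x => u x + v x)%R <= 2%:E * (sqn u + sqn v))%E.
Proof.
move=> mu' mv; rewrite /sqn -ge0_integralD//.
- rewrite -ge0_integralZl//.
  + apply: ge0_le_integral => //.
    * by move=> x Dx; rewrite lee_fin mulr_ge0 ?sqmod_ge0 ?w_ge0.
    * by apply/measurable_EFinP; apply: measurable_sqn; exact: cmeasD.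
    * apply/measurable_EFinP; apply: measurable_funM => //.
      by apply: measurable_funD; exact: measurable_sqn.
    * move=> x Dx; rewrite -EFinD -EFinM lee_fin -mulrDl mulrA.
      by apply: ler_wpM2r; [exact: w_ge0|exact: sqmodD].
  + by apply: emeasurable_funD; apply/measurable_EFinP; exact: measurable_sqn.
  + by move=> x Dx; rewrite adde_ge0// lee_fin mulr_ge0 ?sqmod_ge0 ?w_ge0.
- by move=> x Dx; rewrite lee_fin mulr_ge0 ?sqmod_ge0 ?w_ge0.
- by apply/measurable_EFinP; exact: measurable_sqn.
- by move=> x Dx; rewrite lee_fin mulr_ge0 ?sqmod_ge0 ?w_ge0.
- by apply/measurable_EFinP; exact: measurable_sqn.
Qed.

Lemma sqmodBC (a b : C) : sqmod (a - b) = sqmod (b - a).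
Proof. by rewrite /sqmod; case: a b => a b [p q] /=; ring. Qed.

Lemma inL2D u v : inL2 u -> inL2 v -> inL2 (fun x => u x + v x).
Proof.
move=> [mu' fu] [mv fv]; split; first exact: cmeasD.
by rewrite (le_lt_trans (sqnD mu' mv))// lte_mul_pinfty// lte_add_pinfty.
Qed.

Lemma inL2Z c u : inL2 u -> inL2 (fun x => c * u x).
Proof.
move=> [mu' fu]; have mc : cmeas D (fun x => c * u x).
  by apply: cmeasM => //; exact: cmeas_cst.
split => //; apply: (@le_lt_trans _ _ ((sqmod c)%:E * sqn u)%E).
  by apply: sqn_le => //; [exact: sqmod_ge0|move=> x _; rewrite sqmodM].
by rewrite lte_mul_pinfty// ?lee_fin ?sqmod_ge0.
Qed.

Lemma sqn_bound u (M : R) : cmeas D u -> 0 <= M -> (forall x, D x -> sqmod (u x) <= M) ->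
  (sqn u <= M%:E * mu D)%E.
Proof.
move=> mu' M0 H; rewrite -integral_cst//; apply: ge0_le_integral => //.
- by move=> x Dx; rewrite lee_fin mulr_ge0 ?sqmod_ge0 ?w_ge0.
- by apply/measurable_EFinP; exact: measurable_sqn.
- move=> x Dx; rewrite lee_fin -[leRHS]mulr1.
  have /andP[w0 w1] := w01 Dx.
  by apply: ler_pM => //; [exact: sqmod_ge0|exact: H].
Qed.

(** Here [t] is L^2-close to [u] and [v] is uniformly close to [t]. The quarters offset the factor 2
    of [sqnD]: [2 (e / 4 + e / 4) = e]. *)
Lemma sqn_near u v t (M V e : R) : cmeas D u -> cmeas D v -> cmeas D t ->
  0 <= M -> (forall x, D x -> sqmod (v x - t x) <= M) ->
  mu D = V%:E -> M * V <= e / 4 -> (sqn (fun x => t x - u x)%R < (e / 4)%:E)%E ->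
  (sqn (fun x => u x - v x)%R < e%:E)%E.
Proof.
move=> mu' mv mt M0 vt muV MV tu.
have -> : sqn (fun x => u x - v x) = sqn (fun x => (v x - t x) + (t x - u x)).
  by apply: eq_integral => x _; rewrite sqmodBC addrA subrK.
apply: le_lt_trans (sqnD _ _) _; [exact: cmeasB|exact: cmeasB|].
have vt' : (sqn (fun x => v x - t x)%R <= (e / 4)%:E)%E.
  apply: le_trans (sqn_bound (cmeasB mv mt) M0 vt) _.
  by rewrite muV -EFinM lee_fin.
apply: (@lt_le_trans _ _ (2%:E * ((e / 4)%:E + (e / 4)%:E))%E).
  rewrite lte_pmul2l//; apply: lee_ltD => //.
  by rewrite ge0_fin_numE ?sqn_ge0// (le_lt_trans vt')// ltry.
by rewrite -EFinD -EFinM lee_fin; lra.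
Qed.

Lemma inL2_bounded u (M : R) : cmeas D u -> (forall x, D x -> sqmod (u x) <= M) -> inL2 u.
Proof.
move=> mu' H; split=> //; have M0 : 0 <= `|M| by [].
have H' x : D x -> sqmod (u x) <= `|M|.
  by move=> Dx; rewrite (le_trans (H x Dx))// ler_norm.
by rewrite (le_lt_trans (sqn_bound mu' M0 H'))// lte_mul_pinfty.
Qed.

Lemma ip_integrable u v : inL2 u -> inL2 v ->
  cintegrable mu D (fun x => u x * conjc (v x) * rc (w x)).
Proof.
move=> Lu Lv.
have mm : cmeas D (fun x => u x * conjc (v x) * rc (w x)).
  by apply: cmeasM; [apply: cmeasM; [exact: Lu.1|exact: cmeas_conj Lv.1]|exact: cmeas_rc].
have I := integrableD mD (inL2_integrable Lu) (inL2_integrable Lv).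
have bnd x : D x -> `|complex.Re (u x * conjc (v x) * rc (w x))| <= sqmod (u x) * w x + sqmod (v x) * w x /\
   `|complex.Im (u x * conjc (v x) * rc (w x))| <= sqmod (u x) * w x + sqmod (v x) * w x.
  move=> Dx; have w0 := w_ge0 Dx.
  rewrite -mulrDl /sqmod; case: (u x) (v x) => a b [p q] /=.
  rewrite !mulr0 subr0 add0r !normrM (ger0_norm w0) /=.
  have := sqr_ge0 (a - p); have := sqr_ge0 (a + p).
  have := sqr_ge0 (b - q); have := sqr_ge0 (b + q).
  have := sqr_ge0 (a - q); have := sqr_ge0 (a + q).
  have := sqr_ge0 (b - p); have := sqr_ge0 (b + p).
  have := sqr_ge0 a; have := sqr_ge0 b; have := sqr_ge0 p; have := sqr_ge0 q.
  by split; apply: ler_wpM2r => //; rewrite ler_norml; apply/andP; split; lra.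
split.
  apply: le_integrable I => //; first by apply/measurable_EFinP; exact: mm.1.
  move=> x Dx /=; rewrite lee_fin (le_trans (bnd x Dx).1)// ler_norm//.
apply: le_integrable I => //; first by apply/measurable_EFinP; exact: mm.2.
by move=> x Dx /=; rewrite lee_fin (le_trans (bnd x Dx).2)// ler_norm.
Qed.

Lemma ipDl u v t : inL2 u -> inL2 v -> inL2 t ->
  ip (fun x => u x + v x) t = ip u t + ip v t.
Proof.
move=> Lu Lv Lt; rewrite /ip -cintD//; [|exact: ip_integrable..].
by apply: cint_ext => x _; ring.
Qed.

Lemma ipZl c u t : inL2 u -> inL2 t -> ip (fun x => c * u x) t = c * ip u t.
Proof.
move=> Lu Lt; rewrite /ip -cintZ//; last exact: ip_integrable.
by apply: cint_ext => x _; ring.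
Qed.

Lemma inL20 : inL2 (fun=> 0).
Proof.
by apply: (@inL2_bounded _ 0); [exact: cmeas_cst|move=> x _; rewrite /sqmod /= expr0n addr0].
Qed.

Lemma inL2_ext u v : (forall x, D x -> u x = v x) -> inL2 u -> inL2 v.
Proof.
move=> uv [mu' fu]; split; first exact: cmeas_ext uv mu'.
rewrite /sqn (eq_integral (fun x => (sqmod (u x) * w x)%:E))// => x.
by rewrite inE => Dx; rewrite uv.
Qed.

Lemma sqn_ext u v : (forall x, D x -> u x = v x) -> sqn u = sqn v.
Proof. by move=> uv; apply: eq_integral => x; rewrite inE => Dx; rewrite uv. Qed.

Lemma inL2_sum (I : eqType) (s : seq I) (F : I -> T -> C) :
  (forall i, i \in s -> inL2 (F i)) -> inL2 (fun x => \sum_(i <- s) F i x).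
Proof.
elim: s => [|i s IH] H.
  by apply: inL2_ext inL20 => x _; rewrite big_nil.
apply: (@inL2_ext (fun x => F i x + \sum_(j <- s) F j x)).
  by move=> x _; rewrite big_cons.
apply: inL2D; first by apply: H; rewrite mem_head.
by apply: IH => j js; apply: H; rewrite inE js orbT.
Qed.

Lemma ip_suml (I : eqType) (s : seq I) (F : I -> T -> C) t : inL2 t ->
  (forall i, i \in s -> inL2 (F i)) ->
  ip (fun x => \sum_(i <- s) F i x) t = \sum_(i <- s) ip (F i) t.
Proof.
move=> Lt H; rewrite /ip -cint_sum//; last by move=> i /H Li; exact: ip_integrable.
by apply: cint_ext => x _; rewrite -!mulr_suml.
Qed.

Lemma ipC u v : inL2 u -> inL2 v -> ip v u = conjc (ip u v).
Proof.
move=> Lu Lv; rewrite /ip -cint_conj//; last exact: ip_integrable.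
apply: cint_ext => x _; rewrite /rc; case: (u x) (v x) => a b [p q].
by apply/eqP; rewrite eq_complex /=; apply/andP; split; apply/eqP; ring.
Qed.

Lemma ip_diag u : inL2 u -> ip u u = rc (fine (sqn u)).
Proof.
move=> Lu; rewrite /ip /cint /rc; congr Complex.
  congr fine; apply: eq_integral => x _; congr EFin.
  by rewrite /sqmod; case: (u x) => a b /=; ring.
rewrite (eq_Rintegral mu (g := fun=> 0)) ?Rintegral_cst// ?mul0r//.
by move=> x _; case: (u x) => a b /=; ring.
Qed.

Lemma sqnE u : inL2 u -> sqn u = (fine (sqn u))%:E.
Proof. by move=> [_ fu]; rewrite fineK// ge0_fin_numE// sqn_ge0. Qed.

(** Stated as an identity because it is read in two ways: nonnegativity of the left side bounds the
    coefficients, and nonnegativity of the sum shows that subtracting the projection does not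
    increase the norm. *)
Lemma bessel (I : eqType) (s : seq I) (e : I -> T -> C) u :
  uniq s -> inL2 u -> (forall i, i \in s -> inL2 (e i)) ->
  (forall i j, i \in s -> j \in s -> ip (e i) (e j) = (i == j)%:R) ->
  fine (sqn (fun x => u x - \sum_(i <- s) ip u (e i) * e i x))
  = fine (sqn u) - \sum_(i <- s) sqmod (ip u (e i)).
Proof.
move=> us Lu Le orth.
pose S x := \sum_(i <- s) ip u (e i) * e i x.
have LS : inL2 S by apply: inL2_sum => i si; exact/inL2Z/Le.
have LNS : inL2 (fun x => - 1 * S x) by exact: inL2Z.
have Ze c i t : i \in s -> inL2 t -> ip (fun x => c * e i x) t = c * ip (e i) t.
  by move=> si Lt; exact: ipZl (Le _ si) Lt.
have SS t : inL2 t -> ip S t = \sum_(i <- s) ip u (e i) * ip (e i) t.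
  move=> Lt; rewrite (ip_suml Lt); last by move=> i si; exact/inL2Z/Le.
  by apply: eq_big_seq => i si; exact: Ze.
have Sj j : j \in s -> ip S (e j) = ip u (e j).
  move=> sj; rewrite (SS _ (Le _ sj)) (bigD1_seq j)//= (orth _ _ sj sj) eqxx mulr1.
  rewrite big_seq_cond big1 ?addr0// => i /andP[si ij].
  by rewrite (orth _ _ si sj) (negbTE ij) mulr0.
have sqc (z : C) : z * conjc z = rc (sqmod z).
  by rewrite /sqmod /rc; case: z => a b /=; congr Complex; ring.
have SuE : ip S u = rc (\sum_(i <- s) sqmod (ip u (e i))).
  rewrite (SS _ Lu) rmorph_sum/=; apply: eq_big_seq => i si.
  by rewrite (ipC Lu (Le _ si)) sqc.
have SSE : ip S S = rc (\sum_(i <- s) sqmod (ip u (e i))).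
  rewrite (SS _ LS) rmorph_sum/=; apply: eq_big_seq => i si.
  by rewrite (ipC LS (Le _ si)) (Sj _ si) sqc.
have LuS : inL2 (fun x => u x + - 1 * S x) by exact: inL2D.
apply: rc_inj; rewrite (sqn_ext (v := fun x => u x + - 1 * S x)); last first.
  by move=> x _; rewrite mulN1r.
have uE : ip u S = rc (\sum_(i <- s) sqmod (ip u (e i))).
  by rewrite (ipC LS)// SuE conjc_rc.
rewrite -ip_diag// ipDl// ipZl// (ipC LuS Lu) (ipC LuS LS) !ipDl// !ipZl//.
rewrite uE SuE SSE ip_diag// !mulN1r subrr [RHS]rmorphB.
have cB (A B : R) : conjc (rc A - rc B) = rc A - rc B.
  by rewrite /rc /=; congr Complex; ring.
by rewrite cB (_ : conjc 0 = 0) ?subr0// /= oppr0.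
Qed.

(** The Cauchy-Schwarz inequality, from Bessel's identity for the one-element system
    [e / sqrt k]. *)
Lemma bessel1 e u (k : R) : 0 < k -> inL2 u -> inL2 e -> ip e e = rc k ->
  sqmod (ip u e) <= k * fine (sqn u).
Proof.
move=> k0 Lu Le ee.
have k0' : rc k != 0 by rewrite rc_eq0 gt_eqF.
pose s := (Num.sqrt k)^-1; have s0 : s != 0 by rewrite invr_neq0// gt_eqF// sqrtr_gt0.
have s2 : s * s * k = 1.
  by rewrite -expr2 exprVn sqr_sqrtr ?ltW// mulVf// gt_eqF.
pose e' (_ : unit) x := rc s * e x.
have Le' i : inL2 (e' i) by exact: inL2Z.
have ce t : inL2 t -> ip t (e' tt) = rc s * ip t e.
  move=> Lt; rewrite (ipC (Le' tt) Lt) (ipZl _ Le Lt) (ipC Le Lt).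
  by rewrite /rc; case: (ip e t) => a b /=; congr Complex; ring.
have orth i j : ip (e' i) (e' j) = (i == j)%:R.
  case: i j => -[]; rewrite ce ?Le'// ipZl// ee -!rmorphM eqxx mulrA s2.
  by rewrite rmorph1.
have := @bessel _ [:: tt] e' u isT Lu (fun i _ => Le' i) (fun i j _ _ => orth i j).
rewrite !big_seq1 ce// sqmodM.
have -> : sqmod (rc s) = s * s by rewrite /sqmod /= expr0n addr0 expr2.
move=> E; have : 0 <= fine (sqn u) - s * s * sqmod (ip u e).
  by rewrite -E fine_ge0// sqn_ge0.
rewrite subr_ge0 => h; have := ler_wpM2l (ltW k0) h.
have -> : k * (s * s * sqmod (ip u e)) = s * s * k * sqmod (ip u e) by ring.
by rewrite s2 mul1r.
Qed.

End WeightedL2.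

(** * Integrals over the Euler boxes *)

Section BoundedIntegrable.
Context d (T : measurableType d) (R : realType) (mu : {measure set T -> \bar R}).

Lemma bounded_integrable (D : set T) (f : T -> R) (M : R) :
  measurable D -> (mu D < +oo)%E -> measurable_fun D f ->
  (forall x, D x -> `|f x| <= M) -> mu.-integrable D (EFin \o f).
Proof.
move=> mD Dfin mf fM; apply: measurable_bounded_integrable => //.
exists M; split; first exact: num_real.
by move=> y My x Dx; exact: le_trans (fM x Dx) (ltW My).
Qed.

End BoundedIntegrable.

Section ProductIntegral.
Context d1 d2 (T1 : measurableType d1) (T2 : measurableType d2) (R : realType).
Variables (m1 : {sigma_finite_measure set T1 -> \bar R}).
Variables (m2 : {sigma_finite_measure set T2 -> \bar R}).
Variables (A : set T1) (B : set T2) (f : T1 -> R) (g : T2 -> R) (M N : R).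
Hypotheses (mA : measurable A) (mB : measurable B).
Hypotheses (fA : (m1 A < +oo)%E) (fB : (m2 B < +oo)%E).
Hypotheses (mf : measurable_fun setT f) (mg : measurable_fun setT g).
Hypotheses (bf : forall x, A x -> `|f x| <= M) (bg : forall x, B x -> `|g x| <= N).

Lemma product_finite : ((m1 \x m2)%E (A `*` B) < +oo)%E.
Proof. by rewrite product_measure1E// lte_mul_pinfty// ge0_fin_numE. Qed.

Lemma integrable_prod :
  (m1 \x m2)%E.-integrable (A `*` B) (EFin \o (fun p => f p.1 * g p.2)).
Proof.
apply: (bounded_integrable (M := M * N)).
- exact: measurableX.
- exact: product_finite.
- apply: measurable_funTS; apply: measurable_funM.
    exact: measurableT_comp.
  exact: measurableT_comp.
- by move=> [x y] [/= Ax By]; rewrite normrM ler_pM ?bf ?bg.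
Qed.

Lemma Rintegral_prod :
  Rintegral (m1 \x m2)%E (A `*` B) (fun p => f p.1 * g p.2)
  = Rintegral m1 A f * Rintegral m2 B g.
Proof.
have intf : m1.-integrable A (EFin \o f).
  by apply: bounded_integrable bf => //; exact: measurable_funTS.
have intg : m2.-integrable B (EFin \o g).
  by apply: bounded_integrable bg => //; exact: measurable_funTS.
have mAB : measurable (A `*` B) by exact: measurableX.
have intfg := integrable_prod.
rewrite /Rintegral.
have E : (\int[(m1 \x m2)%E]_(p in A `*` B) (f p.1 * g p.2)%:E
    = \int[m1]_(x in A) \int[m2]_(y in B) (f x * g y)%:E)%E.
  rewrite integral_mkcond /= -integral12_prod_meas1/=; last first.
    exact: (integrable_mkcond _ mAB).1 intfg.
  rewrite [RHS]integral_mkcond; apply: eq_integral => x _.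
  rewrite patchE /fubini_F; case: ifPn => [xA|xA].
    rewrite [RHS]integral_mkcond; apply: eq_integral => y _.
    by rewrite !patchE in_setX xA.
  by apply: integral0_eq => y _; rewrite patchE in_setX (negbTE xA).
rewrite E.
have Ix x : A x -> (\int[m2]_(y in B) (f x * g y)%:E = (f x * Rintegral m2 B g)%:E)%E.
  move=> _; under eq_integral => y _ do rewrite EFinM.
  rewrite integralZl// EFinM /Rintegral fineK//.
  exact: integrable_fin_num intg.
transitivity (Rintegral m1 A (fun x => f x * Rintegral m2 B g)).
  by congr fine; apply: eq_integral => x; rewrite inE => /Ix.
by rewrite RintegralZr.
Qed.

End ProductIntegral.

Section ProductSigmaFinite.
Variable R : realType.
Context d1 d2 (T1 : measurableType d1) (T2 : measurableType d2).
Variables (m1 : {sigma_finite_measure set T1 -> \bar R}) (m2 : {sigma_finite_measure set T2 -> \bar R}).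

Lemma product_sigma_finite : sigma_finite setT (m1 \x m2)%E.
Proof.
have /sigma_finiteP[F [TF ndF Foo]] := sigma_finiteT m1.
have /sigma_finiteP[G [TG ndG Goo]] := sigma_finiteT m2.
exists (fun n => F n `*` G n).
  rewrite -setXTT TF TG; apply/seteqP; split=> -[x y].
    move=> [/= [n _ Fnx] [k _ Gky]]; exists (maxn n k) => //; split => /=.
      by move: x Fnx; exact/subsetPset/ndF/leq_maxl.
    by move: y Gky; exact/subsetPset/ndG/leq_maxr.
  by move=> [n _ []/= ? ?]; split; exists n.
move=> k; have [? ?] := Foo k; have [? ?] := Goo k.
split; first exact: measurableX.
by rewrite product_measure1E// lte_mul_pinfty// ge0_fin_numE.
Qed.

(* The library's canonical sigma-finite structure on [m1 \x m2] is shadowed by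
   the one for subprobabilities. *)
Definition sprod : {sigma_finite_measure set (T1 * T2)%type -> \bar R} :=
  HB.pack_for {sigma_finite_measure set (T1 * T2)%type -> \bar R} (m1 \x m2)%E
    (Measure_isSigmaFinite.Build _ _ _ (m1 \x m2)%E product_sigma_finite).
End ProductSigmaFinite.

(** * Integrals of trigonometric functions *)

Section OneDimensionalIntegrals.
Variable R : realType.
Local Notation lam := (@lebesgue_measure R).

Lemma Rintegral_deriv (f F : R -> R) (a b : R) : a < b -> continuous f ->
  (forall x, is_derive x (1 : R) F (f x)) ->
  Rintegral lam `[a, b]%classic f = F b - F a.
Proof.
move=> ab cf dF.
have cF : continuous F.
  by move=> x; apply/differentiable_continuous/derivable1_diffP; have [] := dF x.
rewrite /Rintegral (@continuous_FTC2 _ f F a b) //.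
- by move=> x; exact: continuous_subspaceT.
- split.
  + by move=> x _; have [] := dF x.
  + exact/cvg_at_right_filter/cF.
  + exact/cvg_at_left_filter/cF.
- by move=> x _; rewrite derive1E; have [_ ->] := dF x.
Qed.

Lemma continuous_integrable (f : R -> R) (a b : R) : continuous f ->
  lam.-integrable `[a, b]%classic (EFin \o f).
Proof.
by move=> cf; apply: continuous_compact_integrable; [exact: segment_compact|exact: continuous_subspaceT].
Qed.

Lemma continuous_cosM (k : R) : continuous (fun x : R => cos (k * x)).
Proof.
move=> x; apply: (@continuous_comp _ _ _ ( *%R k) cos); last exact: continuous_cos.
exact: mulrl_continuous.
Qed.

Lemma continuous_sinM (k : R) : continuous (fun x : R => sin (k * x)).
Proof.
move=> x; apply: (@continuous_comp _ _ _ ( *%R k) sin); last exact: continuous_sin.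
exact: mulrl_continuous.
Qed.

Lemma is_derive_sinM (k x : R) : k != 0 ->
  is_derive x (1 : R) (fun x => sin (k * x) / k) (cos (k * x)).
Proof.
move=> k0.
have H : is_derive x (1 : R) (fun x => k * x) k.
  by apply: is_derive_eq; rewrite /GRing.scale/= ; rewrite ?mulr0 ?mulr1 ?addr0.
apply: is_derive_eq; rewrite scaler0 add0r.
by rewrite /GRing.scale/= mulrC mulfK.
Qed.

Lemma is_derive_cosM (k x : R) : k != 0 ->
  is_derive x (1 : R) (fun x => - cos (k * x) / k) (sin (k * x)).
Proof.
move=> k0.
have H : is_derive x (1 : R) (fun x => k * x) k.
  by apply: is_derive_eq; rewrite /GRing.scale/= ; rewrite ?mulr0 ?mulr1 ?addr0.
apply: is_derive_eq; rewrite scaler0 add0r.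
by rewrite /GRing.scale/= mulNr opprK mulrC mulfK.
Qed.

Lemma Rintegral_cosM (k a b : R) : a < b -> k != 0 ->
  Rintegral lam `[a, b]%classic (fun x => cos (k * x)) = (sin (k * b) - sin (k * a)) / k.
Proof.
move=> ab k0; have D (x : R) := is_derive_sinM x k0.
by rewrite (Rintegral_deriv ab (@continuous_cosM k) D) mulrBl.
Qed.

Lemma Rintegral_sinM (k a b : R) : a < b -> k != 0 ->
  Rintegral lam `[a, b]%classic (fun x => sin (k * x)) = (cos (k * a) - cos (k * b)) / k.
Proof.
move=> ab k0; have D (x : R) := is_derive_cosM x k0.
by rewrite (Rintegral_deriv ab (@continuous_sinM k) D); field.
Qed.

Lemma Rintegral_cst_itv (a b c : R) : a < b ->
  Rintegral lam `[a, b]%classic (fun=> c) = c * (b - a).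
Proof.
move=> ab; rewrite Rintegral_cst//; congr (_ * _).
have E : lam `[a, b]%classic = (b - a)%:E.
  by have := lebesgue_measure_itv `[a, b]; rewrite /= lte_fin ab -EFinD.
exact: (congr1 fine E).
Qed.

Lemma cexpi_2pi (m : int) : cexpi (m%:~R * (2 * pi)) = 1 :> R[i].
Proof.
rewrite -cexpi_intX; have -> : cexpi (2 * pi) = 1 :> R[i].
  have -> : 2 * pi = 0 + pi *+ 2 :> R by rewrite add0r mulr2n; ring.
  by rewrite /cexpi cosD2pi sinD2pi cos0 sin0.
by rewrite exp1rz.
Qed.

Lemma Rintegral_itv_co (a b : R) (f : R -> R) : continuous f ->
  Rintegral lam `[a, b[%classic f = Rintegral lam `[a, b]%classic f.
Proof.
move=> cf; apply: Rintegral_itv_bndo_bndc.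
apply: integrableS (continuous_integrable a b cf) => //.
by apply: subset_itvl; rewrite bnd_simp.
Qed.

Lemma Rintegral_period_cos (m : int) :
  Rintegral lam `[0, 2 * pi[%classic (fun x => cos (m%:~R * x))
  = if m == 0 then 2 * pi else 0.
Proof.
have pp := pi_gt0 R; rewrite Rintegral_itv_co; last exact: continuous_cosM.
have p2 : 0 < 2 * pi :> R by rewrite mulr_gt0.
case: eqVneq => [->|m0].
  rewrite (eq_Rintegral lam (g := fun=> 1)) ?Rintegral_cst_itv ?subr0 ?mul1r//.
  by move=> x _; rewrite mul0r cos0.
have k0 : m%:~R != 0 :> R by rewrite intr_eq0.
rewrite Rintegral_cosM// mulr0 sin0.
by have [_ ->] := cexpi_2pi m; rewrite subr0 mul0r.
Qed.

Lemma Rintegral_period_sin (m : int) :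
  Rintegral lam `[0, 2 * pi[%classic (fun x => sin (m%:~R * x)) = 0.
Proof.
have pp := pi_gt0 R; rewrite Rintegral_itv_co; last exact: continuous_sinM.
have p2 : 0 < 2 * pi :> R by rewrite mulr_gt0.
case: (eqVneq m 0) => [->|m0].
  rewrite (eq_Rintegral lam (g := fun=> 0)) ?Rintegral_cst_itv ?mul0r//.
  by move=> x _; rewrite mul0r sin0.
have k0 : m%:~R != 0 :> R by rewrite intr_eq0.
rewrite Rintegral_sinM// mulr0 cos0.
by have [-> _] := cexpi_2pi m; rewrite subrr mul0r.
Qed.

Lemma Rintegral_arc_cos (m : int) (psi : R) : 0 < psi ->
  Rintegral lam `[- psi, psi]%classic (fun x => cos (m%:~R * x)) = s_ m psi.
Proof.
move=> p0; have pp : - psi < psi by lra.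
rewrite /s_; case: eqVneq => [->|m0].
  rewrite (eq_Rintegral lam (g := fun=> 1)) ?Rintegral_cst_itv ?mul1r//; first by ring.
  by move=> x _; rewrite mul0r cos0.
have k0 : m%:~R != 0 :> R by rewrite intr_eq0.
by rewrite Rintegral_cosM// mulrN sinN; congr (_ / _); ring.
Qed.

Lemma Rintegral_arc_sin (m : int) (psi : R) : 0 < psi ->
  Rintegral lam `[- psi, psi]%classic (fun x => sin (m%:~R * x)) = 0.
Proof.
move=> p0; have pp : - psi < psi by lra.
case: (eqVneq m 0) => [->|m0].
  rewrite (eq_Rintegral lam (g := fun=> 0)) ?Rintegral_cst_itv ?mul0r//.
  by move=> x _; rewrite mul0r sin0.
have k0 : m%:~R != 0 :> R by rewrite intr_eq0.
by rewrite Rintegral_sinM// mulrN cosN subrr mul0r.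
Qed.

(** The substitution [t = cos x], carried out through the explicit antiderivative [- (primitive
    P).[cos x]]. *)
Lemma Rintegral_poly_cos (P : {poly R}) :
  Rintegral lam `[0, pi]%classic (fun x => P.[cos x] * sin x) = intp P.
Proof.
have pp := pi_gt0 R.
have c : continuous (fun x : R => P.[cos x] * sin x).
  have c1 : continuous (fun x : R => P.[cos x]).
    move=> x; apply: (@continuous_comp _ _ _ cos (horner P)); first exact: continuous_cos.
    exact: continuous_horner.
  by move=> x; exact: (continuousM (c1 x) (@continuous_sin R x)).
have D (x : R) : is_derive x (1 : R) (fun x => - (primitive P).[cos x]) (P.[cos x] * sin x).
  have H := is_derive_poly (primitive P) (cos x).
  rewrite primitiveK in H.
  have H2 := @is_derive1_comp R (horner (primitive P)) cos x _ _ H (is_derive_cos x).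
  apply: is_derive_eq.
  by rewrite mulrN opprK.
by rewrite (Rintegral_deriv pp c D) cospi cos0 /intp; ring.
Qed.

End OneDimensionalIntegrals.

(** * Continuity of d-functions and separated integrals over boxes *)

Section BoxIntegrals.
Variable R : realType.
Local Notation lam := (@lebesgue_measure R).
Local Notation J := (`[0, 2 * pi[%classic : set R).
Local Notation K := (`[0, pi]%classic : set R).

Lemma continuous_sum (I : Type) (s : seq I) (F : I -> R -> R) :
  (forall i, continuous (F i)) -> continuous (fun x => \sum_(i <- s) F i x).
Proof.
move=> cF; elim: s => [|i s IH].
  by rewrite (_ : (fun x => _) = fun=> 0); [move=> x; exact: cvg_cst|apply/funext => x; rewrite big_nil].
rewrite (_ : (fun x => _) = (F i \+ (fun x => \sum_(j <- s) F j x))).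
  by move=> x; exact: continuousD (cF i x) (IH x).
by apply/funext => x; rewrite big_cons.
Qed.

(** Stable under products and powers, so it carries over from [dA] and [dB] to the polynomial of
    which [dm] is a coefficient. *)
Definition coef_continuous (p : R -> {poly R}) := forall i, continuous (fun x => (p x)`_i).

Lemma coef_continuousM p q : coef_continuous p -> coef_continuous q ->
  coef_continuous (fun x => p x * q x).
Proof.
move=> cp cq i; rewrite (_ : (fun x => _) = (fun x => \sum_(j < i.+1) (p x)`_j * (q x)`_(i - j))).
  apply: continuous_sum => j x; exact: continuousM (cp j x) (cq _ x).
by apply/funext => x; rewrite coefM.
Qed.

Lemma coef_continuousX p n : coef_continuous p -> coef_continuous (fun x => p x ^+ n).
Proof.
move=> cp; elim: n => [|n IH].
  move=> i; rewrite (_ : (fun x => _) = fun=> (1 : {poly R})`_i)//.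
  by move=> x; exact: cvg_cst.
by rewrite (_ : (fun x => _) = (fun x => p x * p x ^+ n)); [exact: coef_continuousM|apply/funext => x; rewrite exprS].
Qed.

Lemma dm_continuous n i l : continuous (@dm R n i l).
Proof.
have cc : continuous (fun x : R => cos (x / 2)).
  rewrite (_ : (fun x => _) = (fun x => cos (2^-1 * x))); first exact: continuous_cosM.
  by apply/funext => x; rewrite mulrC.
have cs : continuous (fun x : R => sin (x / 2)).
  rewrite (_ : (fun x => _) = (fun x => sin (2^-1 * x))); first exact: continuous_sinM.
  by apply/funext => x; rewrite mulrC.
have c0 (c : R) : continuous (fun _ : R => c) by move=> x; exact: cvg_cst.
have cA : coef_continuous (@dA R).
  case=> [|[|k]].
  - rewrite (_ : (fun x => _) = (fun x => sin (x / 2)))//.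
    by apply/funext => x; rewrite /dA coefD coefZ coefX coefC /= mulr0 add0r.
  - rewrite (_ : (fun x => _) = (fun x => cos (x / 2)))//.
    by apply/funext => x; rewrite /dA coefD coefZ coefX coefC /= mulr1 addr0.
  - rewrite (_ : (fun x => _) = (fun x => 0))//.
    by apply/funext => x; rewrite /dA coefD coefZ coefX coefC /= mulr0 addr0.
have cB : coef_continuous (@dB R).
  case=> [|[|k]].
  - rewrite (_ : (fun x => _) = (fun x => cos (x / 2)))//.
    by apply/funext => x; rewrite /dB coefB coefZ coefX coefC /= mulr0 subr0.
  - rewrite (_ : (fun x => _) = (fun x => - sin (x / 2))).
      by move=> x; exact: (continuousN (cs x)).
    by apply/funext => x; rewrite /dB coefB coefZ coefX coefC /= mulr1 sub0r.
  - rewrite (_ : (fun x => _) = (fun x => 0))//.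
    by apply/funext => x; rewrite /dB coefB coefZ coefX coefC /= mulr0 subr0.
move=> x; have := coef_continuousM (coef_continuousX (n := (2 * n - i)%N) cA) (coef_continuousX (n := i) cB).
by move=> /(_ (2 * n - l)%N x) H; exact: (continuousM (c0 _ x) H).
Qed.

Lemma continuous_segment_bounded (f : R -> R) (a b : R) : continuous f ->
  exists M, forall x, a <= x <= b -> `|f x| <= M.
Proof.
move=> cf; have := @continuous_compact _ _ f `[a, b]%classic (continuous_subspaceT cf) (@segment_compact R a b).
move=> /compact_bounded[M [_ HM]]; exists (M + 1) => x xab.
apply: (HM (M + 1)); first by rewrite ltrDl.
by exists x.
Qed.

Lemma continuous_mfun (f : R -> R) : continuous f -> measurable_fun setT f.
Proof. exact: continuous_measurable_fun. Qed.

Lemma lam_J : (lam J < +oo)%E.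
Proof. by rewrite (lebesgue_measure_itv `[0, 2 * pi[)/=; case: ifP => // _; rewrite -EFinD ltry. Qed.

Lemma lam_K : (lam K < +oo)%E.
Proof. by rewrite (lebesgue_measure_itv `[0, pi])/=; case: ifP => // _; rewrite -EFinD ltry. Qed.

Lemma box2E : @box2 R = J `*` K.
Proof.
apply/seteqP; split=> -[x y] /=; rewrite /box2 /= !in_itv /=; first by case.
by case=> ->; case: (_ <= y <= _).
Qed.

Lemma box3E : @box3 R = @box2 R `*` J.
Proof.
apply/seteqP; split=> -[[x y] z] /=; rewrite /box3 /box2 /= in_itv/=.
  by case=> -> [-> ->].
by case=> -[-> ->] ->.
Qed.

Lemma measurable_box2 : measurable (@box2 R).
Proof. by rewrite box2E; apply: measurableX. Qed.

Lemma measurable_box3 : measurable (@box3 R).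
Proof. by rewrite box3E; apply: measurableX => //; exact: measurable_box2. Qed.

Lemma mu2_box2 : (@mu2 R (@box2 R) < +oo)%E.
Proof. by rewrite box2E; apply: (product_finite (m1 := lam) (m2 := lam)) => //; [exact: lam_J|exact: lam_K]. Qed.

Lemma mu3_box3 : (@mu3 R (@box3 R) < +oo)%E.
Proof.
rewrite box3E.
apply: (product_finite (m1 := sprod lam lam) (m2 := lam)) => //.
- exact: measurable_box2.
- exact: mu2_box2.
- exact: lam_J.
Qed.

Lemma Rintegral_box2 (f g : R -> R) : continuous f -> continuous g ->
  (@mu2 R).-integrable (@box2 R) (EFin \o (fun p => f p.1 * g p.2)) /\
  Rintegral (@mu2 R) (@box2 R) (fun p => f p.1 * g p.2)
  = Rintegral lam J f * Rintegral lam K g.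
Proof.
move=> cf cg.
have [M HM] := continuous_segment_bounded 0 (2 * pi) cf.
have [N HN] := continuous_segment_bounded 0 pi cg.
have bf x : J x -> `|f x| <= M.
  by rewrite /= in_itv/= => /andP[x0 x1]; apply: HM; rewrite x0 ltW.
have bg x : K x -> `|g x| <= N by rewrite /= in_itv/= => xK; exact: HN.
rewrite box2E; split.
  apply: (integrable_prod (m1 := lam) (m2 := lam) (M := M) (N := N)) => //; [exact: lam_J|exact: lam_K|exact: continuous_mfun..].
apply: (Rintegral_prod (m1 := lam) (m2 := lam) (M := M) (N := N)) => //; [exact: lam_J|exact: lam_K|exact: continuous_mfun..].
Qed.

Lemma Rintegral_box3 (f g h : R -> R) : continuous f -> continuous g -> continuous h ->
  (@mu3 R).-integrable (@box3 R) (EFin \o (fun x => f x.1.1 * g x.1.2 * h x.2)) /\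
  Rintegral (@mu3 R) (@box3 R) (fun x => f x.1.1 * g x.1.2 * h x.2)
  = Rintegral lam J f * Rintegral lam K g * Rintegral lam J h.
Proof.
move=> cf cg ch.
have [M HM] := continuous_segment_bounded 0 (2 * pi) cf.
have [N HN] := continuous_segment_bounded 0 pi cg.
have [L HL] := continuous_segment_bounded 0 (2 * pi) ch.
pose k (p : R * R) := f p.1 * g p.2.
have bk p : @box2 R p -> `|k p| <= M * N.
  rewrite /box2 /= => -[/andP[x0 x1] yK]; rewrite normrM ler_pM// ?HN// HM//.
  by rewrite x0 ltW.
have bh x : J x -> `|h x| <= L.
  by rewrite /= in_itv/= => /andP[x0 x1]; apply: HL; rewrite x0 ltW.
have mk : measurable_fun setT k.
  apply: measurable_funM; (apply: measurableT_comp; [exact: continuous_mfun|]).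
    exact: measurable_fst.
  exact: measurable_snd.
have [_ E] := Rintegral_box2 cf cg.
rewrite -E box3E; split.
  apply: (integrable_prod (m1 := sprod lam lam) (m2 := lam) (f := k) (M := M * N) (N := L)) => //; [exact: measurable_box2|exact: mu2_box2|exact: lam_J|exact: continuous_mfun].
apply: (Rintegral_prod (m1 := sprod lam lam) (m2 := lam) (f := k) (M := M * N) (N := L)) => //; [exact: measurable_box2|exact: mu2_box2|exact: lam_J|exact: continuous_mfun].
Qed.

End BoxIntegrals.

(** * Orthonormal systems *)

Section Orthonormality.
Variable R : realType.
Local Notation C := R[i].
Local Notation lam := (@lebesgue_measure R).
Local Notation K := (`[0, pi]%classic : set R).

Definition w2 (p : R * R) : R := sin p.2.
Definition w3 (x : R * R * R) : R := sin x.1.2.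

Lemma sin01 (t : R) : 0 <= t <= pi -> 0 <= sin t <= 1.
Proof. by move=> tp; rewrite sin_ge0_pi//= sin_le1. Qed.

Lemma w2_01 p : @box2 R p -> 0 <= w2 p <= 1.
Proof. by move=> [_]; exact: sin01. Qed.

Lemma w3_01 x : @box3 R x -> 0 <= w3 x <= 1.
Proof. by move=> [_ [H _]]; exact: sin01. Qed.

Lemma mfun_snd2 (h : R -> R) : continuous h -> measurable_fun setT (fun p : R * R => h p.2).
Proof. by move=> ch; apply: measurableT_comp; [exact: continuous_mfun|exact: measurable_snd]. Qed.

Lemma mfun_fst2 (h : R -> R) : continuous h -> measurable_fun setT (fun p : R * R => h p.1).
Proof. by move=> ch; apply: measurableT_comp; [exact: continuous_mfun|exact: measurable_fst]. Qed.

Lemma mfun_3 (h : R * R -> R) : measurable_fun setT h ->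
  measurable_fun setT (fun x : R * R * R => h x.1).
Proof. by move=> mh; apply: measurableT_comp => //; exact: measurable_fst. Qed.

Lemma mfun_snd3 (h : R -> R) : continuous h -> measurable_fun setT (fun x : R * R * R => h x.2).
Proof. by move=> ch; apply: measurableT_comp; [exact: continuous_mfun|exact: measurable_snd]. Qed.

Lemma mw2 : measurable_fun (@box2 R) w2.
Proof. by apply: measurable_funTS; apply: mfun_snd2; exact: continuous_sin. Qed.

Lemma mw3 : measurable_fun (@box3 R) w3.
Proof.
by apply: measurable_funTS; apply: (mfun_3 (h := w2)); apply: mfun_snd2; exact: continuous_sin.
Qed.

Lemma cint_box2 (m : int) (h : R -> R) : continuous h ->
  cint (@mu2 R) (@box2 R) (fun p : R * R => rc (h p.2) * cexpi (m%:~R * p.1))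
  = rc (if m == 0 then 2 * pi * Rintegral lam K h else 0).
Proof.
move=> ch; have [_ E1] := Rintegral_box2 (@continuous_cosM R m%:~R) ch.
have [_ E2] := Rintegral_box2 (@continuous_sinM R m%:~R) ch.
rewrite /cint /rc; congr Complex.
  transitivity (Rintegral (@mu2 R) (@box2 R) (fun p => cos (m%:~R * p.1) * h p.2)).
    by apply: eq_Rintegral => p _ /=; ring.
  by rewrite E1 Rintegral_period_cos; case: eqP => // _; rewrite mul0r.
transitivity (Rintegral (@mu2 R) (@box2 R) (fun p => sin (m%:~R * p.1) * h p.2)).
  by apply: eq_Rintegral => p _ /=; ring.
by rewrite E2 Rintegral_period_sin mul0r.
Qed.

Lemma cint_box3 (m q : int) (h : R -> R) : continuous h ->
  cint (@mu3 R) (@box3 R)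
    (fun x : R * R * R => cexpi (m%:~R * x.1.1) * rc (h x.1.2) * cexpi (q%:~R * x.2))
  = rc (if (m == 0) && (q == 0) then (2 * pi) ^+ 2 * Rintegral lam K h else 0).
Proof.
move=> ch.
have cc (k : int) := @continuous_cosM R k%:~R; have cs (k : int) := @continuous_sinM R k%:~R.
have [i1 E1] := Rintegral_box3 (cc m) ch (cc q).
have [i2 E2] := Rintegral_box3 (cs m) ch (cs q).
have [i3 E3] := Rintegral_box3 (cs m) ch (cc q).
have [i4 E4] := Rintegral_box3 (cc m) ch (cs q).
rewrite !Rintegral_period_sin !Rintegral_period_cos in E1 E2 E3 E4.
rewrite /cint /rc; congr Complex.
  transitivity (Rintegral (@mu3 R) (@box3 R) (fun x =>
      cos (m%:~R * x.1.1) * h x.1.2 * cos (q%:~R * x.2)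
      - sin (m%:~R * x.1.1) * h x.1.2 * sin (q%:~R * x.2))).
    by apply: eq_Rintegral => x _ /=; ring.
  rewrite RintegralB//; last exact: measurable_box3.
  rewrite E1 E2 mulr0 subr0; case: (m == 0); case: (q == 0);
    by rewrite /= ?mulr0 ?mul0r//; ring.
transitivity (Rintegral (@mu3 R) (@box3 R) (fun x =>
    sin (m%:~R * x.1.1) * h x.1.2 * cos (q%:~R * x.2)
    + cos (m%:~R * x.1.1) * h x.1.2 * sin (q%:~R * x.2))).
  by apply: eq_Rintegral => x _ /=; ring.
rewrite RintegralD//; last exact: measurable_box3.
by rewrite E3 E4 !mul0r mulr0 addr0.
Qed.

Lemma Rintegral_dm n n' i i' l l' :
  (n + i' = n' + i)%N -> (n + l' = n' + l)%N ->
  (i <= 2 * n)%N -> (l <= 2 * n)%N -> (i' <= 2 * n')%N -> (l' <= 2 * n')%N ->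
  Rintegral lam K (fun b => dm n i l b * dm n' i' l' b * sin b)
  = if n == n' then 2 / (2 * n%:R + 1) else 0.
Proof.
move=> ii ll i2n l2n i2n' l2n'.
have [P [PE <-]] := dm_orth R ii ll i2n l2n i2n' l2n'.
rewrite -Rintegral_poly_cos; apply: eq_Rintegral => b; rewrite inE /= in_itv/= => /andP[b0 bp].
(* The polynomial formula is only known inside the interval; at both ends the factor [sin b] makes
   the integrands agree. *)
have [->|b0'] := eqVneq b 0; first by rewrite sin0 !mulr0.
have [->|bp'] := eqVneq b pi; first by rewrite sinpi !mulr0.
by rewrite PE// !lt_neqAle b0 bp eq_sym b0' bp'.
Qed.

Definition sgY n l : R := (- 1) ^+ (l + n) * Num.sqrt ((2 * n%:R + 1) / (4 * pi)).

Lemma Yx_xi n l (p : R * R) : (l <= 2 * n)%N -> @box2 R p ->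
  Yx n l (xi p.1 p.2)
  = rc (sgY n l * dm n n l p.2) * cexpi ((l%:Z - n%:Z)%:~R * p.1).
Proof.
move=> l2n [_ bp]; rewrite -Ysh_Yx// /Ysh nPz_dm//; congr (rc _ * _).
by rewrite /sgY; ring.
Qed.

Lemma continuous_mulf (f g : R -> R) : continuous f -> continuous g ->
  continuous (fun x => f x * g x).
Proof. by move=> cf cg x; exact: continuousM (cf x) (cg x). Qed.

Lemma continuous_cst (c : R) : continuous (fun _ : R => c).
Proof. by move=> x; exact: cvg_cst. Qed.

Lemma sqmod_cexpi (x : R) : sqmod (cexpi x) = 1.
Proof. by rewrite /sqmod /= cos2Dsin2. Qed.

Lemma sqmod_rc (x : R) : sqmod (rc x) = x ^+ 2.
Proof. by rewrite /sqmod /= expr0n addr0. Qed.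

Lemma cmeas_cexpi d (T : measurableType d) (D : set T) (h : T -> R) :
  measurable_fun D h -> cmeas D (fun x => cexpi (h x)).
Proof.
move=> mh; split => /=.
  by apply: measurableT_comp => //; apply: continuous_mfun; exact: continuous_cos.
by apply: measurableT_comp => //; apply: continuous_mfun; exact: continuous_sin.
Qed.

Lemma inL2_Y n l : (l <= 2 * n)%N ->
  inL2 (@mu2 R) (@box2 R) w2 (fun p => Yx n l (xi p.1 p.2)).
Proof.
move=> l2n.
apply: (@inL2_ext _ _ _ (@mu2 R) (@box2 R) w2
  (fun p => rc (sgY n l * dm n n l p.2) * cexpi ((l%:Z - n%:Z)%:~R * p.1))).
  by move=> p bp; rewrite Yx_xi.
have [M HM] := continuous_segment_bounded 0 pi (@dm_continuous R n n l).
apply: (@inL2_bounded _ _ _ (@mu2 R) (@box2 R) w2 (@measurable_box2 R) (@mu2_box2 R) mw2 w2_01 _ ((sgY n l) ^+ 2 * M ^+ 2)).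
  apply: cmeasM.
    apply: cmeas_rc; apply: measurable_funTS.
    apply: (mfun_snd2 (h := fun b => sgY n l * dm n n l b)).
    by apply: continuous_mulf; [exact: continuous_cst|exact: dm_continuous].
  apply: cmeas_cexpi; apply: measurable_funTS.
  apply: (mfun_fst2 (h := fun x => _ * x)); exact: mulrl_continuous.
move=> p [_ /HM bp]; rewrite sqmodM sqmod_cexpi mulr1 sqmod_rc exprMn.
apply: ler_wpM2l; first exact: sqr_ge0.
by rewrite -real_normK ?num_real// lerXn2r// ?nnegrE// (le_trans _ bp).
Qed.

(** Different orders are separated by the integral over the longitude. Equal orders reduce to
    [Rintegral_dm], and for equal degrees the constants give [2 pi * (2n + 1) / (4 pi) * 2 / (2n +
    1) = 1]. *)
Lemma ip_Y n l n' l' : (l <= 2 * n)%N -> (l' <= 2 * n')%N ->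
  ip (@mu2 R) (@box2 R) w2 (fun p => Yx n l (xi p.1 p.2)) (fun p => Yx n' l' (xi p.1 p.2))
  = ((n, l) == (n', l'))%:R.
Proof.
move=> l2n l2n'.
pose h (b : R) := sgY n l * sgY n' l' * (dm n n l b * dm n' n' l' b * sin b).
pose m : int := (l%:Z - n%:Z) - (l'%:Z - n'%:Z).
have cd : continuous (fun b : R => dm n n l b * dm n' n' l' b * sin b).
  exact: (continuous_mulf (continuous_mulf (@dm_continuous R n n l)
    (@dm_continuous R n' n' l')) (@continuous_sin R)).
have ch : continuous h.
  exact: (continuous_mulf (@continuous_cst (sgY n l * sgY n' l')) cd).
transitivity (cint (@mu2 R) (@box2 R) (fun p => rc (h p.2) * cexpi (m%:~R * p.1))).
  apply: cint_ext => p bp; rewrite !Yx_xi// /w2 /h /m.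
  have -> : (l%:Z - n%:Z - (l'%:Z - n'%:Z))%:~R * p.1
      = (l%:Z - n%:Z)%:~R * p.1 + - ((l'%:Z - n'%:Z)%:~R * p.1) :> R.
    by rewrite rmorphB /= mulrBl.
  rewrite cexpiD -conjc_cexpi; move: (sgY n l) (sgY n' l') (dm n n l p.2) (dm n' n' l' p.2) (sin _).
  move: (cexpi _) (cexpi _) => u [c d] a b e f g.
  by rewrite /rc; case: u => u v; apply/eqP; rewrite eq_complex /=;
    apply/andP; split; apply/eqP; ring.
rewrite cint_box2//.
have iK : lam.-integrable K (EFin \o (fun b => dm n n l b * dm n' n' l' b * sin b)).
  exact: continuous_integrable.
have [m0|m0] := eqVneq m 0; last first.
  rewrite rmorph0; case: eqP => // -[nn ll]; move/eqP: m0; case.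
  by rewrite /m nn ll subrr.
rewrite RintegralZl// Rintegral_dm//; try lia; rewrite ?xpair_eqE; try (rewrite /m in m0; lia).
have [nn|nn] /= := eqVneq n n'; last by rewrite !mulr0 rmorph0.
have -> : (l == l') = true by apply/eqP; rewrite /m in m0; lia.
subst n'; have el : l' = l by rewrite /m in m0; lia.
subst l'.
have p0 := pi_gt0 R; have n0 : 0 < 2 * n%:R + 1 :> R by rewrite ltr_wpDl// mulr_ge0.
rewrite -(rmorph1 (@rc R)); congr rc; rewrite /sgY.
have s1 : (- 1) ^+ (l + n) * (- 1) ^+ (l + n) = 1 :> R.
  by rewrite -exprMn mulrNN mulr1 expr1n.
have s2 : Num.sqrt ((2 * n%:R + 1) / (4 * pi)) * Num.sqrt ((2 * n%:R + 1) / (4 * pi))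
   = (2 * n%:R + 1) / (4 * pi) :> R.
  by rewrite -expr2 sqr_sqrtr// divr_ge0 ?mulr_ge0// ltW.
move: s1 s2; move: ((- 1 : R) ^+ (l + n)) (Num.sqrt _) => e q s1 s2.
transitivity (2 * pi * ((e * e) * (q * q)) * (2 / (2 * n%:R + 1))); first by ring.
rewrite s1 s2 mul1r.
by move: (pi : R) p0 => r r0; field; rewrite !gt_eqF.
Qed.

(** The D-function with [dm] in place of [wd], hence bounded and continuous up to the ends of the
    range of [beta]. *)
Definition Dm n i l (x : R * R * R) : C :=
  cexpi (- ((i%:Z - n%:Z)%:~R * x.1.1)) * rc (dm n i l x.1.2)
  * cexpi (- ((l%:Z - n%:Z)%:~R * x.2)).

Lemma cmeas_Dm n i l : cmeas (@box3 R) (Dm n i l).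
Proof.
apply: cmeasM; first apply: cmeasM.
- apply: cmeas_cexpi; apply: measurable_funTS; apply: measurable_funN.
  apply: (mfun_3 (h := fun p => _ * p.1)).
  apply: (mfun_fst2 (h := fun x => _ * x)); exact: mulrl_continuous.
- apply: cmeas_rc; apply: measurable_funTS.
  by apply: (mfun_3 (h := fun p => dm n i l p.2)); apply: mfun_snd2; exact: dm_continuous.
- apply: cmeas_cexpi; apply: measurable_funTS; apply: measurable_funN.
  apply: (mfun_snd3 (h := fun x => _ * x)); exact: mulrl_continuous.
Qed.

Lemma inL2_Dm n i l : inL2 (@mu3 R) (@box3 R) w3 (Dm n i l).
Proof.
have [M HM] := continuous_segment_bounded 0 pi (@dm_continuous R n i l).
apply: (@inL2_bounded _ _ _ (@mu3 R) (@box3 R) w3 (@measurable_box3 R) (@mu3_box3 R) mw3 w3_01 _ (M ^+ 2)).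
  exact: cmeas_Dm.
move=> x [_ [/HM bx _]]; rewrite /Dm !sqmodM !sqmod_cexpi mulr1 mul1r sqmod_rc.
by rewrite -real_normK ?num_real// lerXn2r// ?nnegrE// (le_trans _ bx).
Qed.

Lemma ip_Dm n i l n' i' l' :
  (i <= 2 * n)%N -> (l <= 2 * n)%N -> (i' <= 2 * n')%N -> (l' <= 2 * n')%N ->
  ip (@mu3 R) (@box3 R) w3 (Dm n i l) (Dm n' i' l')
  = rc (if [&& n == n', i == i' & l == l'] then 8 * pi ^+ 2 / (2 * n%:R + 1) else 0).
Proof.
move=> i2n l2n i2n' l2n'.
pose h (b : R) := dm n i l b * dm n' i' l' b * sin b.
pose m : int := - (i%:Z - n%:Z) + (i'%:Z - n'%:Z).
pose q : int := - (l%:Z - n%:Z) + (l'%:Z - n'%:Z).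
have ch : continuous h.
  exact: (continuous_mulf (continuous_mulf (@dm_continuous R n i l)
    (@dm_continuous R n' i' l')) (@continuous_sin R)).
transitivity (cint (@mu3 R) (@box3 R) (fun x => cexpi (m%:~R * x.1.1) * rc (h x.1.2) * cexpi (q%:~R * x.2))).
  apply: cint_ext => x bx; rewrite /Dm /w3 /h /m /q.
  have E (a b : int) (t : R) : (- a + b)%:~R * t = - (a%:~R * t) + b%:~R * t.
    by rewrite rmorphD rmorphN /=; ring.
  have cE (t : R) : cexpi t = conjc (cexpi (- t)) by rewrite conjc_cexpi opprK.
  rewrite !E !cexpiD (cE ((i'%:Z - n'%:Z)%:~R * _)) (cE ((l'%:Z - n'%:Z)%:~R * _)).
  move: (dm n i l x.1.2) (dm n' i' l' x.1.2) (sin _) => a b c.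
  move: (cexpi _) (cexpi _) (cexpi _) (cexpi _) => [u1 v1] [u2 v2] [u3 v3] [u4 v4].
  by rewrite /rc; apply/eqP; rewrite eq_complex /=;
    apply/andP; split; apply/eqP; ring.
rewrite cint_box3//.
have [m0|m0] := eqVneq m 0; last first.
  rewrite /= ifF//; apply/negP => /and3P[/eqP nn /eqP ii _]; move/eqP: m0; case.
  by rewrite /m nn ii addNr.
have [q0|q0] := eqVneq q 0; last first.
  rewrite /= ifF//; apply/negP => /and3P[/eqP nn _ /eqP ll]; move/eqP: q0; case.
  by rewrite /q nn ll addNr.
rewrite /= Rintegral_dm//; try (rewrite /m in m0; rewrite /q in q0; lia).
have [nn|nn] /= := eqVneq n n'; last by rewrite mulr0.
subst n'; have -> : (i == i') = true by apply/eqP; rewrite /m in m0; lia.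
have -> : (l == l') = true by apply/eqP; rewrite /q in q0; lia.
rewrite /=; congr rc.
have n0 : 0 < 2 * n%:R + 1 :> R by rewrite ltr_wpDl// mulr_ge0.
by move: (pi : R) => p; field; rewrite gt_eqF.
Qed.

End Orthonormality.

(** * The arc transform of harmonics *)

Section ArcTransform.
Variable R : realType.
Local Notation C := R[i].
Local Notation lam := (@lebesgue_measure R).

(** A function that is merely continuous within the sphere is shown measurable in angle coordinates,
    along arcs and after the arc transform by uniform approximation with harmonics, for which
    measurability is explicit. *)
Lemma cmeas_limit d (T : measurableType d) (D : set T) (u : T -> C) :
  (forall e : R, 0 < e -> exists2 v, cmeas D v & forall x, D x -> sqmod (v x - u x) <= e) ->
  cmeas D u.
Proof.
move=> H.
have /choice[v Hv] : forall k : nat, exists v, cmeas D v /\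
    forall x, D x -> sqmod (v x - u x) <= (k.+1%:R^-1) ^+ 2.
  move=> k; have [|v mv Hv] := H ((k.+1%:R^-1) ^+ 2); first by rewrite exprn_gt0// invr_gt0.
  by exists v.
have lim (a : nat -> R) (b : R) : (forall k, (a k - b) ^+ 2 <= (k.+1%:R^-1) ^+ 2) ->
    a @ \oo --> b.
  move=> Hab; apply/cvgrPdist_le => e e0; near=> k.
  have k1 : 0 <= k.+1%:R^-1 :> R by rewrite invr_ge0.
  have : `|b - a k| <= k.+1%:R^-1.
    by rewrite -(ler_pXn2r (n := 2))// ?nnegrE// real_normK ?num_real// -sqrrN opprB.
  move/le_trans; apply.
  near: k; have := near_infty_natSinv_lt (PosNum e0).
  by apply: filterS => k /= /ltW.
have bnd k x : D x -> (complex.Re (v k x) - complex.Re (u x)) ^+ 2 <= (k.+1%:R^-1) ^+ 2 /\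
    (complex.Im (v k x) - complex.Im (u x)) ^+ 2 <= (k.+1%:R^-1) ^+ 2.
  move=> /((Hv k).2); rewrite /sqmod; case: (v k x) (u x) => a b [p q] /=.
  by move=> h; split; apply: le_trans h; rewrite ?lerDl ?lerDr sqr_ge0.
split.
  apply: (@measurable_fun_cvg _ _ _ D (fun k x => complex.Re (v k x))).
    by move=> k; exact: (Hv k).1.1.
  by move=> x Dx; apply: lim => k; exact: (bnd k x Dx).1.
apply: (@measurable_fun_cvg _ _ _ D (fun k x => complex.Im (v k x))).
  by move=> k; exact: (Hv k).1.2.
by move=> x Dx; apply: lim => k; exact: (bnd k x Dx).2.
Unshelve. all: end_near. Qed.

Lemma Yx_arc n l (a b c phi : R) : (l <= 2 * n)%N ->
  Yx n l (invmx (Qe a b c) *m e_ phi)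
  = \sum_(i < (2 * n).+1) rc (nPz n (i%:Z - n%:Z) 0) * Dm n i l ((a, b), c)
      * cexpi ((i%:Z - n%:Z)%:~R * phi).
Proof.
(* The inverse rotation applies the Euler angles in reverse order with opposite signs: the outer
   phase [e^(-ijc)], with [j = l - n], comes out first, then the d-functions expand the middle
   rotation, and the last phase joins the equatorial value of each harmonic. *)
move=> l2n; rewrite invmx_Qe -!mulmxA Yx_R3// Yx_R2// mulr_sumr.
apply: eq_bigr => i _; have i2n : (i <= 2 * n)%N by rewrite -ltnS.
have hp : 0 <= (pi / 2 : R) <= pi.
  have := pi_gt0 R => p0; apply/andP; split; lra.
rewrite Yx_R3// e_xi -(Ysh_Yx phi i2n hp) /Ysh cos_pihalf /Dm /= !mulrN; ring.
Qed.

Lemma cint_arc_cexpi (m : int) (psi : R) : 0 < psi ->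
  cintegrable lam `[- psi, psi]%classic (fun x => cexpi (m%:~R * x)) /\
  cint lam `[- psi, psi]%classic (fun x => cexpi (m%:~R * x)) = rc (s_ m psi).
Proof.
move=> p0; split.
  by split; apply: continuous_integrable; [exact: continuous_cosM|exact: continuous_sinM].
by rewrite /cint /= Rintegral_arc_cos// Rintegral_arc_sin.
Qed.

Definition arcY psi n l (x : R * R * R) : C :=
  \sum_(i < (2 * n).+1) rc (nPz n (i%:Z - n%:Z) 0 * s_ (i%:Z - n%:Z) psi) * Dm n i l x.

Lemma Arc_Yx psi n l (a b c : R) : 0 < psi -> (l <= 2 * n)%N ->
  cintegrable lam `[- psi, psi]%classic (fun phi => Yx n l (invmx (Qe a b c) *m e_ phi)) /\
  Arc psi (Yx n l) (Qe a b c) = arcY psi n l ((a, b), c).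
Proof.
move=> p0 l2n.
have mI : measurable (`[- psi, psi]%classic : set (measurableTypeR R)) by [].
have E phi := Yx_arc a b c phi l2n.
have I i := (cint_arc_cexpi (i%:Z - n%:Z) p0).1.
have IZ (i : 'I_(2 * n).+1) := cintegrableZ mI (rc (nPz n (i%:Z - n%:Z) 0) * Dm n i l ((a, b), c)) (I i).
pose G (phi : measurableTypeR R) : C := \sum_(i < (2 * n).+1)
  rc (nPz n (i%:Z - n%:Z) 0) * Dm n i l ((a, b), c) * cexpi ((i%:Z - n%:Z)%:~R * phi).
split.
  apply: (@cintegrable_ext _ _ _ lam _ mI G); first by move=> phi _; rewrite E.
  by apply: cintegrable_sum => // i _; exact: IZ.
rewrite /Arc; transitivity (cint lam `[- psi, psi]%classic G).
  by apply: cint_ext => phi _; rewrite E.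
rewrite cint_sum//; apply: eq_bigr => i _.
by rewrite cintZ// (cint_arc_cexpi _ p0).2 rmorphM /=; ring.
Qed.

(* The entries of [s] are [(c, (n, n + k))], standing for [c Y_n^k]. *)
Definition hsum (s : seq (C * (nat * nat))) (x : 'cV[R]_3) : C :=
  \sum_(p <- s) p.1 * Yx p.2.1 p.2.2 x.
Definition arcsum psi (s : seq (C * (nat * nat))) (x : R * R * R) : C :=
  \sum_(p <- s) p.1 * arcY psi p.2.1 p.2.2 x.
Definition valid (s : seq (C * (nat * nat))) :=
  forall p, p \in s -> (p.2.2 <= 2 * p.2.1)%N.

Lemma Arc_hsum psi s (a b c : R) : 0 < psi -> valid s ->
  cintegrable lam `[- psi, psi]%classic (fun phi => hsum s (invmx (Qe a b c) *m e_ phi)) /\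
  Arc psi (hsum s) (Qe a b c) = arcsum psi s ((a, b), c).
Proof.
move=> p0 vs; have mI : measurable (`[- psi, psi]%classic : set (measurableTypeR R)) by [].
have I p : p \in s -> cintegrable lam `[- psi, psi]%classic
    (fun phi => p.1 * Yx p.2.1 p.2.2 (invmx (Qe a b c) *m e_ phi)).
  by move=> /vs vp; exact/cintegrableZ/(Arc_Yx a b c p0 vp).1.
split; first exact: cintegrable_sum.
rewrite /Arc /hsum cint_sum//; apply: eq_big_seq => p ps.
rewrite cintZ//; last exact: (Arc_Yx a b c p0 (vs _ ps)).1.
by rewrite -(Arc_Yx a b c p0 (vs _ ps)).2.
Qed.

Lemma inL2_hsum s : valid s -> inL2 (@mu2 R) (@box2 R) (@w2 R) (fun p => hsum s (xi p.1 p.2)).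
Proof.
move=> vs; apply: inL2_sum; [exact: measurable_box2|exact: mu2_box2|exact: mw2|exact: w2_01|].
move=> p /vs vp; apply: inL2Z; [exact: measurable_box2|exact: mw2|exact: w2_01|].
exact: inL2_Y.
Qed.

Lemma inL2_arcY psi n l : inL2 (@mu3 R) (@box3 R) (@w3 R) (arcY psi n l).
Proof.
apply: inL2_sum; [exact: measurable_box3|exact: mu3_box3|exact: mw3|exact: w3_01|].
move=> i _; apply: inL2Z; [exact: measurable_box3|exact: mw3|exact: w3_01|].
exact: inL2_Dm.
Qed.

Lemma inL2_arcsum psi s : inL2 (@mu3 R) (@box3 R) (@w3 R) (arcsum psi s).
Proof.
apply: inL2_sum; [exact: measurable_box3|exact: mu3_box3|exact: mw3|exact: w3_01|].
move=> i _; apply: inL2Z; [exact: measurable_box3|exact: mw3|exact: w3_01|].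
exact: inL2_arcY.
Qed.

End ArcTransform.

(** * Simultaneous approximation of a function and its arc transform *)

Section Approximation.
Variables (R : realType) (psi : R).
Hypothesis psi0 : 0 < psi.
Local Notation C := R[i].
Local Notation lam := (@lebesgue_measure R).
Local Notation I := (`[- psi, psi]%classic : set (measurableTypeR R)).

Lemma uniform_hsum_approx (f : 'cV[R]_3 -> C) (e : R) : ccontS2 f -> 0 < e ->
  exists2 s, valid s & forall x, S2 x -> sqmod (hsum s x - f x) <= e.
Proof.
move=> cf e0; have [T [s [vs sE]] HT] := uniform_span_approx cf e0.
by exists s => // x Sx; rewrite /hsum -sE// HT.
Qed.

Lemma lam_I : (lam I < +oo)%E.
Proof. by rewrite (lebesgue_measure_itv `[- psi, psi])/=; case: ifP => // _; rewrite -EFinD ltry. Qed.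

Lemma Rintegral_arc_bound (f : R -> R) (r : R) :
  lam.-integrable I (EFin \o f) -> (forall x, I x -> `|f x| <= r) ->
  (Rintegral lam I f) ^+ 2 <= (2 * psi * r) ^+ 2.
Proof.
move=> fI fr.
have pp : - psi < psi by have := psi0 => ?; lra.
have mI : measurable I by [].
have c : lam.-integrable I (EFin \o (fun=> r)).
  by apply: (bounded_integrable (M := `|r|)) => //; exact: lam_I.
have h : `|Rintegral lam I f| <= 2 * psi * r.
  apply: le_trans (le_normr_Rintegral mI fI) _.
  apply: le_trans (le_Rintegral mI (integrable_norm fI) c fr) _.
  by rewrite Rintegral_cst_itv// opprK le_eqVlt; apply/orP; left; apply/eqP; ring.
rewrite -[leLHS]real_normK ?num_real// lerXn2r// nnegrE ?normr_ge0//.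
exact: le_trans h.
Qed.

(** The arc has length [2 psi]; the outer factor 2 comes from bounding the real and imaginary parts
    separately. *)
Lemma cint_arc_bound (h : R -> C) (r : R) : 0 <= r ->
  cintegrable lam I h -> (forall x, I x -> sqmod (h x) <= r ^+ 2) ->
  sqmod (cint lam I h) <= 2 * (2 * psi * r) ^+ 2.
Proof.
move=> r0 [h1 h2] hr.
have bnd x : I x -> `|complex.Re (h x)| <= r /\ `|complex.Im (h x)| <= r.
  move=> /hr; rewrite /sqmod => H.
  split; rewrite -(ler_pXn2r (n := 2))// ?nnegrE// real_normK ?num_real//;
    apply: le_trans H; by rewrite ?lerDl ?lerDr sqr_ge0.
rewrite /sqmod /cint /= mulr_natl mulr2n lerD//.
  by apply: Rintegral_arc_bound => // x /bnd[].
by apply: Rintegral_arc_bound => // x /bnd[].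
Qed.

Lemma cintegrable_arc (F : 'cV[R]_3 -> C) (a b c : R) : ccontS2 F ->
  cintegrable lam I (fun phi => F (invmx (Qe a b c) *m e_ phi)).
Proof.
move=> cF; have mI : measurable I by [].
have mF : cmeas I (fun phi : measurableTypeR R => F (invmx (Qe a b c) *m e_ phi)).
  apply: cmeas_limit => e e0; have [s vs Hs] := uniform_hsum_approx cF e0.
  exists (fun phi => hsum s (invmx (Qe a b c) *m e_ phi)).
    have [[i1 i2] _] := Arc_hsum a b c psi0 vs.
    by split; apply/measurable_EFinP; [exact: measurable_int i1|exact: measurable_int i2].
  by move=> phi _; apply: Hs; exact: S2_arc.
have [M M0 HM] := within_S2_bounded cF.1.
have [N N0 HN] := within_S2_bounded cF.2.
split.
  apply: (bounded_integrable (M := M)) => //; [exact: lam_I|exact: mF.1|].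
  by move=> phi _; apply: HM; exact: S2_arc.
apply: (bounded_integrable (M := N)) => //; [exact: lam_I|exact: mF.2|].
by move=> phi _; apply: HN; exact: S2_arc.
Qed.

Lemma Arc_approx (F : 'cV[R]_3 -> C) s (r : R) : ccontS2 F -> valid s -> 0 <= r ->
  (forall x, S2 x -> sqmod (hsum s x - F x) <= r ^+ 2) ->
  forall x : R * R * R,
    sqmod (arcsum psi s x - Arc psi F (Qe x.1.1 x.1.2 x.2)) <= 2 * (2 * psi * r) ^+ 2.
Proof.
move=> cF vs r0 H [[a b] c] /=.
have mI : measurable I by [].
have [i1 <-] := Arc_hsum a b c psi0 vs; have i2 := cintegrable_arc a b c cF.
have -> : Arc psi (hsum s) (Qe a b c) - Arc psi F (Qe a b c)
    = cint lam I (fun phi => hsum s (invmx (Qe a b c) *m e_ phi)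
         + - 1 * F (invmx (Qe a b c) *m e_ phi)).
  by rewrite cintD//; [rewrite cintZ// mulN1r|exact: cintegrableZ].
apply: cint_arc_bound => //.
  by apply: cintegrableD => //; exact: cintegrableZ.
by move=> phi _; rewrite mulN1r; apply: H; exact: S2_arc.
Qed.

Lemma cmeas_contS2 (F : 'cV[R]_3 -> C) : ccontS2 F ->
  cmeas (@box2 R) (fun p : R * R => F (xi p.1 p.2)).
Proof.
move=> cF; apply: cmeas_limit => e e0; have [s vs Hs] := uniform_hsum_approx cF e0.
exists (fun p : R * R => hsum s (xi p.1 p.2)); first exact: (inL2_hsum vs).1.
by move=> p _; apply: Hs; exact: xi_S2.
Qed.

Lemma cmeas_ArcS2 (F : 'cV[R]_3 -> C) : ccontS2 F ->
  cmeas (@box3 R) (fun x : R * R * R => Arc psi F (Qe x.1.1 x.1.2 x.2)).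
Proof.
move=> cF; apply: cmeas_limit => e e0.
(* Solves [2 (2 psi r)^2 = e], the bound of [Arc_approx]. *)
pose r := Num.sqrt (e / (8 * psi ^+ 2)).
have p2 : 0 < 8 * psi ^+ 2 by rewrite mulr_gt0// exprn_gt0.
have r2 : r ^+ 2 = e / (8 * psi ^+ 2) by rewrite sqr_sqrtr// divr_ge0// ltW.
have [|s vs Hs] := uniform_hsum_approx cF (e := r ^+ 2).
  by rewrite r2 divr_gt0.
exists (arcsum psi s); first exact: (inL2_arcsum psi s).1.
move=> x _; apply: le_trans (Arc_approx cF vs (sqrtr_ge0 _) Hs x) _.
rewrite !exprMn r2 le_eqVlt; apply/orP; left; apply/eqP; field.
by rewrite gt_eqF.
Qed.

Lemma simultaneous_approx (f : 'cV[R]_3 -> C) (g : 'M[R]_3 -> C) :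
  cmeas (@box2 R) (fun p : R * R => f (xi p.1 p.2)) ->
  cmeas (@box3 R) (fun x : R * R * R => g (Qe x.1.1 x.1.2 x.2)) ->
  (exists fm : nat -> 'cV[R]_3 -> C,
      (forall m, ccontS2 (fm m)) /\
      to0 (fun m => L2S2 (fun x => fm m x - f x)) /\
      to0 (fun m => L2SO3 (fun Q => Arc psi (fm m) Q - g Q))) ->
  forall e : R, 0 < e -> exists s, [/\ valid s,
    (sqn (@mu2 R) (@box2 R) (@w2 R) (fun p => (f (xi p.1 p.2) - hsum s (xi p.1 p.2))%R) < e%:E)%E &
    (sqn (@mu3 R) (@box3 R) (@w3 R) (fun x => (g (Qe x.1.1 x.1.2 x.2) - arcsum psi s x)%R) < e%:E)%E].
Proof.
move=> mf mg [fm [cfm [cvf cvg]]] e e0.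
have e4 : 0 < e / 4 by rewrite divr_gt0.
have [N1 H1] := cvf _ e4; have [N2 H2] := cvg _ e4.
pose m := maxn N1 N2.
have {}H1 := H1 m (leq_maxl _ _); have {}H2 := H2 m (leq_maxr _ _).
have [V2 V2E] : exists V : R, @mu2 R (@box2 R) = V%:E.
  exists (fine (@mu2 R (@box2 R))); rewrite fineK// ge0_fin_numE//; exact: mu2_box2.
have [V3 V3E] : exists V : R, @mu3 R (@box3 R) = V%:E.
  exists (fine (@mu3 R (@box3 R))); rewrite fineK// ge0_fin_numE//; exact: mu3_box3.
have V20 : 0 <= V2 by rewrite -lee_fin -V2E.
have V30 : 0 <= V3 by rewrite -lee_fin -V3E.
pose k := 8 * psi ^+ 2.
have k0 : 0 < k by rewrite mulr_gt0// exprn_gt0.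
(* A squared uniform error [q] on the sphere costs [q V2] there and, since [Arc_approx] turns [q]
   into [k q], costs [k q V3] on the rotation group. Both are at most [e / 4]; the summand 1 keeps
   the denominator positive. *)
pose q := e / 4 / (1 + V2 + k * V3).
have d0 : 0 < 1 + V2 + k * V3.
  by rewrite -addrA ltr_pwDl// addr_ge0// mulr_ge0// ltW.
have q0 : 0 < q by rewrite divr_gt0.
have qV2 : q * V2 <= e / 4.
  rewrite /q mulrAC ler_pdivrMr// ler_wpM2l ?(ltW e4)//.
  have : 0 <= k * V3 by rewrite mulr_ge0// ltW.
  by lra.
have qV3 : k * q * V3 <= e / 4.
  have -> : k * q * V3 = e / 4 * (k * V3) / (1 + V2 + k * V3) by rewrite /q; field; rewrite gt_eqF.
  by rewrite ler_pdivrMr// ler_wpM2l ?(ltW e4)//; lra.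
pose r := Num.sqrt q; have r2 : r ^+ 2 = q by rewrite sqr_sqrtr// ltW.
have [|s vs Hs] := uniform_hsum_approx (cfm m) (e := r ^+ 2); first by rewrite r2.
exists s; split => //.
- apply: (@sqn_near _ _ _ (@mu2 R) (@box2 R) (@w2 R) (@measurable_box2 R) (@mw2 R) (@w2_01 R)
    (fun p => f (xi p.1 p.2)) (fun p => hsum s (xi p.1 p.2)) (fun p => fm m (xi p.1 p.2)) q V2) => //; [exact: (inL2_hsum vs).1|exact: cmeas_contS2|exact: ltW|].
  by move=> p _; rewrite -r2; apply: Hs; exact: xi_S2.
- apply: (@sqn_near _ _ _ (@mu3 R) (@box3 R) (@w3 R) (@measurable_box3 R) (@mw3 R) (@w3_01 R)
    (fun x => g (Qe x.1.1 x.1.2 x.2)) (arcsum psi s) (fun x => Arc psi (fm m) (Qe x.1.1 x.1.2 x.2)) (k * q) V3) => //;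
    [exact: (inL2_arcsum psi s).1|exact: cmeas_ArcS2|by rewrite ltW// mulr_gt0|].
  move=> x _; apply: le_trans (Arc_approx (cfm m) vs (sqrtr_ge0 _) Hs x) _.
  by rewrite le_eqVlt; apply/orP; left; apply/eqP; rewrite !exprMn r2 /k; ring.
Qed.

End Approximation.

(** * Reconstruction *)

Section Reconstruction.
Variable R : realType.
Local Notation C := R[i].
Local Notation mu2 := (@mu2 R).
Local Notation mu3 := (@mu3 R).
Local Notation box2 := (@box2 R).
Local Notation box3 := (@box3 R).
Local Notation w2 := (@w2 R).
Local Notation w3 := (@w3 R).
Local Notation ipS := (ip mu2 box2 w2).
Local Notation ipG := (ip mu3 box3 w3).
Local Notation onS f := (fun p : R * R => f (xi p.1 p.2)).
Local Notation onG g := (fun x : R * R * R => g (Qe x.1.1 x.1.2 x.2)).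
Local Notation inS := (inL2 mu2 box2 w2).
Local Notation inG := (inL2 mu3 box3 w3).
Let mb2 := @measurable_box2 R.
Let mb3 := @measurable_box3 R.
Let fin2 := @mu2_box2 R.
Let fin3 := @mu3_box3 R.
Let mw2 := @mw2 R.
Let mw3 := @mw3 R.
Let w2_01 := @w2_01 R.
Let w3_01 := @w3_01 R.

Definition arc_eigen n j (psi : R) : R := nPz n (j%:Z - n%:Z) 0 * s_ (j%:Z - n%:Z) psi.

Lemma ip_hsum s n l : valid s -> (l <= 2 * n)%N ->
  ipS (onS (hsum s)) (onS (Yx n l)) = \sum_(p <- s) p.1 * (p.2 == (n, l))%:R.
Proof.
move=> vs l2n; have LY := inL2_Y R l2n.
rewrite (@ip_suml _ _ _ mu2 box2 w2 mb2 mw2 w2_01 _ s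
  (fun p x => p.1 * Yx p.2.1 p.2.2 (xi x.1 x.2)) _ LY); last first.
  by move=> p /vs vp; apply: (@inL2Z _ _ _ mu2 box2 w2 mb2 mw2 w2_01); exact: inL2_Y.
apply: eq_big_seq => p /vs vp.
by rewrite (@ipZl _ _ _ mu2 box2 w2 mb2 mw2 w2_01 p.1 _ _ (inL2_Y R vp) LY) ip_Y//.
Qed.

Definition indices N : seq (nat * nat) :=
  [seq (n, l) | n <- index_iota 0 N.+1, l <- index_iota 0 (2 * n + 1)].

Lemma mem_indices N n l : ((n, l) \in indices N) = (n <= N)%N && (l <= 2 * n)%N.
Proof.
apply/allpairsPdep/andP => [[n' [l' []]]|[nN l2n]].
  by rewrite !mem_index_iota => h1 h2 [-> ->]; lia.
by exists n, l; rewrite !mem_index_iota; split => //; lia.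
Qed.

Lemma indices_uniq N : uniq (indices N).
Proof.
apply: allpairs_uniq_dep => [|n _|]; [exact: iota_uniq|exact: iota_uniq|].
by move=> [n l] [n' l'] _ _ /= [-> ->].
Qed.

Lemma hsum_expand s N x : valid s -> (forall p, p \in s -> (p.2.1 <= N)%N) ->
  \sum_(i <- indices N) ipS (onS (hsum s)) (onS (Yx i.1 i.2)) * Yx i.1 i.2 x = hsum s x.
Proof.
move=> vs sN.
transitivity (\sum_(i <- indices N) \sum_(p <- s) p.1 * (p.2 == i)%:R * Yx i.1 i.2 x).
  apply: eq_big_seq => -[n l]; rewrite mem_indices => /andP[_ l2n].
  by rewrite ip_hsum// mulr_suml.
rewrite exchange_big /=; apply: eq_big_seq => p ps.
have pN : p.2 \in indices N.
  by rewrite [p.2]surjective_pairing mem_indices sN// vs.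
rewrite (bigD1_seq p.2 pN (indices_uniq N)) eqxx mulr1 big1 => [|i ip].
  exact: addr0.
by rewrite eq_sym (negbTE ip) mulr0 mul0r.
Qed.

Lemma ip_arcY psi n l n' j l' : (l <= 2 * n)%N -> (j <= 2 * n')%N -> (l' <= 2 * n')%N ->
  ipG (arcY psi n l) (Dm n' j l')
  = rc (8 * pi ^+ 2 / (2 * n'%:R + 1) * arc_eigen n' j psi) * ((n, l) == (n', l'))%:R.
Proof.
move=> l2n j2n l2n'; have LD := @inL2_Dm R n' j l'.
rewrite (@ip_suml _ _ _ mu3 box3 w3 mb3 mw3 w3_01 _ _
  (fun (i : 'I_(2 * n).+1) x => rc (nPz n (i%:Z - n%:Z) 0 * s_ (i%:Z - n%:Z) psi) * Dm n i l x) _ LD); last first.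
  by move=> i _; apply: (@inL2Z _ _ _ mu3 box3 w3 mb3 mw3 w3_01); exact: inL2_Dm.
have E (i : 'I_(2 * n).+1) : ipG (fun x => rc (nPz n (i%:Z - n%:Z) 0 * s_ (i%:Z - n%:Z) psi) * Dm n i l x) (Dm n' j l')
  = if [&& n == n', i == j :> nat & l == l']
    then rc (8 * pi ^+ 2 / (2 * n'%:R + 1) * arc_eigen n' j psi) else 0.
  rewrite (@ipZl _ _ _ mu3 box3 w3 mb3 mw3 w3_01 _ _ _ (@inL2_Dm R n i l) LD).
  rewrite ip_Dm//; last by rewrite -ltnS.
  case: ifP => [/and3P[/eqP <- /eqP <- _]|_]; last by rewrite rmorph0 mulr0.
  by rewrite -rmorphM /arc_eigen mulrC.
under eq_bigr do rewrite E.
rewrite xpair_eqE; have [nn|nn] := eqVneq n n'; last by rewrite big1 ?mulr0.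
subst n'; have [ll|ll] := eqVneq l l'; last first.
  by rewrite big1 ?mulr0// => i _; rewrite andbF.
rewrite mulr1 (bigD1 (Ordinal (j2n : (j < (2 * n).+1)%N)))//= eqxx.
rewrite big1 ?addr0// => i ij; rewrite ifF//; apply/negbTE; rewrite andbT.
by apply: contra ij => /eqP ij; apply/eqP/val_inj.
Qed.

Lemma ip_arcsum psi s n j l : valid s -> (j <= 2 * n)%N -> (l <= 2 * n)%N ->
  ipG (arcsum psi s) (Dm n j l)
  = rc (8 * pi ^+ 2 / (2 * n%:R + 1) * arc_eigen n j psi)
    * ipS (onS (hsum s)) (onS (Yx n l)).
Proof.
move=> vs j2n l2n; have LD := @inL2_Dm R n j l.
rewrite (@ip_suml _ _ _ mu3 box3 w3 mb3 mw3 w3_01 _ _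
  (fun p x => p.1 * arcY psi p.2.1 p.2.2 x) _ LD); last first.
  by move=> i _; apply: (@inL2Z _ _ _ mu3 box3 w3 mb3 mw3 w3_01); exact: inL2_arcY.
rewrite ip_hsum// mulr_sumr; apply: eq_big_seq => p /vs vp.
rewrite (@ipZl _ _ _ mu3 box3 w3 mb3 mw3 w3_01 _ _ _ (inL2_arcY psi _ _) LD).
by rewrite ip_arcY// mulrCA -surjective_pairing.
Qed.

Lemma ghat_ip (g : 'M[R]_3 -> C) n j l : (j <= 2 * n)%N -> (l <= 2 * n)%N ->
  ghat g n (j%:Z - n%:Z) (l%:Z - n%:Z)
  = rc ((2 * n%:R + 1) / (8 * pi ^+ 2)) * ipG (onG g) (Dm n j l).
Proof.
move=> j2n l2n; rewrite /ghat; congr (_ * _).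
apply: cint_ext => x [_ [/andP[b0 bp] _]]; rewrite /w3.
(* [WD] and [Dm] are only known to agree for [0 < beta < pi]; at the two ends the weight is zero. *)
have [->|b0'] := eqVneq x.1.2 0; first by rewrite sin0 rmorph0 !mulr0.
have [->|bp'] := eqVneq x.1.2 pi; first by rewrite sinpi rmorph0 !mulr0.
by rewrite /WD /Dm wd_dm// !lt_neqAle b0 bp eq_sym b0' bp'.
Qed.

(** * Identification of the coefficients and best approximation *)

Section Coefficients.
Variables (psi : R) (f : 'cV[R]_3 -> C) (g : 'M[R]_3 -> C).
Hypothesis psi_range : 0 < psi < pi.
Hypothesis Lf : inS (onS f).
Hypothesis Lg : inG (onG g).
Hypothesis approx : forall e : R, 0 < e -> exists s, [/\ valid s,
  (sqn mu2 box2 w2 (fun p => (f (xi p.1 p.2) - hsum s (xi p.1 p.2))%R) < e%:E)%E &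
  (sqn mu3 box3 w3 (fun x => (g (Qe x.1.1 x.1.2 x.2) - arcsum psi s x)%R) < e%:E)%E].

Lemma ip_arc_transform n j l : (j <= 2 * n)%N -> (l <= 2 * n)%N ->
  ipG (onG g) (Dm n j l)
  = rc (8 * pi ^+ 2 / (2 * n%:R + 1) * arc_eigen n j psi) * ipS (onS f) (onS (Yx n l)).
Proof.
move=> j2n l2n; set c : R := 8 * pi ^+ 2 / (2 * n%:R + 1).
have p0 := pi_gt0 R; have n0 : 0 < 2 * n%:R + 1 :> R by rewrite ltr_wpDl// mulr_ge0.
have c0 : 0 < c by rewrite divr_gt0// mulr_gt0// exprn_gt0.
set a := arc_eigen n j psi.
apply/eqP; rewrite -subr_eq0; set z := _ - _.
have K0 : 0 < 2 * (c + (c * a) ^+ 2).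
  by rewrite mulr_gt0// ltr_pwDl// sqr_ge0.
suff small e : 0 < e -> sqmod z <= 2 * (c + (c * a) ^+ 2) * e.
  have : sqmod z <= 0.
    rewrite leNgt; apply/negP => z0.
    (* With this [e] the bound reads [sqmod z <= sqmod z / 2]. *)
    have := small (sqmod z / (2 * (c + (c * a) ^+ 2)) / 2).
    rewrite !divr_gt0// => /(_ isT).
    have -> : 2 * (c + (c * a) ^+ 2) * (sqmod z / (2 * (c + (c * a) ^+ 2)) / 2) = sqmod z / 2.
      by field; rewrite gt_eqF// -(pmulr_rgt0 _ (ltr0Sn _ 1)).
    by lra.
  rewrite /sqmod; case: (z) => u v /= uv; rewrite eq_complex /=.
  have := sqr_ge0 u; have := sqr_ge0 v => h1 h2.
  by rewrite -(sqrf_eq0 u) -(sqrf_eq0 v); apply/andP; split; apply/eqP; lra.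
move=> e0; have [s [vs Hf Hg]] := approx e0.
have Lh := inL2_hsum vs; have La := inL2_arcsum psi s.
have Ly := inL2_Y R l2n; have LD := @inL2_Dm R n j l.
have N1 := @inL2Z _ _ _ mu2 box2 w2 mb2 mw2 w2_01 (- 1) _ Lh.
have N2 := @inL2Z _ _ _ mu3 box3 w3 mb3 mw3 w3_01 (- 1) _ La.
have D1 := @inL2D _ _ _ mu2 box2 w2 mb2 mw2 w2_01 _ _ Lf N1.
have D2 := @inL2D _ _ _ mu3 box3 w3 mb3 mw3 w3_01 _ _ Lg N2.
have E1 := @ipDl _ _ _ mu2 box2 w2 mb2 mw2 w2_01 _ _ _ Lf N1 Ly.
have E2 := @ipDl _ _ _ mu3 box3 w3 mb3 mw3 w3_01 _ _ _ Lg N2 LD.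
have E3 := @ipZl _ _ _ mu2 box2 w2 mb2 mw2 w2_01 (- 1) _ _ Lh Ly.
have E4 := @ipZl _ _ _ mu3 box3 w3 mb3 mw3 w3_01 (- 1) _ _ La LD.
have B1 : sqmod (ipS (fun p => f (xi p.1 p.2) + -1 * hsum s (xi p.1 p.2)) (onS (Yx n l))) <= e.
  have := @bessel1 _ _ _ mu2 box2 w2 mb2 fin2 mw2 w2_01 _ _ 1 ltr01 D1 Ly.
  rewrite ip_Y// eqxx rmorph1 mul1r => /(_ erefl) /le_trans; apply.
  rewrite -lee_fin -(@sqnE _ _ _ mu2 box2 w2 w2_01 _ D1) ltW//; apply: le_lt_trans Hf.
  by rewrite le_eqVlt; apply/orP; left; apply/eqP; apply: sqn_ext => p _; rewrite mulN1r.
have B2 : sqmod (ipG (fun x => g (Qe x.1.1 x.1.2 x.2) + -1 * arcsum psi s x) (Dm n j l)) <= c * e.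
  have := @bessel1 _ _ _ mu3 box3 w3 mb3 fin3 mw3 w3_01 _ _ c c0 D2 LD.
  rewrite ip_Dm// !eqxx => /(_ erefl) /le_trans; apply.
  apply: ler_wpM2l; first exact: ltW.
  rewrite -lee_fin -(@sqnE _ _ _ mu3 box3 w3 w3_01 _ D2) ltW//; apply: le_lt_trans Hg.
  by rewrite le_eqVlt; apply/orP; left; apply/eqP; apply: sqn_ext => p _; rewrite mulN1r.
(* The identity is exact for [hsum s], so only the residuals contribute; [B1] and [B2] bound their
   two inner products. *)
have zE : z = ipG (fun x => g (Qe x.1.1 x.1.2 x.2) + -1 * arcsum psi s x) (Dm n j l)
   + - rc (c * a) * ipS (fun p => f (xi p.1 p.2) + -1 * hsum s (xi p.1 p.2)) (onS (Yx n l)).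
  by rewrite E1 E2 E3 E4 ip_arcsum// /z -/c -/a; ring.
rewrite zE; apply: le_trans (sqmodD _ _) _; rewrite sqmodM.
have -> : sqmod (- rc (c * a)) = (c * a) ^+ 2 by rewrite -rmorphN sqmod_rc sqrrN.
rewrite -mulrA; apply: ler_wpM2l => //; rewrite mulrDl lerD//.
by apply: ler_wpM2l => //; exact: sqr_ge0.
Qed.

Lemma ghat_arc n j l : (j <= 2 * n)%N -> (l <= 2 * n)%N ->
  ghat g n (j%:Z - n%:Z) (l%:Z - n%:Z) = rc (arc_eigen n j psi) * ipS (onS f) (onS (Yx n l)).
Proof.
move=> j2n l2n; rewrite ghat_ip// ip_arc_transform// mulrA -rmorphM; congr (rc _ * _).
have p0 := pi_gt0 R; have n0 : 0 < 2 * n%:R + 1 :> R by rewrite ltr_wpDl// mulr_ge0.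
by move: (pi : R) (arc_eigen _ _ _) p0 => r a r0; field; rewrite !gt_eqF.
Qed.

Lemma coef_ip n l : (l <= 2 * n)%N ->
  coef psi g n (l%:Z - n%:Z) = ipS (onS f) (onS (Yx n l)).
Proof.
move=> l2n; rewrite /coef.
have d0 := denominator_gt0 n psi_range.
have d0' : rc (\sum_(j < 2 * n + 1) nPz n (zidx j) 0 ^+ 2 * s_ (zidx j) psi ^+ 2) != 0.
  by rewrite rc_eq0 gt_eqF.
apply: (mulIf d0'); rewrite mulfVK// [in RHS]rmorph_sum mulr_sumr.
apply: eq_bigr => j _; have j2n : (j <= 2 * n)%N by rewrite -ltnS -[X in (_ < X)%N]addn1.
rewrite /zidx ghat_arc// -/(arc_eigen n j psi) mulrA -rmorphM mulrC; congr (_ * rc _).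
by rewrite /arc_eigen; ring.
Qed.

Lemma psum_ip N (p : R * R) : box2 p -> psum psi g N p.1 p.2
  = \sum_(i <- indices N) ipS (onS f) (onS (Yx i.1 i.2)) * Yx i.1 i.2 (xi p.1 p.2).
Proof.
move=> [_ bp]; rewrite /psum big_allpairs_dep big_mkord.
apply: eq_bigr => n _; rewrite big_mkord.
apply: eq_bigr => l _; have l2n : (l <= 2 * n)%N by rewrite -ltnS -[X in (_ < X)%N]addn1.
by rewrite /zidx coef_ip// Ysh_Yx.
Qed.

(** Since [hsum s] is its own projection onto degrees at most [N], the function [f - psum] is the
    residual of [h = f - hsum s] under that projection, and Bessel's identity applied to [h]
    compares the norms. *)
Lemma psum_near s N : valid s -> (forall p, p \in s -> (p.2.1 <= N)%N) ->
  (sqn mu2 box2 w2 (fun p => (f (xi p.1 p.2) - psum psi g N p.1 p.2)%R)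
   <= sqn mu2 box2 w2 (fun p => (f (xi p.1 p.2) - hsum s (xi p.1 p.2))%R))%E.
Proof.
move=> vs sN; have Lh := inL2_hsum vs.
have N1 := @inL2Z _ _ _ mu2 box2 w2 mb2 mw2 w2_01 (- 1) _ Lh.
have D1 := @inL2D _ _ _ mu2 box2 w2 mb2 mw2 w2_01 _ _ Lf N1.
have LY i : i \in indices N -> inS (onS (Yx i.1 i.2)).
  by case: i => n l; rewrite mem_indices => /andP[_ l2n]; exact: inL2_Y.
pose h (p : R * R) := f (xi p.1 p.2) + - 1 * hsum s (xi p.1 p.2).
have hE p : box2 p -> f (xi p.1 p.2) - psum psi g N p.1 p.2
    = h p - \sum_(i <- indices N) ipS h (onS (Yx i.1 i.2)) * Yx i.1 i.2 (xi p.1 p.2).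
  move=> bp; rewrite psum_ip// {1}/h -(hsum_expand (xi p.1 p.2) vs sN).
  transitivity (f (xi p.1 p.2) + - 1 * \sum_(i <- indices N) ipS (onS (hsum s)) (onS (Yx i.1 i.2)) * Yx i.1 i.2 (xi p.1 p.2)
    - \sum_(i <- indices N) (ipS (onS f) (onS (Yx i.1 i.2)) * Yx i.1 i.2 (xi p.1 p.2)
      - ipS (onS (hsum s)) (onS (Yx i.1 i.2)) * Yx i.1 i.2 (xi p.1 p.2))).
    by rewrite sumrB; ring.
  congr (_ - _); apply: eq_big_seq => i /LY Li.
  have -> : ipS h (onS (Yx i.1 i.2)) = ipS (onS f) (onS (Yx i.1 i.2)) - ipS (onS (hsum s)) (onS (Yx i.1 i.2)).
    transitivity (ipS (onS f) (onS (Yx i.1 i.2)) + ipS (fun p => - 1 * hsum s (xi p.1 p.2)) (onS (Yx i.1 i.2))).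
      exact: (@ipDl _ _ _ mu2 box2 w2 mb2 mw2 w2_01 _ _ _ Lf N1 Li).
    congr (_ + _); rewrite -[RHS]mulN1r.
    exact: (@ipZl _ _ _ mu2 box2 w2 mb2 mw2 w2_01 (- 1) _ _ Lh Li).
  by rewrite mulrBl.
have orth i j : i \in indices N -> j \in indices N ->
    ipS (onS (Yx i.1 i.2)) (onS (Yx j.1 j.2)) = (i == j)%:R.
  case: i j => n l [n' l']; rewrite !mem_indices => /andP[_ l2n] /andP[_ l2n'].
  exact: ip_Y.
have B := @bessel _ _ _ mu2 box2 w2 mb2 fin2 mw2 w2_01 _ (indices N)
  (fun i => onS (Yx i.1 i.2)) _ (indices_uniq N) D1 LY orth.
have LS : inS (fun p => \sum_(i <- indices N) ipS h (onS (Yx i.1 i.2)) * Yx i.1 i.2 (xi p.1 p.2)).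
  apply: (@inL2_sum _ _ _ mu2 box2 w2 mb2 fin2 mw2 w2_01) => i /LY Li.
  exact: (@inL2Z _ _ _ mu2 box2 w2 mb2 mw2 w2_01).
have LB : inS (fun p => f (xi p.1 p.2) - psum psi g N p.1 p.2).
  have N2 := @inL2Z _ _ _ mu2 box2 w2 mb2 mw2 w2_01 (- 1) _ LS.
  have := @inL2D _ _ _ mu2 box2 w2 mb2 mw2 w2_01 _ _ D1 N2.
  by apply: (@inL2_ext _ _ _ mu2 box2 w2) => p bp; rewrite hE//; congr (_ + _); rewrite mulN1r.
have -> : sqn mu2 box2 w2 (fun p => f (xi p.1 p.2) - hsum s (xi p.1 p.2)) = sqn mu2 box2 w2 h.
  by apply: (@sqn_ext _ _ _ mu2 box2 w2) => p _; rewrite /h mulN1r.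
rewrite (@sqnE _ _ _ mu2 box2 w2 w2_01 _ LB) (@sqnE _ _ _ mu2 box2 w2 w2_01 _ D1) lee_fin.
rewrite (@sqn_ext _ _ _ mu2 box2 w2 _ _ hE) B gerBl.
by apply: sumr_ge0 => i _; exact: sqmod_ge0.
Qed.

End Coefficients.
End Reconstruction.

Theorem theorem6 (R : realType) (psi : R) (f : 'cV[R]_3 -> R[i])
    (g : 'M[R]_3 -> R[i]) :
  0 < psi < pi ->
  (* f in L^2(S^2) *)
  cmeas (@box2 R) (fun p : R * R => f (xi p.1 p.2)) ->
  (L2S2 f < +oo)%E ->
  (* g in L^2(SO(3)) *)
  cmeas (@box3 R) (fun x : (R * R) * R => g (Qe x.1.1 x.1.2 x.2)) ->
  (L2SO3 g < +oo)%E ->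
  (* g = A_psi f, A_psi being the continuous extension from C(S^2) *)
  (exists fm : nat -> 'cV[R]_3 -> R[i],
      (forall m, ccontS2 (fm m)) /\
      to0 (fun m => L2S2 (fun x => fm m x - f x)) /\
      to0 (fun m => L2SO3 (fun Q => Arc psi (fm m) Q - g Q))) ->
  (* f = sum_n sum_k coef_{n,k} Y_n^k in L^2(S^2) *)
  to0 (fun N : nat =>
    (\int[@mu2 R]_(p in @box2 R)
       (sqmod (f (xi p.1 p.2) - psum psi g N p.1 p.2) * sin p.2)%:E)%E).
Proof.
move=> psi_range mf ff mg fg lim_fm.
have psi0 : 0 < psi by case/andP: psi_range.
have approx := simultaneous_approx psi0 mf mg lim_fm.
move=> e e0; have [s [vs Hs _]] := approx e e0.
(* From the largest degree in [s] onwards every partial sum is at least as close to [f] as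
   [hsum s]. *)
exists (\max_(p <- s) p.2.1)%N => N sN; apply: le_lt_trans Hs.
apply: (psum_near psi_range (conj mf ff) (conj mg fg) approx vs) => p ps.
by apply: leq_trans sN; exact: (leq_bigmax_seq (F := fun p => p.2.1)).
Qed.
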